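(* Let $\{(X(t),Y(t))\}_{t\ge0}$ be a reflecting orthogonal planar random motion with speed $c>0$ and changes of direction paced by a Poisson process with rate $\lambda(t)\in C^1\bigl((0,\infty),[0,\infty)\bigr)$ such that $\Lambda(t)=\int_0^t\lambda(s)\,ds<\infty$ for all $t>0$. Then the function $f$ defined by $f(\eta,t)\,d\eta=P\{X(t)+Y(t)=ct,\ X(t)-Y(t)\in d\eta\}$, for $|\eta|<ct$, satisfies the differential problem $$\begin{cases}\dfrac{\partial^2f}{\partial t^2}+2\lambda(t)\dfrac{\partial f}{\partial t}+\dfrac23\Bigl(\dfrac43\lambda(t)^2+\lambda'(t)\Bigr)f=c^2\dfrac{\partial^2f}{\partial\eta^2},\\[6pt] f(\eta,t)\ge0,\\[4pt] \displaystyle\int_{-ct}^{ct}f(\eta,t)\,d\eta=\frac12\bigl(e^{-2\Lambda(t)/3}-e^{-\Lambda(t)}\bigr).\end{cases}$$ The function $$f(\eta,t)=\frac{e^{-2\Lambda(t)/3}}{4}\,\bar p\Bigl(\frac\eta2,t\Bigr)$$ solves this problem, where $\bar p(x,t)$ is the absolutely continuous component of the distribution of a one-dimensional telegraph process with rate function $\lambda(t)/3$ and velocity $c/2$.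
   Context: Directions: $d_k=(\cos(k\pi/2),\sin(k\pi/2))$, $k=0,1,2,3$, with indices taken modulo 4. The reflecting orthogonal planar random motion with speed $c$ and rate function $\lambda$ is the position $(X(t),Y(t))$ of a particle that starts at the origin at time $0$ with initial direction uniformly distributed on $\{d_0,d_1,d_2,d_3\}$, moves with velocity $c\,d_k$ as long as its current direction is $d_k$, and at each event of a non-homogeneous Poisson process with rate function $\lambda(t)$ switches from its current direction $d_k$ to one of the other three directions, each with probability $1/3$ (independently of everything else). A one-dimensional (symmetric) telegraph process with velocity $v>0$ and rate function $\mu(t)$ is the position of a particle on $\mathbb{R}$ starting at $0$ with initial velocity $+v$ or $-v$, each with probability $1/2$, and reversing its velocity at each event of an independent non-homogeneous Poisson process with rate function $\mu(t)$.
   Formalization: For λ merely C¹ the second partials of f need not exist (e.g. λ(t)=1+max(0,t−1)²), so the differential equation is stated in the sense of distributions on |η|<ct for every C¹ rate λ, and pointwise with classical partial derivatives when λ is C² on (0,∞). *)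

(* Defs.v *)
From HB Require Import structures.
From mathcomp Require Import all_boot all_order all_algebra.
From mathcomp Require Import all_classical all_reals all_analysis.
Set Implicit Arguments.
Unset Strict Implicit.
Unset Printing Implicit Defensive.
Import Order.TTheory GRing.Theory Num.Theory.
Import numFieldNormedType.Exports.
Local Open Scope classical_set_scope.
Local Open Scope ring_scope.

(* Continuous differentiability on the open half-line ]0, +oo[; nothing is
   asked of l at 0 or on the negative half-line. *)
Definition C1_pos (R : realType) (l : R -> R) : Prop :=
  forall t : R, 0 < t -> derivable l t 1 /\ {for t, continuous l^`()%classic}.

Definition C2_pos (R : realType) (l : R -> R) : Prop :=
  C1_pos l /\ C1_pos l^`()%classic.

Definition cumulative_rate (R : realType) (l : R -> R) (t : R) : R :=
  \int[lebesgue_measure]_(s in `]0, t]) l s.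

(* The sigma-algebra generated by the variables Z i, i in D; generating it by
   the fibres is adequate for variables taking countably many values, the only
   ones it is used for. *)
Definition generated_sigma (Omega I T : Type) (D : set I)
    (Z : I -> Omega -> T) : set (set Omega) :=
  <<s [set A | exists i x, D i /\ A = [set w | Z i w = x] ] >>.

Definition independent_families d (Omega : measurableType d) (R : realType)
    (P : probability Omega R) (F G : set (set Omega)) : Prop :=
  forall A B, F A -> G B -> P (A `&` B) = (P A * P B)%E.

(* Only the values N t for t >= 0 matter. The Poisson weights are written out
   because the library's poisson_pmf is not a mass function at rate 0. *)
Definition poisson_process d (Omega : measurableType d) (R : realType)
    (P : probability Omega R) (mu : R -> R) (N : R -> Omega -> nat) : Prop :=
  [/\ forall t : R, 0 <= t -> measurable_fun [set: Omega] (N t),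
      (forall w, N 0 w = 0%N) /\
        (forall w (s t : R), 0 <= s -> s <= t -> (N s w <= N t w)%N),
      forall w (t : R), 0 <= t -> \forall s \near t^'+, N s w = N t w,
      forall (s t : R) k, 0 <= s -> s <= t ->
        let m := \int[lebesgue_measure]_(u in `]s, t]) mu u in
        P [set w | (N t w - N s w)%N = k] =
          (m ^+ k / k`!%:R * expR (- m))%:E
    & forall (n : nat) (t : nat -> R) (k : nat -> nat),
        0 <= t 0%N -> (forall i, t i <= t i.+1) ->
        P [set w | forall i, (i < n)%N -> (N (t i.+1) w - N (t i) w)%N = k i] =
          (\prod_(i < n) P [set w | (N (t i.+1) w - N (t i) w)%N = k i])%E].

(* K n is the direction followed after n switches: a Markov chain with uniform
   initial law that jumps to each of the other three states with probability
   1/3. *)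
Definition direction_chain d (Omega : measurableType d) (R : realType)
    (P : probability Omega R) (K : nat -> Omega -> 'I_4) : Prop :=
  (forall n k, measurable [set w | K n w = k]) /\
  (forall (n : nat) (k : nat -> 'I_4),
     P [set w | forall i, (i <= n)%N -> K i w = k i] =
       (4^-1 * \prod_(i < n) (if k i.+1 == k i then 0 else 3^-1))%:E).

Definition reflecting_motion d (Omega : measurableType d) (R : realType)
    (P : probability Omega R) (c : R) (l : R -> R)
    (X Y : R -> Omega -> R) : Prop :=
  exists (N : R -> Omega -> nat) (K : nat -> Omega -> 'I_4),
    [/\ poisson_process P l N, direction_chain P K,
        independent_families P
          (generated_sigma [set t : R | 0 <= t] N)
          (generated_sigma [set: nat] K),
        (forall (t : R) w, 0 <= t -> X t w = c *
          \int[lebesgue_measure]_(s in `[0, t])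
             cos ((K (N s w) w)%:R * pi / 2))
      & (forall (t : R) w, 0 <= t -> Y t w = c *
          \int[lebesgue_measure]_(s in `[0, t])
             sin ((K (N s w) w)%:R * pi / 2))].

Definition telegraph_process d (Omega : measurableType d) (R : realType)
    (P : probability Omega R) (v : R) (mu : R -> R)
    (S : R -> Omega -> R) : Prop :=
  exists (N : R -> Omega -> nat) (V : Omega -> R),
    [/\ poisson_process P mu N,
        forall w, V w = v \/ V w = - v,
        (forall x, measurable [set w | V w = x]) /\
          P [set w | V w = v] = (2^-1)%:E /\ P [set w | V w = - v] = (2^-1)%:E,
        independent_families P
          (generated_sigma [set t : R | 0 <= t] N)
          (generated_sigma [set: unit] (fun=> V))
      & forall (t : R) w, 0 <= t -> S t w =
          \int[lebesgue_measure]_(s in `[0, t]) (V w * (-1) ^+ N s w)].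

(* f(eta,t) d eta = P{X(t) + Y(t) = ct, X(t) - Y(t) in d eta} for |eta| < ct;
   continuity in eta selects the version of the density that is meant, and
   determines f on |eta| < ct. *)
Definition edge_density d (Omega : measurableType d) (R : realType)
    (P : probability Omega R) (c : R) (X Y : R -> Omega -> R)
    (f : R -> R -> R) : Prop :=
  forall t : R, 0 < t ->
    (forall eta : R, `|eta| < c * t -> {for eta, continuous (f^~ t)}) /\
    (forall A : set R, measurable A -> A `<=` `](- (c * t)), (c * t)[ ->
       P [set w | X t w + Y t w = c * t /\ A (X t w - Y t w)] =
         (\int[lebesgue_measure]_(eta in A) (f eta t)%:E)%E).

(* p(., t) is a density of the absolutely continuous part in the Lebesgue
   decomposition of the law of S t, in its version continuous on
   the open range ]-vt, vt[. *)
Definition ac_component d (Omega : measurableType d) (R : realType)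
    (P : probability Omega R) (v : R) (S : R -> Omega -> R)
    (p : R -> R -> R) : Prop :=
  forall t : R, 0 < t ->
    [/\ forall x : R, `|x| < v * t -> {for x, continuous (p^~ t)},
        measurable_fun [set: R] (p^~ t)
      & exists nu : {measure set (measurableTypeR R) -> \bar R},
          (exists Z : set R, [/\ measurable Z,
             lebesgue_measure Z = 0%E & nu (~` Z) = 0%E]) /\
          (forall A : set R, measurable A ->
             P [set w | A (S t w)] =
               (\int[lebesgue_measure]_(x in A) (p x t)%:E + nu A)%E)].

(* Functions of (eta, t) are curried, in this order. *)
Definition d_eta (R : realType) (f : R -> R -> R) : R -> R -> R :=
  fun eta t => (f^~ t)^`()%classic eta.

Definition d_t (R : realType) (f : R -> R -> R) : R -> R -> R :=
  fun eta t => (f eta)^`()%classic t.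

(* As c > 0, this is contained in t > 0. *)
Definition cone (R : realType) (c : R) : set (R * R) :=
  [set p | `|p.1| < c * p.2].

Definition pde_classical (R : realType) (c : R) (l : R -> R)
    (f : R -> R -> R) : Prop :=
  forall eta t : R, `|eta| < c * t ->
    [/\ derivable (f eta) t 1 /\ derivable (d_t f eta) t 1,
        derivable (f^~ t) eta 1 /\ derivable ((d_eta f)^~ t) eta 1
      & d_t (d_t f) eta t + 2 * l t * d_t f eta t
          + 2 / 3 * (4 / 3 * l t ^+ 2 + l^`()%classic t) * f eta t
        = c ^+ 2 * d_eta (d_eta f) eta t].

(* The letters true and false stand for d/dt and d/deta. *)
Fixpoint iter_partial (R : realType) (a : seq bool) (phi : R -> R -> R)
    : R -> R -> R :=
  match a with
  | [::] => phi
  | b :: a' => (if b then @d_t R else @d_eta R) (iter_partial a' phi)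
  end.

Definition smooth2 (R : realType) (phi : R -> R -> R) : Prop :=
  forall (a : seq bool) (p : R * R),
    differentiable (fun q : R * R => iter_partial a phi q.1 q.2) p.

Definition test_function (R : realType) (D : set (R * R))
    (phi : R -> R -> R) : Prop :=
  smooth2 phi /\
  exists C : set (R * R), [/\ compact C, C `<=` D
    & forall p, ~ C p -> phi p.1 p.2 = 0].

(* The equation in the sense of distributions on the cone: the operator is
   transposed onto the test function. *)
Definition pde_distributional (R : realType) (c : R) (l : R -> R)
    (f : R -> R -> R) : Prop :=
  (forall p, cone c p -> {for p, continuous (fun q : R * R => f q.1 q.2)}) /\
  (forall phi, test_function (cone c) phi ->
     \int[(@lebesgue_measure R \x @lebesgue_measure R)%E]_(p in cone c)
       (f p.1 p.2 *
         (d_t (d_t phi) p.1 p.2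
          - 2 * d_t (fun eta t => l t * phi eta t) p.1 p.2
          + 2 / 3 * (4 / 3 * l p.2 ^+ 2 + l^`()%classic p.2) * phi p.1 p.2
          - c ^+ 2 * d_eta (d_eta phi) p.1 p.2)) = 0).

(* For l merely C1, the second partial derivatives of the density need not
   exist: its one-switch term is a multiple of
     expR (- cumulative_rate l t) * (l ((t + eta / c) / 2) + l ((t - eta / c) / 2)).
   The equation is then meant in the sense of distributions; for l of class C2
   it is required to hold pointwise as well. *)
Definition solves_problem (R : realType) (c : R) (l : R -> R)
    (f : R -> R -> R) : Prop :=
  [/\ pde_distributional c l f,
      C2_pos l -> pde_classical c l f,
      forall eta t : R, `|eta| < c * t -> 0 <= f eta t
    & forall t : R, 0 < t ->
        (\int[lebesgue_measure]_(eta in `](- (c * t))%R, (c * t)%R[)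
           (f eta t)%:E)%E =
        (2^-1 * (expR (- (2 * cumulative_rate l t / 3))
                 - expR (- cumulative_rate l t)))%:E].

(* Main.v *)
Require Import Defs.
From HB Require Import structures.
From mathcomp Require Import all_boot all_order all_algebra.
From mathcomp Require Import all_classical all_reals all_analysis.
From mathcomp Require Import measurable_realfun zify ring lra.
Import Order.TTheory GRing.Theory Num.Theory.
Import numFieldNormedType.Exports.
Set Implicit Arguments.
Unset Strict Implicit.
Unset Printing Implicit Defensive.
Local Open Scope classical_set_scope.
Local Open Scope ring_scope.

(** Both laws of the statement come from one object: the joint law of the number
    of switches of a Poisson clock and of the time that an alternating path has
    spent, up to t, in the state that is not the current one ([other_time]). A
    switch exchanges this time with the time spent in the current state.
    Conditioning on the last switch therefore yields the recursion of
    [switch_density]: on n.+1 switches of a clock of rate m, the time in the other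
    state has the density [switch_density m n (t - v) v] in v, up to the factor
    exp (- M t), where M is the primitive of m ([switch_law]). For the proof, the
    mean of a Lipschitz function of this time on the event of n.+1 switches,
    multiplied by exp (M t), is compared with the integral given by the recursion.
    In a short interval there is no switch, or one, or two or more with a
    probability quadratic in the increment of M, so the difference has increments
    of second order and is constant ([compensated_mean_integral]).

    Let l = 3 k. The reflecting particle lies on the edge X + Y = c t if and only if
    it has used no direction but d_0 and d_1, hence has alternated between them. A
    given alternating path with n switches has probability 4^-1 3^-n. Since
    [switch_density] with n.+1 switches is homogeneous of degree n.+1 in the rate,
    the weights 3^-n turn the rate l into k, and summation over n gives the function
    G = [density k], with G u v = k v + int_0^u k (s + v) G v s ds. A telegraph
    process of rate k uses all its paths, so its density is made of the same G. With
    u = (t + eta / c) / 2 and v = (t - eta / c) / 2, the density on the edge is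
    exp (- 3 K t) (G u v + G v u) / (8 c), where K is the primitive of k
    ([edge_law]); it differs from that of the telegraph process by the factor
    exp (- 2 K t) / 4 and the scale of length ([telegraph_law],
    [telegraph_density_edge]). A continuous density is determined by the law, which
    transfers all this to any version of the two densities.

    The integral equation gives d_u G u v = k (u + v) G v u, which in the variables
    (eta, t) is a hyperbolic system for the two densities f+ and f- of the particles
    moving in the directions d_0 and d_1:
    f+_t + c f+_eta = - l f+ + (l / 3) f- and f-_t - c f-_eta = - l f- + (l / 3) f+.
    If l is of class C2, then G has second derivatives along lines and the equation
    follows by elimination ([edge_pde]). If l is only of class C1, the product of
    f+ + f- and of the transposed operator applied to a test function is the
    divergence of a field that contains no derivative of f+ and f-; its integral
    vanishes by [divergence0] ([edge_pde_distributional]). The total mass is the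
    exponential series of K without its first term ([poisson_mass],
    [edge_mass]). *)

(** * Affine changes of variable and Riemann sums *)

Lemma integrable_bounded d (T : measurableType d) (R : realType)
    (m : {measure set T -> \bar R}) (D : set T) (f : T -> R) (B : R) :
  measurable D -> (m D < +oo)%E -> measurable_fun D f ->
  (forall x, D x -> `|f x| <= B) -> m.-integrable D (EFin \o f).
Proof.
move=> mD finD mf fB.
have [D0|/set0P[x0 Dx0]] := eqVneq D set0.
  by rewrite D0; exact: integrable_set0.
have B0 : 0 <= B by apply: le_trans (fB _ Dx0).
apply: (@le_integrable _ _ _ m _ mD _ (EFin \o cst B)).
- exact/measurable_EFinP.
- by move=> x Dx /=; rewrite lee_fin (ger0_norm B0) fB.
- apply/integrableP; split; first by apply/measurable_EFinP; exact: measurable_cst.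
  rewrite (_ : (fun _ => _) = cst (B%:E)); last first.
    by apply/funext => x /=; rewrite ger0_norm.
  by rewrite integral_cst// lte_mul_pinfty.
Qed.

Section affine.
Context {R : realType}.
Local Notation mu := (@lebesgue_measure R).

Lemma preimage_affine_itv (a b x y : R) : 0 < a ->
  (fun z => a * z + b) @^-1` `]x, y] = `](x - b) / a, (y - b) / a]%classic.
Proof.
move=> a0; apply/seteqP; split=> z /=; rewrite !in_itv/= ltr_pdivrMr// ler_pdivlMr//;
  by rewrite ltrBlDr lerBrDr (mulrC z).
Qed.

Lemma preimage_affine_itvN (a b x y : R) : a < 0 ->
  (fun z => a * z + b) @^-1` `]x, y] = `[(y - b) / a, (x - b) / a[%classic.
Proof.
move=> a0; apply/seteqP; split=> z /=; rewrite !in_itv/= ltr_ndivlMr// ler_ndivrMr//;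
  by rewrite ltrBlDr lerBrDr (mulrC z) andbC.
Qed.

Lemma measurable_affine (a b : R) : measurable_fun [set: R] (fun z : R => a * z + b).
Proof. by apply: measurable_funD => //; exact: measurable_funM. Qed.

Lemma lebesgue_affine (a b : R) : a != 0 -> forall A : set R, measurable A ->
  mu A = (`|a|%:E * mu ((fun z => (a * z + b)%R) @^-1` A))%E.
Proof.
move=> a0 A mA.
pose a1 : {nonneg R} := NngNum (normr_ge0 a).
pose nu0 : {measure set (measurableTypeR R) -> \bar R} :=
  pushforward mu (fun z : measurableTypeR R => (a * z + b : measurableTypeR R)).
pose nu : {measure set (measurableTypeR R) -> \bar R} := mscale a1 (nu0 (measurable_affine a b)).
rewrite (@lebesgue_measure_unique R nu)//.
move=> X [[x y] xy <-] /=.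
rewrite /nu /mscale/= /pushforward/=.
have [ax|ax|ax] := ltgtP a 0; last by rewrite ax eqxx in a0.
- rewrite preimage_affine_itvN// !lebesgue_measure_itv/= !lte_fin.
  rewrite ltr_nM2r ?invr_lt0// ltrD2r; case: ifPn => [_|]; last by rewrite mule0.
  rewrite -!EFinB -EFinM ltr0_norm//; congr EFin; field.
  exact: ltr0_neq0.
- rewrite preimage_affine_itv// !lebesgue_measure_itv/= !lte_fin.
  rewrite ltr_pM2r ?invr_gt0// ltrD2r; case: ifPn => [_|]; last by rewrite mule0.
  rewrite -!EFinB -EFinM gtr0_norm//; congr EFin; field.
  exact: lt0r_neq0.
Qed.

Lemma ge0_integral_affine (a b : R) (f : R -> \bar R) : a != 0 ->
  measurable_fun [set: R] f -> (forall x, (0 <= f x)%E) ->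
  (\int[mu]_x f x = `|a|%:E * \int[mu]_x f (a * x + b)%R)%E.
Proof.
move=> a0 mf f0.
pose a1 : {nonneg R} := NngNum (normr_ge0 a).
pose nu0 : {measure set (measurableTypeR R) -> \bar R} :=
  pushforward mu (fun z : measurableTypeR R => (a * z + b : measurableTypeR R)).
pose nu : {measure set (measurableTypeR R) -> \bar R} := mscale a1 (nu0 (measurable_affine a b)).
rewrite (@eq_measure_integral _ _ _ _ nu mu); last first.
  by move=> A mA _; exact: (lebesgue_affine b a0 mA).
rewrite ge0_integral_mscale//; congr (_ * _)%E.
rewrite ge0_integral_pushforward//.
exact: measurable_affine.
Qed.
End affine.

Section riemann.
Context {R : realType}.
Local Notation mu := (@lebesgue_measure R).

(** Regularity of the paths of a counting process; nothing is implied on the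
    left of a time. *)
Definition right_constant (z : R -> R) := forall s, 0 <= s ->
  \forall s' \near s^'+, z s' = z s.

Definition grid (t : R) (k i : nat) : R := t * i%:R / k.+1%:R.

Definition step (t : R) (z : R -> R) (k : nat) (s : R) : R :=
  \sum_(i < k.+1) z (grid t k i.+1) * \1_(`]grid t k i, grid t k i.+1]%classic) s.

Implicit Types (t s : R) (z : R -> R) (k : nat).

Lemma grid_lt t k i j : 0 < t -> (i < j)%N -> grid t k i < grid t k j.
Proof.
move=> t0 ij; rewrite /grid ltr_pM2r ?invr_gt0 ?ltr0n// ltr_pM2l//.
by rewrite ltr_nat.
Qed.

Lemma grid_le t k i j : 0 <= t -> (i <= j)%N -> grid t k i <= grid t k j.
Proof.
move=> t0 ij; rewrite /grid ler_pM2r ?invr_gt0 ?ltr0n// ler_wpM2l//.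
by rewrite ler_nat.
Qed.

Lemma grid0 t k : grid t k 0 = 0. Proof. by rewrite /grid mulr0 mul0r. Qed.

Lemma gridS t k : grid t k k.+1 = t.
Proof. by rewrite /grid mulfK// pnatr_eq0. Qed.

Lemma grid_step t k i : grid t k i.+1 - grid t k i = t / k.+1%:R.
Proof. by rewrite /grid -natr1; field; rewrite addrC natr1 pnatr_eq0. Qed.

Lemma grid_cell t k s : 0 < s -> s <= t -> exists2 i : 'I_k.+1,
  grid t k i < s & s <= grid t k i.+1.
Proof.
move=> s0 st; have t0 : 0 < t := lt_le_trans s0 st.
have ex : exists n, s <= grid t k n by exists k.+1; rewrite gridS.
case: (ex_minnP ex) => -[|i] hi hmin.
  by move: hi; rewrite grid0 leNgt s0.
have ik : (i < k.+1)%N by apply: hmin; rewrite gridS.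
exists (Ordinal ik) => //=.
by rewrite ltNge; apply/negP => /hmin; rewrite ltnn.
Qed.

Lemma step_cell t z k s (i : 'I_k.+1) : 0 < t -> grid t k i < s -> s <= grid t k i.+1 ->
  step t z k s = z (grid t k i.+1).
Proof.
move=> t0 si1 si; rewrite /step (bigD1 i)//= indicE mem_set/= ?in_itv/= ?si1// mulr1.
rewrite big1 ?addr0// => j ji; rewrite indicE memNset ?mulr0//= in_itv/= => /andP[js sj].
have [ij|ij|/val_inj ij] := ltngtP i j; last by rewrite ij eqxx in ji.
- have := lt_le_trans js si; rewrite ltNge grid_le//; exact: ltW.
- have := lt_le_trans si1 sj; rewrite ltNge grid_le//; exact: ltW.
Qed.

Lemma step_bounded t z k s B : 0 < t -> (forall s, `|z s| <= B) -> 0 < s <= t ->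
  `|step t z k s| <= B.
Proof.
move=> t0 zB /andP[s0 st].
have [i h1 h2] := grid_cell k s0 st.
by rewrite (step_cell _ t0 h1 h2).
Qed.

(** The right end of the cell of s tends to s from the right, where z is
    constant. *)
Lemma cvg_step t z s : 0 < s <= t -> right_constant z ->
  step t z k s @[k --> \oo] --> z s.
Proof.
move=> /andP[s0 st] rz; have t0 : 0 < t := lt_le_trans s0 st.
have [/= e e0 he] := rz _ (ltW s0).
apply: cvg_near_cst.
have [k0 hk0] : exists k0 : nat, t / e < k0%:R.
  by exists (Num.bound (t / e)); apply: archi_boundP; rewrite divr_ge0// ltW.
exists k0 => // k /= k0k.
have [i h1 h2] := grid_cell k s0 st.
rewrite (step_cell _ t0 h1 h2).
move: h2; rewrite le_eqVlt => /predU1P[<-//|h2].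
apply: he => //=; rewrite distrC gtr0_norm ?subr_gt0//.
have -> : grid t k i.+1 - s = (grid t k i.+1 - grid t k i) + (grid t k i - s) by ring.
rewrite grid_step.
have : t / k.+1%:R < e.
  rewrite ltr_pdivrMr ?ltr0n// mulrC -ltr_pdivrMr//.
  by apply: (lt_le_trans hk0); rewrite ler_nat; exact: leqW.
move: (t / k.+1%:R) (grid t k i) h1 => x y; lra.
Qed.

Lemma measurable_step t z k : measurable_fun [set: R] (step t z k).
Proof.
rewrite /step; apply: measurable_sum => i.
by apply: measurable_funM => //; exact: measurable_indic.
Qed.

Lemma right_constant_measurable t z : 0 < t -> right_constant z ->
  measurable_fun `]0, t] z.
Proof.
move=> t0 rz; apply: (@measurable_fun_cvg _ _ _ _ (step t z)).
  by move=> k; apply: measurable_funS (measurable_step t z k).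
by move=> s /=; rewrite in_itv/= => st; exact: cvg_step.
Qed.

Lemma Rintegral_sum d (T : measurableType d) (m : {measure set T -> \bar R}) (D : set T)
  (I : Type) (r : seq I) (f : I -> T -> R) : measurable D ->
  (forall i, m.-integrable D (EFin \o f i)) ->
  m.-integrable D (EFin \o (fun x => \sum_(i <- r) f i x)) /\
  \int[m]_(x in D) (\sum_(i <- r) f i x) = \sum_(i <- r) \int[m]_(x in D) f i x.
Proof.
move=> mD intf; elim: r => [|i r [IH1 IH2]].
  rewrite big_nil; under eq_Rintegral do rewrite big_nil.
  under [X in integrable _ _ (EFin \o X)]eq_fun do rewrite big_nil.
  split; last by rewrite Rintegral_cst// mul0r.
  exact: integrable0.
under [X in integrable _ _ (EFin \o X)]eq_fun do rewrite big_cons.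
under eq_Rintegral do rewrite big_cons.
split; last by rewrite RintegralD// big_cons IH2.
rewrite (_ : _ \o _ = ((EFin \o f i) \+ (EFin \o (fun x => \sum_(j <- r) f j x)%R)))%E.
  exact: integrableD.
by apply/funext => x /=; rewrite EFinD.
Qed.

Lemma integral_step t z k : 0 < t ->
  \int[mu]_(s in `]0, t]) step t z k s = t / k.+1%:R * \sum_(i < k.+1) z (grid t k i.+1).
Proof.
move=> t0; rewrite /step.
have mI : measurable (`]0, t]%classic : set R) by [].
have finI : (mu `]0%R, t]%classic < +oo)%E.
  by rewrite lebesgue_measure_itv/=; case: ifP; rewrite // ltry.
have int1 (i : 'I_k.+1) : mu.-integrable `]0, t] (EFin \o (\1_(`]grid t k i, grid t k i.+1]%classic) : R -> R)).
  apply: (@integrable_bounded _ _ _ _ _ _ 1) => //.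
  by move=> s _ /=; rewrite indicE; case: (_ \in _); rewrite ?normr1 ?normr0.
pose F (i : 'I_k.+1) (s : R) := z (grid t k i.+1) * \1_(`]grid t k i, grid t k i.+1]%classic) s.
have iF (i : 'I_k.+1) : mu.-integrable `]0, t] (EFin \o F i).
  rewrite (_ : _ \o _ = (fun x => (z (grid t k i.+1))%:E * (EFin \o (\1_(`]grid t k i, grid t k i.+1]%classic) : R -> R)) x)%E).
    exact: integrableZl.
  by apply/funext => s /=; rewrite EFinM.
rewrite (@Rintegral_sum _ (measurableTypeR R) mu `]0, t] _ (index_enum _) F mI iF).2.
rewrite mulr_sumr; apply: eq_bigr => i _.
rewrite RintegralZl// mulrC; congr (_ * _).
rewrite /Rintegral integral_indic//.
rewrite (_ : _ `&` _ = `]grid t k i, grid t k i.+1]%classic).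
  transitivity (fine (mu `]grid t k i, grid t k i.+1]%classic)) => //.
  by rewrite lebesgue_measure_itv/= lte_fin grid_lt// -EFinB/= grid_step.
apply/seteqP; split=> [s [] //|s /=]; rewrite !in_itv/= => /andP[a b]; rewrite a b; split=> //.
apply/andP; split; first by rewrite (le_lt_trans _ a)// -(grid0 t k) grid_le// ltW.
by rewrite (le_trans b)// -[leRHS](gridS t k) grid_le// ltW.
Qed.

Lemma cvg_riemann t z B : 0 < t -> right_constant z -> (forall s, `|z s| <= B) ->
  t / k.+1%:R * \sum_(i < k.+1) z (grid t k i.+1) @[k --> \oo] -->
  \int[mu]_(s in `[0, t]) z s.
Proof.
move=> t0 rz zB.
have mI : measurable (`]0, t]%classic : set R) by [].
have finI : (mu `]0%R, t]%classic < +oo)%E.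
  by rewrite lebesgue_measure_itv/=; case: ifP; rewrite // ltry.
under eq_cvg do rewrite -integral_step//.
have [|||||intz _ h] := @dominated_convergence _ _ _ mu `]0, t] mI (fun k => EFin \o step t z k) (EFin \o z) (EFin \o cst B).
- by move=> k; apply/measurable_EFinP; exact: measurable_funTS (measurable_step t z k).
- by apply/measurable_EFinP; exact: right_constant_measurable.
- apply: aeW => s /=; rewrite in_itv/= => st; apply: cvg_EFin; first exact: nearW.
  exact: cvg_step.
- apply: (@integrable_bounded _ _ _ _ _ _ B) => // s _ /=.
  by rewrite ger0_norm//; apply: le_trans (zB 0).
- apply: aeW => s k /=; rewrite in_itv/= => st; rewrite lee_fin; exact: step_bounded.
rewrite -Rintegral_itv_obnd_cbnd//.
apply: fine_cvg; rewrite fineK//; exact: integrable_fin_num.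
Qed.

(** As a limit of Riemann sums over fixed sampling times, the integral inherits
    measurability from the single variables Z s, for any sigma-algebra that
    makes them measurable. This will be used for the sigma-algebra of the
    events and for the one generated by the process. *)
Lemma measurable_Rintegral_path d (Omega : measurableType d) (Z : R -> Omega -> R) B t :
  0 <= t -> (forall s, 0 <= s -> measurable_fun [set: Omega] (Z s)) ->
  (forall w, right_constant (Z ^~ w)) -> (forall s w, `|Z s w| <= B) ->
  measurable_fun [set: Omega] (fun w => \int[mu]_(s in `[0, t]) Z s w).
Proof.
rewrite le_eqVlt => /predU1P[<- _ _ _|t0 mZ rZ ZB].
  by under eq_fun do rewrite set_itv1 Rintegral_set1; exact: measurable_cst.
apply: (@measurable_fun_cvg _ _ _ _
  (fun k w => t / k.+1%:R * \sum_(i < k.+1) Z (grid t k i.+1) w)).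
  move=> k; apply: measurable_funM => //; apply: measurable_sum => i.
  by apply: mZ; rewrite -(grid0 t k) grid_le// ltW.
by move=> w _; exact: (cvg_riemann t0 (rZ w) (fun s => ZB s w)).
Qed.
End riemann.

Lemma indic_iff (R : realType) (T T' : Type) (A : set T) (B : set T') w w' :
  (A w <-> B w') -> \1_A w = \1_B w' :> R.
Proof.
move=> AB; rewrite !indicE.
have [Aw|nAw] := pselect (A w); first by rewrite !mem_set//; exact/AB.
by rewrite !memNset//; apply: contra_not nAw => /AB.
Qed.

Section integrable_EFin.
Context d (T : measurableType d) (R : realType) (mu : {measure set T -> \bar R}).
Variables (D : set T) (mD : measurable D) (f g : T -> R).
Hypotheses (intf : mu.-integrable D (EFin \o f)) (intg : mu.-integrable D (EFin \o g)).

Lemma integrable_EFinD : mu.-integrable D (EFin \o (fun x => f x + g x)).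
Proof.
rewrite (_ : _ \o _ = (EFin \o f) \+ (EFin \o g))%E; first exact: integrableD.
by apply/funext => x /=; rewrite EFinD.
Qed.

Lemma integrable_EFinB : mu.-integrable D (EFin \o (fun x => f x - g x)).
Proof.
rewrite (_ : _ \o _ = (EFin \o f) \- (EFin \o g))%E; first exact: integrableB.
by apply/funext => x /=; rewrite EFinB.
Qed.

Lemma integrable_EFinZ (c : R) : mu.-integrable D (EFin \o (fun x => c * f x)).
Proof.
rewrite (_ : _ \o _ = (fun x => c%:E * (EFin \o f) x)%E); first exact: integrableZl.
by apply/funext => x /=; rewrite EFinM.
Qed.
End integrable_EFin.

Section probability_bounded.
Context d (T : measurableType d) (R : realType) (P : probability T R).

Lemma probability_lty (A : set T) : measurable A -> (P A < +oo)%E.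
Proof. by move=> mA; rewrite -ge0_fin_numE// fin_num_measure. Qed.

Lemma integrable_probability (f : T -> R) (B : R) : measurable_fun [set: T] f ->
  (forall w, `|f w| <= B) -> P.-integrable setT (EFin \o f).
Proof.
move=> mf fB; apply: (@integrable_bounded _ _ _ _ _ _ B) => //.
exact: probability_lty.
Qed.

Lemma Rintegral_probability_cst (c : R) : \int[P]_(w in setT) c = c.
Proof.
rewrite Rintegral_cst//.
rewrite -[RHS]mulr1; congr (c * _).
exact: (congr1 fine (probability_setT P)).
Qed.

Lemma normr_indic_le (A : set T) (x : R) w : `|x| <= 1 -> `|x * \1_A w| <= 1.
Proof.
by move=> x1; rewrite indicE; case: (_ \in _); rewrite ?mulr1// mulr0 normr0.
Qed.

Lemma integrable_indic_probability (A : set T) : measurable A ->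
  P.-integrable setT (EFin \o (\1_A : T -> R)).
Proof.
move=> mA; apply: (@integrable_probability _ 1); first exact: measurable_indic.
by move=> w; rewrite -[X in `|X|]mul1r normr_indic_le// normr1.
Qed.
End probability_bounded.

(** * Counting paths *)

Section bounded_itv.
Context {R : realType}.
Local Notation mu := (@lebesgue_measure R).

Lemma lebesgue_itvcc_lty (a b : R) : (mu `[a, b]%classic < +oo)%E.
Proof. by rewrite lebesgue_measure_itv/=; case: ifP; rewrite // ltry. Qed.

Lemma integrable_bounded_itv (a b : R) (f : R -> R) (B : R) :
  measurable_fun `[a, b] f -> (forall x, a <= x <= b -> `|f x| <= B) ->
  mu.-integrable `[a, b] (EFin \o f).
Proof.
move=> mf fB; apply: (@integrable_bounded _ _ _ mu _ _ B) => //.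
  exact: lebesgue_itvcc_lty.
Qed.

Lemma integrable_cst_itv (a b : R) (c : R) : mu.-integrable `[a, b] (EFin \o (fun=> c)).
Proof. by apply: (@integrable_bounded_itv _ _ _ `|c|) => //. Qed.

Lemma Rintegral_itv_cst (s t : R) (c : R) : s <= t ->
  \int[mu]_(_ in `[s, t]) c = c * (t - s).
Proof.
move=> st; rewrite Rintegral_cst//; congr (_ * _).
transitivity (fine (mu `[s, t]%classic)) => //.
rewrite lebesgue_measure_itv/= lte_fin; case: ltP => [_|].
  by rewrite -EFinB/=.
by move=> t1; apply/esym/eqP; rewrite subr_eq0 eq_le t1.
Qed.
End bounded_itv.

Section rate.
Context {R : realType}.
Local Notation mu := (@lebesgue_measure R).
Variable m : R -> R.
Hypothesis mm : measurable_fun [set: R] m.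
Hypothesis m0 : forall s, 0 <= m s.
Hypothesis mi : forall t, mu.-integrable `]0, t] (EFin \o m).

Local Notation M := (cumulative_rate m).
Implicit Types (s t e C : R).

Lemma cumulative_rateB s t : 0 <= s -> s <= t ->
  \int[mu]_(u in `]s, t]) m u = M t - M s.
Proof.
by move=> s0 st; rewrite /cumulative_rate Rintegral_itvB//.
Qed.

Lemma cumulative_rate0 : M 0 = 0.
Proof. by rewrite /cumulative_rate set_itvoc0 Rintegral_set0. Qed.

Lemma cumulative_rate_le s t : 0 <= s -> s <= t -> M s <= M t.
Proof.
by move=> s0 st; rewrite -subr_ge0 -cumulative_rateB//; exact: Rintegral_ge0.
Qed.

Lemma cumulative_rate_ge0 t : 0 <= M t.
Proof. exact: Rintegral_ge0. Qed.

(** Absolute continuity of the integral. *)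
Lemma cumulative_rate_mesh t : 0 < t -> forall e, 0 < e ->
  \forall k \near \oo, forall i : nat, (i < k.+1)%N -> M (grid t k i.+1) - M (grid t k i) <= e.
Proof.
move=> t0 e e0.
have intm : mu.-integrable setT (EFin \o (m \_ `]0, t]%classic)).
  by rewrite -restrict_EFin; apply/integrable_restrict => //=; rewrite setTI.
have [del [del0 hdel]] := integral_normr_continuous intm e0.
exists (Num.bound (t / del)) => // k /= hk i ik.
have g0 : 0 <= grid t k i by rewrite -(grid0 t k) grid_le// ltW.
have gt : grid t k i.+1 <= t by rewrite -[leRHS](gridS t k) grid_le// ltW.
rewrite -cumulative_rateB//; last by rewrite grid_le// ltW.
have -> : \int[mu]_(u in `]grid t k i, grid t k i.+1]) m u =
    \int[mu]_(u in `]grid t k i, grid t k i.+1]) `|(m \_ `]0, t]%classic) u|.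
  apply: eq_Rintegral => u; rewrite inE/= in_itv/= => /andP[u1 u2].
  rewrite patchE mem_set ?ger0_norm//= in_itv/= (le_lt_trans g0 u1)/=.
  exact: le_trans gt.
apply/ltW/hdel => //.
change (mu `]grid t k i, grid t k i.+1]%classic < del%:E)%E.
rewrite lebesgue_measure_itv/= lte_fin grid_lt// -EFinB lte_fin grid_step.
rewrite ltr_pdivrMr ?ltr0n// mulrC -ltr_pdivrMr//.
rewrite (lt_le_trans (archi_boundP _))//; first by rewrite divr_ge0// ltW.
by rewrite ler_nat leqW.
Qed.

Lemma telescope_grid (F : R -> R) t k : F t - F 0 =
  \sum_(i < k.+1) (F (grid t k i.+1) - F (grid t k i)).
Proof.
rewrite -(big_mkord xpredT (fun i => F (grid t k i.+1) - F (grid t k i))).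
by rewrite telescope_sumr// gridS grid0.
Qed.

(** The counterpart, for the clock r + M r, of the fact that a function with
    increments of second order is constant: summed over a fine grid, the
    increments are at most the mesh times M t. *)
Lemma constant_of_second_order (F : R -> R) C t : 0 < t -> 0 <= C ->
  (forall r r', 0 <= r -> r <= r' -> r' <= t ->
    `|F r' - F r| <= C * ((r' - r) + (M r' - M r)) * (M r' - M r)) ->
  F t = F 0.
Proof.
move=> t0 C0 hF; apply/eqP; rewrite -subr_eq0 -normr_le0.
apply/ler_addgt0Pr => e e0; rewrite add0r.
have Mt : 0 <= M t := cumulative_rate_ge0 t.
pose e' := e / (C * M t + 1) / 2.
have D0 : 0 < C * M t + 1 by rewrite ltr_wpDl// mulr_ge0.
have e'0 : 0 < e' by rewrite !divr_gt0.
have [k0 _ hk0] := cumulative_rate_mesh t0 e'0.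
pose k := maxn k0 (Num.bound (t / e')).
have kk : t / k.+1%:R <= e'.
  rewrite ler_pdivrMr ?ltr0n// mulrC -ler_pdivrMr//.
  rewrite (le_trans (ltW (archi_boundP _)))//; first by rewrite divr_ge0// ltW.
  by rewrite ler_nat leqW// leq_maxr.
have {}hk0 := hk0 k (leq_maxl _ _).
rewrite (telescope_grid F t k) (le_trans (ler_norm_sum _ _ _))//.
apply: (@le_trans _ _ (\sum_(i < k.+1) C * (2 * e') * (M (grid t k i.+1) - M (grid t k i)))).
  apply: ler_sum => i _.
  have gi0 : 0 <= grid t k i by rewrite -(grid0 t k) grid_le// ltW.
  have gt : grid t k i.+1 <= t by rewrite -[leRHS](gridS t k) grid_le// ltW.
  have gii : grid t k i <= grid t k i.+1 by rewrite grid_le// ltW.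
  apply: le_trans (hF _ _ gi0 gii gt) _.
  have dM : 0 <= M (grid t k i.+1) - M (grid t k i).
    by rewrite subr_ge0 cumulative_rate_le.
  apply: ler_wpM2r => //; apply: ler_wpM2l => //.
  by rewrite grid_step [leRHS]mulr_natl mulr2n lerD// hk0.
rewrite -mulr_sumr -telescope_grid cumulative_rate0 subr0.
have -> : C * (2 * e') * M t = (C * M t) / (C * M t + 1) * e.
  by rewrite /e'; field; rewrite lt0r_neq0.
rewrite ler_piMl//; first exact: ltW.
by rewrite ler_pdivrMr// mul1r ler_wpDr.
Qed.
End rate.

Section poisson.
Context d (Omega : measurableType d) (R : realType) (P : probability Omega R).
Local Notation mu := (@lebesgue_measure R).
Variable m : R -> R.
Hypothesis mm : measurable_fun [set: R] m.
Hypothesis m0 : forall s, 0 <= m s.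
Hypothesis mi : forall t, mu.-integrable `]0, t] (EFin \o m).
Variable N : R -> Omega -> nat.
Hypothesis NP : poisson_process P m N.
Local Notation M := (cumulative_rate m).

Lemma poisson_measurable (t : R) : 0 <= t -> measurable_fun [set: Omega] (N t).
Proof. by case: NP => h _ _ _ _; exact: h. Qed.

Lemma poisson_le (s t : R) w : 0 <= s -> s <= t -> (N s w <= N t w)%N.
Proof. by case: NP => _ [_ h] _ _ _; exact: h. Qed.

Lemma poisson0 w : N 0 w = 0%N.
Proof. by case: NP => _ [h _] _ _ _; exact: h. Qed.

Lemma poisson_right_constant (f : nat -> R) w : right_constant (fun s => f (N s w)).
Proof.
move=> s s0; case: NP => _ _ h _ _; apply: filterS (h w s s0) => s' ->//.
Qed.

Lemma poisson_set_measurable (t : R) (A : set nat) : 0 <= t -> measurable [set w | A (N t w)].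
Proof.
move=> t0; rewrite (_ : [set _ | _] = N t @^-1` A)//.
by rewrite -[X in measurable X]setTI; exact: poisson_measurable.
Qed.

Lemma poisson_set2_measurable (s t : R) (A : nat -> nat -> Prop) : 0 <= s -> 0 <= t ->
  measurable [set w | A (N s w) (N t w)].
Proof.
move=> s0 t0.
rewrite (_ : [set w | _] = \bigcup_i ([set w | N s w = i] `&` [set w | A i (N t w)])).
  apply: bigcupT_measurable => i; apply: measurableI; first exact: (@poisson_set_measurable _ [set i]).
  exact: (@poisson_set_measurable _ (A i)).
by apply/seteqP; split => w /=; [move=> Aw; exists (N s w)|move=> [i _ /= [<-]]].
Qed.

Lemma poisson_fun2_measurable (f : nat -> nat -> R) (s t : R) : 0 <= s -> 0 <= t ->
  measurable_fun [set: Omega] (fun w => f (N s w) (N t w)).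
Proof.
move=> s0 t0 _ Y mY; rewrite setTI.
exact: (@poisson_set2_measurable _ _ (fun a b => Y (f a b))).
Qed.

Lemma poisson_incr (s t : R) k : 0 <= s -> s <= t ->
  P [set w | (N t w - N s w)%N = k] =
  ((M t - M s) ^+ k / k`!%:R * expR (- (M t - M s)))%:E.
Proof.
move=> s0 st; case: NP => _ _ _ h _; rewrite h//.
by rewrite -[\int[_]_(_ in _) _]/(\int[mu]_(u in `]s, t]) m u) cumulative_rateB.
Qed.

Lemma poisson_jump (s t : R) : 0 <= s -> s <= t ->
  (P [set w | N t w <> N s w] <= (M t - M s)%:E)%E.
Proof.
move=> s0 st; have t0 := le_trans s0 st.
have -> : [set w | N t w <> N s w] = ~` [set w | (N t w - N s w)%N = 0%N].
  apply/seteqP; split => w /=; apply: contra_not.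
    by move=> /eqP; rewrite subn_eq0 => h; apply/eqP; rewrite eqn_leq h poisson_le.
  by move=> ->; rewrite subnn.
rewrite probability_setC; last first.
  exact: (@poisson_set2_measurable _ _ (fun a b => (b - a)%N = 0%N)).
rewrite poisson_incr// expr0 fact0 divr1 mul1r -EFinB lee_fin.
by have := expR_ge1Dx (- (M t - M s)); lra.
Qed.

(** The probability is 1 - (1 + x) exp (- x) with x = M t - M s, and exp (- x)
    >= 1 - x. *)
Lemma poisson_jump2 (s t : R) : 0 <= s -> s <= t ->
  (P [set w | (2 <= N t w - N s w)%N] <= ((M t - M s) ^+ 2)%:E)%E.
Proof.
move=> s0 st; have t0 := le_trans s0 st.
set D := fun k => [set w | (N t w - N s w)%N = k].
have mD k : measurable (D k) by exact: (@poisson_set2_measurable _ _ (fun a b => (b - a)%N = k)).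
have -> : [set w | (2 <= N t w - N s w)%N] = ~` (D 0%N `|` D 1%N).
  apply/seteqP; split => w /=; rewrite /D/=.
    by case: (_ - _)%N => [//|[//|k]] _ [].
  by case: (_ - _)%N => [|[|k]]// h; exfalso; apply: h; [left|right].
rewrite probability_setC; last exact: measurableU.
have -> : P (D 0%N `|` D 1%N) =
    (expR (- (M t - M s)) + (M t - M s) * expR (- (M t - M s)))%:E.
  have D01 : D 0%N `&` D 1%N = set0.
    by apply/seteqP; split=> w //=; rewrite /D/= => -[->].
  rewrite (measureU _ (mD 0%N) (mD 1%N) D01) EFinD; congr (_ + _)%E.
    by rewrite [LHS](poisson_incr 0 s0 st) expr0 fact0 divr1 mul1r.
  by rewrite [LHS](poisson_incr 1 s0 st) expr1 divr1.
rewrite -EFinB lee_fin.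
set x := M t - M s.
have x0 : 0 <= x by rewrite subr_ge0 cumulative_rate_le.
have := expR_ge1Dx (- x) => hx.
have : (1 + x) * (1 + - x) <= (1 + x) * expR (- x) by rewrite ler_wpM2l// addr_ge0.
by rewrite expr2; nra.
Qed.

(** For a motion that alternates between two velocities, this is the time spent
    up to t in the velocity that is not the current one. Together with t it
    gives the position, and a switch exchanges it with the time spent in the
    current velocity. *)
Definition other_time (t : R) (w : Omega) : R :=
  \int[mu]_(s in `[0, t]) (odd (N s w) != odd (N t w))%:R.

Lemma normr_bool (b : bool) : `|b%:R : R| <= 1.
Proof. by case: b; rewrite ?normr1 ?normr0. Qed.

Lemma measurable_other_time (t : R) : 0 <= t -> measurable_fun [set: Omega] (other_time t).
Proof.
move=> t0; apply: (@measurable_Rintegral_path _ _ _ (fun s w => (odd (N s w) != odd (N t w))%:R) 1) => //.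
- by move=> s s0; exact: (@poisson_fun2_measurable (fun a b => (odd a != odd b)%:R)).
- by move=> w; exact: (@poisson_right_constant (fun a => (odd a != odd (N t w))%:R)).
- by move=> s w; exact: normr_bool.
Qed.

Lemma integrable_path (f : nat -> bool) (s t : R) w : 0 <= s ->
  mu.-integrable `[s, t] (EFin \o (fun u => (f (N u w))%:R)).
Proof.
move=> s0; have [ts|st] := ltP t s.
  by rewrite set_itv_ge ?bnd_simp -?ltNge//; exact: integrable_set0.
apply: (@integrable_bounded_itv _ _ _ _ 1); last by move=> x _; exact: normr_bool.
have [t0|t0] := leP t 0.
  have -> : t = s by apply/eqP; rewrite eq_le st (le_trans t0 s0).
  by rewrite set_itv1; exact: measurable_fun_set1.
apply: (@measurable_funS _ _ _ _ `[0, t]) => //.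
  by move=> x /=; rewrite !in_itv/= => /andP[/(le_trans s0)->].
apply/measurable_fun_itv_obnd_cbndP; apply: right_constant_measurable => //.
exact: (poisson_right_constant (fun a => (f a)%:R)).
Qed.

Lemma integral_path_itv (f : nat -> bool) (s t : R) w : 0 <= s -> s <= t ->
  0 <= \int[mu]_(u in `[s, t]) (f (N u w))%:R <= t - s.
Proof.
move=> s0 st; rewrite Rintegral_ge0//= -[t - s]mul1r -Rintegral_itv_cst//.
apply: le_Rintegral => //; first exact: integrable_path.
- exact: integrable_cst_itv.
- by move=> x _; case: (f _).
Qed.

Lemma integral_path_cat (f : nat -> bool) (s t : R) w : 0 <= s -> s <= t ->
  \int[mu]_(u in `[0, t]) (f (N u w))%:R =
  \int[mu]_(u in `[0, s]) (f (N u w))%:R + \int[mu]_(u in `[s, t]) (f (N u w))%:R :> R.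
Proof.
move=> s0 st.
have := @Rintegral_itvB R (fun u => (f (N u w))%:R) (BLeft 0) (BRight t) s (integrable_path f t w (lexx 0)).
rewrite !bnd_simp => /(_ s0 st).
rewrite Rintegral_itv_obnd_cbnd => [<-|]; first by rewrite addrC subrK.
apply: (integrableS _ _ _ (integrable_path f t w s0)) => //.
exact: subset_itv_oc_cc.
Qed.

Lemma other_time_same (r r' : R) w : 0 <= r -> r <= r' -> N r' w = N r w ->
  other_time r' w = other_time r w.
Proof.
move=> r0 rr' e.
rewrite /other_time e (@integral_path_cat (fun a => odd a != odd (N r w)) r)//.
rewrite -[RHS]addr0; congr (_ + _).
transitivity (\int[mu]_(u in `[r, r']) (0 : R)); last by rewrite Rintegral_cst// mul0r.
apply: eq_Rintegral => u; rewrite inE/= in_itv/= => /andP[ru ur].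
suff -> : N u w = N r w by rewrite eqxx.
by apply/eqP; rewrite eqn_leq -{1}e !poisson_le// (le_trans r0).
Qed.

(** A switch exchanges the two times; the error is the time elapsed since r. *)
Lemma other_time_switch (r r' : R) w : 0 <= r -> r <= r' -> N r' w = (N r w).+1 ->
  `|other_time r' w - (r - other_time r w)| <= r' - r.
Proof.
move=> r0 rr' e.
rewrite {1}/other_time e/= (@integral_path_cat (fun a => odd a != ~~ odd (N r w)) r)//.
have /andP[h1 h2] := @integral_path_itv (fun a => odd a != ~~ odd (N r w)) r r' w r0 rr'.
set I := \int[mu]_(u in `[r, r']) (odd (N u w) != ~~ odd (N r w))%:R in h1 h2 *.
suff -> : \int[mu]_(u in `[0, r]) (odd (N u w) != ~~ odd (N r w))%:R = r - other_time r w.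
  by rewrite addrC addKr ger0_norm.
transitivity (\int[mu]_(u in `[0, r]) (1 : R) - other_time r w); last first.
  by rewrite Rintegral_itv_cst// mul1r subr0.
rewrite /other_time -RintegralB//.
- apply: eq_Rintegral => u _; case: (odd _) (odd _) => -[] /=; by rewrite ?subr0 ?subrr.
- exact: integrable_cst_itv.
- exact: (integrable_path (fun a => odd a != odd (N r w))).
Qed.

Lemma other_time0 w : other_time 0 w = 0.
Proof. by rewrite /other_time set_itv1 Rintegral_set1. Qed.

(** The values at the grid points are prescribed by the increments before r,
    and the increments over successive intervals are independent. *)
Lemma poisson_grid_indep (r r' : R) k (w0 : Omega) j : 0 < r -> r <= r' ->
  let A := [set w | forall i : 'I_k.+2, N (grid r k i) w = N (grid r k i) w0] in
  let J := [set w | (N r' w - N r w)%N = j] in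
  P (A `&` J) = (P A * P J)%E.
Proof.
move=> r0 rr' A J.
pose t i := if (i <= k.+1)%N then grid r k i else r'.
pose kk i := if (i <= k)%N then (N (grid r k i.+1) w0 - N (grid r k i) w0)%N else j.
case: NP => _ _ _ _ ind.
have t0 : 0 <= t 0%N by rewrite /t grid0.
have tt i : t i <= t i.+1.
  rewrite /t; case: (ltngtP i k.+1) => [ik|ik|->]; rewrite ?lexx//.
  - by rewrite grid_le// ltW.
  - by rewrite gridS.
have g0 i : 0 <= grid r k i by rewrite -(grid0 r k) grid_le// ltW.
have h1 := ind k.+2 t kk t0 tt.
have h2 := ind k.+1 t kk t0 tt.
rewrite big_ord_recr/= in h1.
rewrite -h2 in h1.
have tE i : (i <= k.+1)%N -> t i = grid r k i by rewrite /t => ->.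
have kkE i : (i <= k)%N -> kk i = (N (grid r k i.+1) w0 - N (grid r k i) w0)%N.
  by rewrite /kk => ->.
have Ngi i w : (N (grid r k i) w <= N (grid r k i.+1) w)%N.
  by apply: poisson_le => //; exact: (grid_le _ (ltW r0) (leqnSn _)).
have EA : [set w | forall i, (i < k.+1)%N -> (N (t i.+1) w - N (t i) w)%N = kk i] = A.
  apply/seteqP; split => w /= h.
    move=> [i /= ik]; elim: i ik => [|i IH] ik; first by rewrite grid0 !poisson0.
    have ik' : (i < k.+1)%N := ik.
    have := h i ik; rewrite !tE ?(ltnW ik')// kkE// (IH (ltnW ik)) => h3.
    have := Ngi i w; rewrite (IH (ltnW ik)) => h4.
    by rewrite -(subnK h4) h3 subnK.
  move=> i ik; rewrite !tE ?(ltnW ik)// kkE//.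
  have ik2 : (i < k.+2)%N by exact: leqW.
  have ik3 : (i.+1 < k.+2)%N by [].
  by have := h (Ordinal ik2); have := h (Ordinal ik3) => /= -> ->.
have tk : t k.+1 = r by rewrite /t leqnn gridS.
have tkk : t k.+2 = r' by rewrite /t ltnn.
have kkj : kk k.+1 = j by rewrite /kk ltnn.
rewrite EA tk tkk kkj in h1.
rewrite -[RHS]h1; congr (P _).
apply/seteqP; split => w /=.
  rewrite -EA => -[/= h Jw] i; rewrite ltnS leq_eqVlt => /predU1P[->|/h//].
  by rewrite tk tkk kkj.
move=> h; split; first by rewrite -EA => i ik; apply: h; exact: leqW.
by have := h k.+1 (ltnSn _); rewrite tk tkk kkj.
Qed.

(** On N r = n the path takes finitely many values at the grid points, so Y is
    a finite combination of indicators, to which [poisson_grid_indep] applies.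
    *)
Lemma poisson_grid_expect (r r' : R) k n j (Y : Omega -> R) : 0 < r -> r <= r' ->
  (forall w, N r w <> n -> Y w = 0) ->
  (forall w w', (forall i : 'I_k.+2, N (grid r k i) w = N (grid r k i) w') -> Y w = Y w') ->
  P.-integrable setT (EFin \o Y) /\
  \int[P]_w (Y w * \1_[set w | (N r' w - N r w)%N = j] w) =
  (\int[P]_w Y w) * fine (P [set w | (N r' w - N r w)%N = j]).
Proof.
move=> r0 rr' Y0 Yeq; have g0 i : 0 <= grid r k i by rewrite -(grid0 r k) grid_le// ltW.
have r'0 := le_trans (ltW r0) rr'.
set J := [set w | _].
have mJ : measurable J by exact: (@poisson_set2_measurable _ _ (fun a b => (b - a)%N = j) (ltW r0)).
pose A (ka : {ffun 'I_k.+2 -> 'I_n.+1}) := [set w | forall i : 'I_k.+2, N (grid r k i) w = ka i].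
have mA ka : measurable (A ka).
  rewrite (_ : A ka = \bigcap_(i in [set: 'I_k.+2]) [set w | N (grid r k i) w = ka i]).
    apply: fin_bigcap_measurable => // i _; exact: (@poisson_set_measurable _ [set (ka i : nat)]).
  by apply/seteqP; split => w /= h i; [move=> _; exact: h|exact: h].
pose y ka := if pselect (exists w, A ka w) is left e then Y (projT1 (cid e)) else 0.
pose T ka w := y ka * \1_(A ka) w.
have YE w : Y w = \sum_ka T ka w.
  have [Nw|Nw] := eqVneq (N r w) n; last first.
    rewrite Y0; last exact/eqP.
    rewrite big1// => ka _; rewrite /T.
    have [Aw|nAw] := pselect (A ka w); last by rewrite indicE memNset// mulr0.
    rewrite /y; case: pselect => [e|]; last by rewrite mul0r.
    rewrite Y0 ?mul0r//; case: cid => w' /= Aw'.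
    have := Aw' ord_max; have := Aw ord_max; rewrite /= gridS => <- ->; exact/eqP.
  have Ngn i : (i < k.+2)%N -> (N (grid r k i) w <= n)%N.
    by move=> ik; rewrite -Nw poisson_le// -[leRHS](gridS r k) grid_le// ltW.
  pose ka := [ffun i : 'I_k.+2 => inord (N (grid r k i) w) : 'I_n.+1].
  have Aka : A ka w by move=> i; rewrite ffunE inordK// ltnS Ngn.
  rewrite (bigD1 ka)//= big1 ?addr0.
    rewrite /T indicE mem_set// mulr1 /y; case: pselect => [e|]; last by case; exists w.
    case: cid => w' /= Aw'; apply: Yeq => i; by rewrite Aka Aw'.
  move=> ka' kk; rewrite /T indicE memNset ?mulr0// => Aka'.
  move/eqP: kk; apply; apply/ffunP => i; apply/val_inj => /=.
  by rewrite -Aka' Aka.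
have finS (B : set Omega) : measurable B -> P.-integrable setT (EFin \o (\1_B : Omega -> R)).
  exact: integrable_indic_probability.
have iT ka : P.-integrable setT (EFin \o T ka).
  rewrite (_ : _ \o _ = (fun w => (y ka)%:E * (EFin \o (\1_(A ka) : Omega -> R)) w)%E).
    by apply: integrableZl => //; exact: finS.
  by apply/funext => w /=; rewrite EFinM.
pose TJ ka w := y ka * \1_(A ka `&` J) w.
have iTJ ka : P.-integrable setT (EFin \o TJ ka).
  rewrite (_ : _ \o _ = (fun w => (y ka)%:E * (EFin \o (\1_(A ka `&` J) : Omega -> R)) w)%E).
    by apply: integrableZl => //; apply: finS; exact: measurableI.
  by apply/funext => w /=; rewrite EFinM.
have [i1 e1] := @Rintegral_sum _ _ _ P setT _ (index_enum _) T measurableT iT.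
have [i2 e2] := @Rintegral_sum _ _ _ P setT _ (index_enum _) TJ measurableT iTJ.
have -> : Y = (fun w => \sum_ka T ka w) by exact/funext.
split=> //; rewrite e1 mulr_suml.
transitivity (\int[P]_w (\sum_ka TJ ka w)).
  apply: eq_Rintegral => w _; rewrite mulr_suml; apply: eq_bigr => ka _.
  by rewrite /T /TJ indicI -mulrA.
rewrite e2; apply: eq_bigr => ka _.
rewrite /T /TJ !RintegralZl//; [|exact: finS|by apply: finS; exact: measurableI].
rewrite -mulrA; congr (_ * _).
rewrite /Rintegral !integral_indic// ?setIT; [|exact: measurableI].
have [e|ne] := pselect (exists w, A ka w).
  have [w0 Aw0] := e.
  have -> : A ka = [set w | forall i : 'I_k.+2, N (grid r k i) w = N (grid r k i) w0].
    by apply/seteqP; split => w /= h i; rewrite h Aw0.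
  rewrite [X in fine X](poisson_grid_indep k w0 j r0 rr') fineM// fin_num_measure//.
  rewrite (_ : [set w | _] = A ka); first exact: mA.
  by apply/seteqP; split => w /= h i; rewrite h Aw0.
have -> : A ka = set0 by apply/seteqP; split => w //= Aw; apply: ne; exists w.
by rewrite set0I !measure0 mul0r.
Qed.
End poisson.

(** * One switch at a time *)

Lemma cvg_Rintegral_bounded d (T : measurableType d) (R : realType)
    (m : {measure set T -> \bar R}) (D : set T) (f_ : nat -> T -> R) (f : T -> R) (B : R) :
  measurable D -> (m D < +oo)%E -> (forall k, measurable_fun D (f_ k)) ->
  (forall k x, D x -> `|f_ k x| <= B) ->
  (forall x, D x -> f_ k x @[k --> \oo] --> f x) ->
  m.-integrable D (EFin \o f) /\
  \int[m]_(x in D) f_ k x @[k --> \oo] --> \int[m]_(x in D) f x.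
Proof.
move=> mD finD mf_ f_B f_f.
have mf : measurable_fun D f by exact: measurable_fun_cvg f_f.
have [|||||intf _ h] := @dominated_convergence _ _ _ m D mD (fun k => EFin \o f_ k) (EFin \o f) (EFin \o cst B).
- by move=> k; exact/measurable_EFinP.
- exact/measurable_EFinP.
- by apply: aeW => x Dx; apply: cvg_EFin; [exact: nearW|exact: f_f].
- apply: (@integrable_bounded _ _ _ _ _ _ B) => // x Dx /=.
  by rewrite ger0_norm// (le_trans _ (f_B 0%N x Dx)).
- by apply: aeW => x k Dx; rewrite lee_fin; exact: f_B.
split => //; apply: fine_cvg; rewrite fineK//; exact: integrable_fin_num.
Qed.

(** Test functions: they determine a law, and the Lipschitz constant bounds the
    effect of the time that elapses within a short interval. *)
Definition lip01 (R : realType) (L : R) (h : R -> R) :=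
  (forall x, 0 <= h x <= 1) /\ (forall x y, `|h x - h y| <= L * `|x - y|).

Section lip01.
Context {R : realType}.
Implicit Types (L : R) (h : R -> R).

Lemma lip01_norm L h x : lip01 L h -> `|h x| <= 1.
Proof. by case=> h1 _; have /andP[? ?] := h1 x; rewrite ger0_norm. Qed.

Lemma lip01_continuous L h : lip01 L h -> continuous h.
Proof.
move=> [_ hL] x; apply/cvgrPdist_le => /= e e0.
have L1 : 0 < `|L| + 1 by rewrite ltr_wpDl.
near=> y.
rewrite (le_trans (hL x y))//.
rewrite (@le_trans _ _ ((`|L| + 1) * `|x - y|))//.
  by rewrite ler_wpM2r// (le_trans (ler_norm _))// lerDl.
rewrite mulrC -ler_pdivlMr//.
near: y; apply: cvgr_dist_le => //; by rewrite divr_gt0.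
Unshelve. all: by end_near. Qed.

Lemma lip01_refl L h r : lip01 L h -> lip01 L (fun x => h (r - x)).
Proof.
move=> [h01 hL]; split => // x y; rewrite (le_trans (hL _ _))//.
by rewrite (_ : r - x - (r - y) = - (x - y)) ?normrN//; ring.
Qed.

Lemma lip01_measurable L h : lip01 L h -> measurable_fun [set: R] h.
Proof. by move=> /lip01_continuous/continuous_measurable_fun. Qed.
End lip01.

Lemma ler_norm_mul2 (R : realType) (x k E : R) : 0 <= x -> 0 <= k -> k <= E ->
  `|x * k| <= `|E * x|.
Proof.
move=> x0 k0 kE; rewrite !ger0_norm ?mulr_ge0//; last exact: le_trans kE.
by rewrite mulrC ler_wpM2r.
Qed.

Lemma ler_mul01 (R : realType) (E E' b : R) : 0 <= E -> E <= E' -> 0 <= b -> b <= 1 ->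
  E * b <= E'.
Proof. by move=> E0 EE' b0 b1; rewrite -[leRHS]mulr1 ler_pM. Qed.

Lemma ler_dist_mul (R : realType) (Et E E' a b c D x : R) :
  0 <= E' -> E <= E' -> E' <= Et -> E' - E <= Et * D -> `|a - c| <= D ->
  `|c - b| <= x -> 0 <= b -> b <= 1 -> `|E' * a - E * b| <= Et * (2 * D + x).
Proof.
move=> E'0 EE' E't EtD ac cb b0 b1.
have -> : E' * a - E * b = E' * (a - c) + E' * (c - b) + (E' - E) * b by ring.
have -> : Et * (2 * D + x) = Et * D + Et * x + Et * D by ring.
apply: (le_trans (ler_normD _ _)); apply: lerD.
  apply: (le_trans (ler_normD _ _)).
  by apply: lerD; rewrite normrM (ger0_norm E'0); apply: ler_pM.
rewrite normrM (ger0_norm b0) ger0_norm ?subr_ge0//.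
by rewrite -[leRHS]mulr1; apply: ler_pM => //; rewrite subr_ge0.
Qed.

Section poisson_law.
Context d (Omega : measurableType d) (R : realType) (P : probability Omega R).
Local Notation mu := (@lebesgue_measure R).
Variable m : R -> R.
Hypothesis mm : measurable_fun [set: R] m.
Hypothesis m0 : forall s, 0 <= m s.
Hypothesis mi : forall t, mu.-integrable `]0, t] (EFin \o m).
Variable N : R -> Omega -> nat.
Hypothesis NP : poisson_process P m N.
Local Notation M := (cumulative_rate m).
Local Notation oth := (other_time N).
Variable L : R.
Implicit Types (h : R -> R) (n : nat) (r t : R).

Definition count_event n r : set Omega := [set w | N r w = n].

Lemma measurable_count_event n r : 0 <= r -> measurable (count_event n r).
Proof. by move=> r0; exact: (poisson_set_measurable NP [set n]). Qed.

Definition count_part h n r w : R := h (oth r w) * \1_(count_event n r) w.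

Lemma measurable_count_part h n r : lip01 L h -> 0 <= r -> measurable_fun [set: Omega] (count_part h n r).
Proof.
move=> hL r0; apply: measurable_funM; last by apply: measurable_indic; exact: measurable_count_event.
apply: (@measurableT_comp _ _ _ _ _ _ h); first exact: lip01_measurable hL.
exact: (measurable_other_time NP).
Qed.

(** [other_time] is a limit of Riemann sums that depend on the path at finitely
    many times up to r. *)
Lemma poisson_indep h n j r r' : lip01 L h -> 0 <= r -> r <= r' ->
  \int[P]_w (count_part h n r w * \1_[set w | (N r' w - N r w)%N = j] w) =
  (\int[P]_w count_part h n r w) * fine (P [set w | (N r' w - N r w)%N = j]).
Proof.
move=> hL r0 rr'; have r'0 := le_trans r0 rr'.
set J := [set w | _].
have mJ : measurable J by exact: (poisson_set2_measurable NP (fun a b => (b - a)%N = j) r0).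
have h1 := lip01_norm _ hL.
move: r0; rewrite le_eqVlt => /predU1P[r0|r0].
  have pc w : count_part h n r w = h 0 * \1_[set n] 0%N.
    by rewrite /count_part -r0 other_time0; congr (_ * _); apply: indic_iff; rewrite /count_event/= (poisson0 NP).
  under eq_Rintegral do rewrite pc.
  under [in RHS]eq_Rintegral do rewrite pc.
  rewrite [in RHS]Rintegral_probability_cst.
  rewrite RintegralZl//; last first.
    exact: integrable_indic_probability.
  by rewrite {1}/Rintegral integral_indic// setIT.
pose Y k w : R := h (r / k.+1%:R * \sum_(i < k.+1) (odd (N (grid r k i.+1) w) != odd (N r w))%:R) *
   \1_(count_event n r) w.
have Yk k := @poisson_grid_expect _ _ _ P m N NP r r' k n j (Y k) r0 rr'.
have Y0 k w : N r w <> n -> Y k w = 0.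
  by move=> Nw; rewrite /Y indicE memNset ?mulr0.
have Yeq k w w' : (forall i : 'I_k.+2, N (grid r k i) w = N (grid r k i) w') -> Y k w = Y k w'.
  move=> ww'; have Nr : N r w = N r w' by have := ww' ord_max; rewrite /= gridS.
  rewrite /Y; congr (h (_ * _) * _).
    apply: eq_bigr => i _; rewrite Nr.
    by have /= -> // := ww' (lift ord0 i).
  by apply: indic_iff; rewrite /count_event/= Nr.
have {}Yk k := Yk k (Y0 k) (Yeq k).
have mY k : measurable_fun setT (Y k).
  by have [/integrableP[/measurable_EFinP]] := Yk k.
have Yc w : Y k w @[k --> \oo] --> count_part h n r w.
  apply: cvgM; last exact: cvg_cst.
  suff H : r / k.+1%:R * \sum_(i < k.+1) (odd (N (grid r k i.+1) w) != odd (N r w))%:R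
      @[k --> \oo] --> oth r w by exact: (cvg_comp _ h H (lip01_continuous hL (x := oth r w))).
  apply: (@cvg_riemann _ r (fun s => (odd (N s w) != odd (N r w))%:R) 1) => //.
    exact: (poisson_right_constant NP (fun a => (odd a != odd (N r w))%:R)).
  by move=> s; exact: normr_bool.
have c1 := (@cvg_Rintegral_bounded _ _ _ P setT Y (count_part h n r) 1 measurableT
  (probability_lty P measurableT) mY (fun k w _ => normr_indic_le _ _ (h1 _)) (fun w _ => Yc w)).2.
have mYJ k : measurable_fun setT (fun w => Y k w * \1_J w).
  by apply: measurable_funM => //; exact: measurable_indic.
have YJc w : Y k w * \1_J w @[k --> \oo] --> count_part h n r w * \1_J w.
  by apply: cvgM; [exact: Yc|exact: cvg_cst].
have c2 := (@cvg_Rintegral_bounded _ _ _ P setT (fun k w => Y k w * \1_J w)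
  (fun w => count_part h n r w * \1_J w) 1 measurableT
  (probability_lty P measurableT) mYJ
  (fun k w _ => normr_indic_le J w (normr_indic_le _ _ (h1 _))) (fun w _ => YJc w)).2.
have c3 : \int[P]_w (Y k w * \1_J w) @[k --> \oo] --> (\int[P]_w count_part h n r w) * fine (P J).
  under eq_cvg do rewrite (Yk _).2.
  by apply: cvgM => //; exact: cvg_cst.
exact: (cvg_unique _ c2 c3).
Qed.

Hypothesis L0 : 0 <= L.
Definition count_mean h n r : R := \int[P]_w count_part h n r w.

Lemma integrable_count_part h n r : lip01 L h -> 0 <= r -> P.-integrable setT (EFin \o count_part h n r).
Proof.
move=> hL r0; apply: (@integrable_probability _ _ _ _ _ 1).
  exact: measurable_count_part.
by move=> w; apply: normr_indic_le; exact: (lip01_norm _ hL).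
Qed.

Lemma count_part01 h n r w : lip01 L h -> 0 <= count_part h n r w <= 1.
Proof.
move=> [h01 _]; have /andP[h0 h1] := h01 (oth r w).
by rewrite /count_part indicE; case: (_ \in _); rewrite ?mulr1 ?h0// mulr0 lexx ler01.
Qed.

Lemma count_mean01 h n r : lip01 L h -> 0 <= r -> 0 <= count_mean h n r <= 1.
Proof.
move=> hL r0; rewrite Rintegral_ge0/=; last first.
  by move=> w _; have /andP[] := count_part01 n r w hL.
have -> : 1 = \int[P]_(w in setT) (1 : R).
  by rewrite Rintegral_probability_cst.
apply: le_Rintegral => //; first exact: integrable_count_part.
- by apply: (@integrable_probability _ _ _ _ _ 1) => // w; rewrite normr1.
- by move=> w _; have /andP[] := count_part01 n r w hL.
Qed.

Lemma le_normr_Rintegral_prob (f g : Omega -> R) :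
  P.-integrable setT (EFin \o f) -> P.-integrable setT (EFin \o g) ->
  (forall w, `|f w| <= g w) -> `|\int[P]_w f w| <= \int[P]_w g w.
Proof.
move=> intf intg fg; apply: (le_trans (le_normr_Rintegral _ _)) => //.
apply: le_Rintegral => //.
by have := integrable_abse intf.
Qed.

Lemma Rintegral_indicP (A : set Omega) : measurable A -> \int[P]_w (\1_A w) = fine (P A).
Proof. by move=> mA; rewrite /Rintegral integral_indic// setIT. Qed.

Lemma fineP_le (A : set Omega) (x : R) : measurable A -> (P A <= x%:E)%E -> fine (P A) <= x.
Proof. by move=> mA Ax; rewrite -lee_fin fineK// fin_num_measure. Qed.

Lemma count_mean_continuity h n r r' : lip01 L h -> 0 <= r -> r <= r' ->
  `|count_mean h n r' - count_mean h n r| <= M r' - M r.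
Proof.
move=> hL r0 rr'; have r'0 := le_trans r0 rr'.
have mJ : measurable [set w | N r' w <> N r w].
  exact: (poisson_set2_measurable NP (fun a b => b <> a)).
rewrite /count_mean -RintegralB//; try exact: integrable_count_part.
apply: le_trans (le_normr_Rintegral_prob _ (integrable_indic_probability P mJ) _) _.
- by apply: integrable_EFinB => //; exact: integrable_count_part.
- move=> w; have [e|ne] := eqVneq (N r' w) (N r w).
    rewrite /count_part (other_time_same NP r0 rr' e).
    have -> : \1_(count_event n r') w = \1_(count_event n r) w :> R.
      by apply: indic_iff; rewrite /count_event/= e.
    by rewrite subrr normr0 indicE.
  rewrite indicE mem_set/=; last exact/eqP.
  have /andP[a b] := count_part01 n r w hL; have /andP[a' b'] := count_part01 n r' w hL.
  by rewrite ler_norml; apply/andP; split; lra.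
- rewrite Rintegral_indicP//; apply: fineP_le => //.
  exact: (poisson_jump mi NP r0 rr').
Qed.

(** Between r and r' the path makes no switch and leaves [other_time]
    unchanged, or one switch, which replaces it by r minus itself, or at least
    two, an event of order D ^+ 2. *)
Lemma count_mean_one_step h n r r' : lip01 L h -> 0 <= r -> r <= r' ->
  let D := M r' - M r in
  `|count_mean h n.+1 r' - count_mean h n.+1 r * expR (- D)
     - count_mean (fun x => h (r - x)) n r * (D * expR (- D))| <= L * (r' - r) * D + D ^+ 2.
Proof.
move=> hL r0 rr' /=; set D := M r' - M r; have r'0 := le_trans r0 rr'.
have hL' := lip01_refl r hL.
pose J k := [set w | (N r' w - N r w)%N = k].
pose J2 := [set w | (2 <= N r' w - N r w)%N].
have mJ k : measurable (J k) by exact: (poisson_set2_measurable NP (fun a b => (b - a)%N = k)).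
have mJ2 : measurable J2 by exact: (poisson_set2_measurable NP (fun a b => (2 <= b - a)%N)).
have PJ k : fine (P (J k)) = D ^+ k / k`!%:R * expR (- D).
  by rewrite (poisson_incr mi NP).
have D0 : 0 <= D by rewrite subr_ge0 cumulative_rate_le.
have e0 : expR (- D) = fine (P (J 0%N)) by rewrite PJ expr0 fact0 divr1 mul1r.
have e1 : D * expR (- D) = fine (P (J 1%N)) by rewrite PJ expr1 (_ : 1`! = 1%N)// divr1.
rewrite e1 e0 /count_mean -!poisson_indep//.
have i0 : P.-integrable setT (EFin \o (fun w => count_part h n.+1 r w * \1_(J 0%N) w)).
  apply: (@integrable_probability _ _ _ _ _ 1).
    by apply: measurable_funM; [exact: measurable_count_part|exact: measurable_indic].
  by move=> w; do 2 apply: normr_indic_le; exact: (lip01_norm _ hL).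
have i1 : P.-integrable setT (EFin \o (fun w => count_part (fun x => h (r - x)) n r w * \1_(J 1%N) w)).
  apply: (@integrable_probability _ _ _ _ _ 1).
    by apply: measurable_funM; [exact: measurable_count_part|exact: measurable_indic].
  by move=> w; do 2 apply: normr_indic_le; exact: (lip01_norm _ hL).
have ip := integrable_count_part n.+1 hL r'0.
have iB := integrable_EFinB measurableT ip i0.
have iBB := integrable_EFinB measurableT iB i1.
rewrite -RintegralB// -RintegralB//.
pose g w : R := L * (r' - r) * \1_(J 1%N) w + \1_J2 w.
have iJ1 := integrable_EFinZ measurableT (integrable_indic_probability P (mJ 1%N)) (L * (r' - r)).
have ig : P.-integrable setT (EFin \o g).
  by apply: integrable_EFinD => //; exact: integrable_indic_probability.
apply: (le_trans (le_normr_Rintegral_prob iBB ig _)).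
  move=> w.
  have Nr := poisson_le NP w r0 rr'.
  have [e|[e|e]] : (N r' w - N r w)%N = 0%N \/ (N r' w - N r w)%N = 1%N \/ (2 <= N r' w - N r w)%N.
    by case: (_ - _)%N => [|[|k]]; [left|right; left|right; right].
  - have eN : N r' w = N r w by apply/eqP; rewrite eqn_leq Nr andbT -subn_eq0 e.
    have J0w : J 0%N w by [].
    have J1w : ~ J 1%N w by rewrite /J/= e.
    have J2w : ~ J2 w by rewrite /J2/= e.
    rewrite /g !indicE (mem_set J0w) !(memNset J1w) (memNset J2w) !mulr0 mulr1 addr0 subr0.
    rewrite /count_part (other_time_same NP r0 rr' eN).
    have -> : \1_(count_event n.+1 r') w = \1_(count_event n.+1 r) w :> R.
      by apply: indic_iff; rewrite /count_event/= eN.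
    by rewrite subrr normr0.
  - have eN : N r' w = (N r w).+1 by rewrite -(subnK Nr) e.
    have J0w : ~ J 0%N w by rewrite /J/= e.
    have J1w : J 1%N w by [].
    have J2w : ~ J2 w by rewrite /J2/= e.
    rewrite /g !indicE (memNset J0w) !(mem_set J1w) (memNset J2w) mulr0 !mulr1 addr0 subr0.
    have -> : count_part h n.+1 r' w = h (oth r' w) * \1_(count_event n r) w.
      rewrite /count_part; congr (_ * _); apply: indic_iff; rewrite /count_event/= eN; split => [[]//|->//].
    rewrite /count_part -mulrBl indicE; case: (_ \in _); last first.
      by rewrite mulr0 normr0 mulr_ge0// subr_ge0.
    rewrite mulr1; case: hL => _ hL2; apply: (le_trans (hL2 _ _)).
    by apply: ler_wpM2l => //; exact: (other_time_switch NP).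
  - have J0w : ~ J 0%N w by rewrite /J/= => e'; rewrite e' in e.
    have J1w : ~ J 1%N w by rewrite /J/= => e'; rewrite e' in e.
    have J2w : J2 w by [].
    rewrite /g !indicE (memNset J0w) !(memNset J1w) (mem_set J2w) !mulr0 !subr0 add0r.
    by have /andP[a b] := count_part01 n.+1 r' w hL; rewrite ger0_norm.
rewrite /g RintegralD//; last exact: integrable_indic_probability.
rewrite RintegralZl//; last exact: integrable_indic_probability.
rewrite !Rintegral_indicP//; apply: lerD.
  apply: ler_wpM2l; first by rewrite mulr_ge0// subr_ge0.
  rewrite -e1 -[leRHS]mulr1 ler_wpM2l// -expR0 ler_expR; lra.
apply: fineP_le => //; exact: (poisson_jump2 m0 mi NP).
Qed.

(** The factor exp (M r) cancels the decay due to the paths that leave the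
    count n, so that the evolution of the count n.+1 consists of the gain from
    the count n alone. *)
Definition compensated_mean h n r : R := expR (M r) * count_mean h n r.
(** The compensated mean of the test function evaluated after a switch at time
    r. *)
Definition reflected_mean h n r : R := compensated_mean (fun x => h (r - x)) n r.

Lemma expR_sub_le (a b t : R) : a <= b -> b <= t -> expR b - expR a <= expR t * (b - a).
Proof.
move=> ab bt.
have -> : expR b - expR a = expR b * (1 - expR (a - b)).
  by rewrite mulrBr mulr1 -expRD (_ : b + (a - b) = a)//; ring.
have h1 := expR_ge1Dx (a - b).
apply: (@le_trans _ _ (expR b * (b - a))).
  by apply: ler_wpM2l; [exact: expR_ge0|lra].
by apply: ler_wpM2r; [lra|rewrite ler_expR].
Qed.

Lemma reflected_mean_bounds h n r t : lip01 L h -> 0 <= r -> r <= t -> 0 <= reflected_mean h n r <= expR (M t).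
Proof.
move=> hL r0 rt; have /andP[a b] := count_mean01 n (lip01_refl r hL) r0.
rewrite /reflected_mean /compensated_mean mulr_ge0 ?expR_ge0//=.
apply: ler_mul01; [exact: expR_ge0| |exact: a|exact: b].
by rewrite ler_expR; exact: cumulative_rate_le.
Qed.

Lemma reflected_mean_continuity h n r r' t : lip01 L h -> 0 <= r -> r <= r' -> r' <= t ->
  `|reflected_mean h n r' - reflected_mean h n r| <= expR (M t) * (2 + L) * ((r' - r) + (M r' - M r)).
Proof.
move=> hL r0 rr' r't; have r'0 := le_trans r0 rr'.
have Mr' : M r <= M r' by exact: cumulative_rate_le.
have Mt : M r' <= M t by exact: cumulative_rate_le.
set a := count_mean (fun x => h (r' - x)) n r'.
set b := count_mean (fun x => h (r - x)) n r.
pose c := count_mean (fun x => h (r' - x)) n r.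
have ac : `|a - c| <= M r' - M r by exact: count_mean_continuity (lip01_refl r' hL) r0 rr'.
have cb : `|c - b| <= L * (r' - r).
  rewrite /c /b /count_mean -RintegralB//; try (apply: integrable_count_part => //; exact: lip01_refl).
  have -> : L * (r' - r) = \int[P]_(w in setT) (L * (r' - r)).
    by rewrite Rintegral_probability_cst.
  apply: le_normr_Rintegral_prob.
  - by apply: integrable_EFinB => //; apply: integrable_count_part => //; exact: lip01_refl.
  - by apply: (@integrable_probability _ _ _ _ _ `|L * (r' - r)|).
  - move=> w; rewrite /count_part -mulrBl indicE; case: (_ \in _); last first.
      by rewrite mulr0 normr0 mulr_ge0// subr_ge0.
    rewrite mulr1; case: hL => _ hL2; apply: (le_trans (hL2 _ _)).
    rewrite (_ : r' - _ - _ = r' - r); last by ring.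
    by rewrite ger0_norm// subr_ge0.
have /andP[b0 b1] := count_mean01 n (lip01_refl r hL) r0; rewrite -/b in b0 b1.
have E1 := expR_sub_le Mr' Mt.
have E2 : expR (M r') <= expR (M t) by rewrite ler_expR.
apply: (le_trans (ler_dist_mul (expR_ge0 _) _ E2 E1 ac cb b0 b1)); first by rewrite ler_expR.
rewrite -mulrA ler_wpM2l ?expR_ge0//.
have D0 : 0 <= M r' - M r by rewrite subr_ge0.
have d0 : 0 <= r' - r by rewrite subr_ge0.
move: (M r' - M r) (r' - r) D0 d0 => x y x0 y0.
rewrite -subr_ge0 (_ : _ - _ = 2 * y + L * x); last by ring.
by rewrite addr_ge0 ?mulr_ge0.
Qed.

Lemma integrable_rate_reflected_mean h n r t : lip01 L h -> 0 <= r -> r <= t ->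
  measurable_fun `]0, t] (reflected_mean h n) ->
  mu.-integrable `]0, r] (EFin \o (fun s => m s * reflected_mean h n s)).
Proof.
move=> hL r0 rt mk.
have sub : `]0, r] `<=` `]0, t].
  by move=> x /=; rewrite !in_itv/= => /andP[-> /le_trans]; exact.
apply: (@le_integrable _ _ _ mu _ _ _ (fun s => (expR (M r))%:E * (EFin \o m) s)%E) => //.
- apply/measurable_EFinP; apply: measurable_funM; first exact: measurable_funTS.
  exact: measurable_funS mk.
- move=> s /=; rewrite in_itv/= => /andP[s0 sr].
  have /andP[a b] := reflected_mean_bounds n hL (ltW s0) sr.
  by rewrite lee_fin; exact: ler_norm_mul2.
- exact: integrableZl.
Qed.

(** By [count_mean_one_step] and the regularity of the reflected mean, the
    difference of the two sides has increments of second order in r + M r, and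
    [constant_of_second_order] applies. *)
Lemma compensated_mean_integral h n t : lip01 L h -> 0 < t -> measurable_fun `]0, t] (reflected_mean h n) ->
  compensated_mean h n.+1 t = \int[mu]_(r in `]0, t]) (m r * reflected_mean h n r).
Proof.
move=> hL t0 mk.
pose I r := \int[mu]_(s in `]0, r]) (m s * reflected_mean h n s).
pose F r := compensated_mean h n.+1 r - I r.
suff : F t = F 0.
  rewrite /F /I set_itvoc0 Rintegral_set0 subr0 => /eqP; rewrite subr_eq => /eqP ->.
  suff -> : compensated_mean h n.+1 0 = 0 by rewrite add0r.
  rewrite /compensated_mean /count_mean (_ : \int[P]_w _ = \int[P]_(w in setT) (0 : R)); first by rewrite Rintegral_cst// mul0r mulr0.
  by apply: eq_Rintegral => w _; rewrite /count_part indicE memNset ?mulr0// /count_event/= (poisson0 NP).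
(* The first term bounds the oscillation of the reflected mean over [r, r'], the
   second one the error of a single step. *)
pose C := expR (M t) * (2 + L) + expR (M t) * (1 + L).
have C0 : 0 <= C by rewrite addr_ge0// mulr_ge0 ?expR_ge0// addr_ge0.
apply: (constant_of_second_order m0 mi t0 C0) => r r' r0 rr' r't.
have r'0 := le_trans r0 rr'.
have Mr' : M r <= M r' by exact: cumulative_rate_le.
have Mt : M r' <= M t by exact: cumulative_rate_le.
set D := M r' - M r.
have D0 : 0 <= D by rewrite subr_ge0.
have S1 := count_mean_one_step n hL r0 rr'; rewrite /= -/D in S1.
have im : mu.-integrable `]r, r'] (EFin \o m).
  apply: (integrableS _ _ _ (mi r')) => //.
  by move=> x /=; rewrite !in_itv/= => /andP[/(le_lt_trans r0)->].
have ik := integrable_rate_reflected_mean hL r'0 r't mk.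
have ik' : mu.-integrable `]r, r'] (EFin \o (fun s => m s * reflected_mean h n s)).
  apply: (integrableS _ _ _ ik) => //.
  by move=> x /=; rewrite !in_itv/= => /andP[/(le_lt_trans r0)->].
have -> : F r' - F r = expR (M r') * (count_mean h n.+1 r' - count_mean h n.+1 r * expR (- D)
     - count_mean (fun x => h (r - x)) n r * (D * expR (- D))) -
   \int[mu]_(s in `]r, r']) (m s * (reflected_mean h n s - reflected_mean h n r)).
  have -> : \int[mu]_(s in `]r, r']) (m s * (reflected_mean h n s - reflected_mean h n r)) =
     (I r' - I r) - reflected_mean h n r * D.
    under eq_Rintegral do rewrite mulrBr (mulrC _ (reflected_mean h n r)).
    rewrite RintegralB//; last exact: integrable_EFinZ.
    have -> : \int[mu]_(x in `]r, r']) (reflected_mean h n r * m x) = reflected_mean h n r * D.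
      rewrite RintegralZl; [|by []|exact: im]; congr (_ * _).
      exact: (cumulative_rateB mi r0 rr').
    congr (_ - _).
    by apply/esym; apply: Rintegral_itvB.
  have eD : expR (M r) = expR (M r') * expR (- D) by rewrite -expRD /D opprB addrC subrK.
  by rewrite /F /reflected_mean /compensated_mean eD; ring.
apply: (le_trans (ler_normB _ _)).
have -> : C * (r' - r + D) * D = expR (M t) * (1 + L) * (r' - r + D) * D +
   expR (M t) * (2 + L) * (r' - r + D) * D by rewrite /C; ring.
apply: lerD.
  rewrite normrM (ger0_norm (expR_ge0 _)).
  apply: (@le_trans _ _ (expR (M t) * (L * (r' - r) * D + D ^+ 2))).
    by apply: ler_pM; [exact: expR_ge0|exact: normr_ge0|rewrite ler_expR|exact: S1].
  rewrite -!mulrA ler_wpM2l ?expR_ge0//.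
  have : 0 <= (r' - r) * D by rewrite mulr_ge0// subr_ge0.
  have : 0 <= L * D * D by rewrite !mulr_ge0.
  by rewrite expr2; nra.
have -> : expR (M t) * (2 + L) * (r' - r + D) * D =
   \int[mu]_(s in `]r, r']) (expR (M t) * (2 + L) * (r' - r + D) * m s).
  by rewrite RintegralZl// cumulative_rateB.
have iE : mu.-integrable `]r, r'] (EFin \o (fun s => expR (M t) * (2 + L) * (r' - r + D) * m s)).
  by apply: integrable_EFinZ => //; exact: im.
have pw s : `]r, r']%classic s -> `|m s * (reflected_mean h n s - reflected_mean h n r)| <= expR (M t) * (2 + L) * (r' - r + D) * m s.
  rewrite /= in_itv/= => /andP[rs sr'].
  rewrite normrM (ger0_norm (m0 s)) mulrC ler_wpM2r//.
  apply: (le_trans (reflected_mean_continuity n hL r0 (ltW rs) (le_trans sr' r't))).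
  apply: ler_wpM2l; first by rewrite mulr_ge0 ?expR_ge0// addr_ge0.
  have Ms : M s <= M r' by apply: cumulative_rate_le => //; exact: le_trans r0 (ltW rs).
  by rewrite /D; apply: lerD; rewrite lerD2r.
have iw : mu.-integrable `]r, r'] (EFin \o (fun s => m s * (reflected_mean h n s - reflected_mean h n r))).
  apply: (le_integrable _ _ _ iE) => //.
    apply/measurable_EFinP; apply: measurable_funM; first exact: measurable_funTS.
    apply: measurable_funB => //; apply: measurable_funS mk => //.
    move=> x /=; rewrite !in_itv/= => /andP[/(le_lt_trans r0)->/=] /le_trans; exact.
  move=> s rs; rewrite /= lee_fin (le_trans (pw s rs))// ler_norm//.
apply: (le_trans (le_normr_Rintegral _ _)) => //.
apply: le_Rintegral => //.
by have := integrable_abse iw.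
Qed.
End poisson_law.

(** * Switch densities *)

Section density.
Context {R : realType}.
Local Notation mu := (@lebesgue_measure R).
Implicit Types (m h : R -> R) (r t u v p a b x : R) (n : nat).

(** The arguments u and v are the times spent in the current and in the other
    state, so that u + v is the current time. A last switch at time s + v finds
    the current state already occupied for a time s; before it the two states
    have exchanged roles, whence the arguments v and s of the recursion. The
    index n stands for n.+1 switches: a single switch takes place at time v. *)
Fixpoint switch_density m n (u v : R) : \bar R :=
  if n is n'.+1 then
    (\int[mu]_(s in `]0%R, u[) ((m (s + v)%R)%:E * switch_density m n' v s))%E
  else (m v)%:E.

(** The indicator of ]a, b[ as a function of all three arguments, so that
    integrals over intervals with variable ends are accessible to the theorem
    of Fubini. *)
Definition oo_ind (a b x : R) : R := ((a < x) && (x < b))%:R.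

Lemma oo_indE a b x : oo_ind a b x = \1_(`]a, b[%classic) x.
Proof.
rewrite /oo_ind indicE; case: (boolP (_ && _)) => H.
  by rewrite mem_set//= in_itv.
by rewrite memNset//= in_itv; exact/negP.
Qed.

Lemma integral_oo_ind a b (f : R -> \bar R) :
  (\int[mu]_(x in `]a, b[) f x = \int[mu]_x ((oo_ind a b x)%:E * f x))%E.
Proof.
rewrite integral_mkcond epatch_indic; apply: eq_integral => x _ /=.
by rewrite muleC oo_indE.
Qed.

Lemma oo_ind_refl p v : oo_ind 0 p (p - v) = oo_ind 0 p v.
Proof. by rewrite /oo_ind subr_gt0 gtrBl andbC. Qed.

Lemma measurable_oo_ind d (T : measurableType d) (D : set T) (a b x : T -> R) :
  measurable_fun D a -> measurable_fun D b -> measurable_fun D x ->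
  measurable_fun D (fun z => oo_ind (a z) (b z) (x z)).
Proof.
move=> ma mb mx.
rewrite (_ : (fun z => _) = (fun z => (a z < x z)%R%:R * (x z < b z)%R%:R : R)); last first.
  by apply/funext => z; rewrite /oo_ind -natrM mulnb.
by apply: measurable_funM; apply: (@measurableT_comp _ _ _ _ _ _ (fun b : bool => b%:R : R));
  rewrite //; apply: measurable_fun_ltr.
Qed.

Section positive_rate.
Variable m : R -> R.
Hypothesis mm : measurable_fun [set: R] m.
Hypothesis m0 : forall s, 0 <= m s.

Lemma switch_density_ge0 n u v : (0 <= switch_density m n u v)%E.
Proof.
elim: n u v => [|n IH] u v /=; first by rewrite lee_fin.
by apply: integral_ge0 => s _; rewrite mule_ge0// lee_fin.
Qed.

Lemma measurable_switch_density_pair n :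
  measurable_fun [set: R * R] (fun p : R * R => switch_density m n p.1 p.2).
Proof.
elim: n => [|n IH] /=.
  by apply/measurable_EFinP; apply: measurableT_comp => //.
under eq_fun do rewrite integral_oo_ind.
pose F (q : (R * R) * R) : \bar R := ((oo_ind 0 q.1.1 q.2)%:E *
  ((m (q.2 + q.1.2))%:E * switch_density m n q.1.2 q.2))%E.
apply: (measurable_fun_fubini_tonelli_F (m2 := mu) F).
  have m11 : measurable_fun [set: (R * R) * R] (fun q => q.1.1) by exact: measurableT_comp.
  have m12 : measurable_fun [set: (R * R) * R] (fun q => q.1.2) by exact: measurableT_comp.
  apply: emeasurable_funM.
    by apply/measurable_EFinP; apply: measurable_oo_ind.
  apply: emeasurable_funM.
    by apply/measurable_EFinP; apply: measurableT_comp => //; exact: measurable_funD.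
  exact: (measurableT_comp IH (measurable_fun_pair m12 measurable_snd)).
move=> q; rewrite /F mule_ge0//= ?lee_fin// mule_ge0// ?lee_fin//.
exact: switch_density_ge0.
Qed.

Lemma measurable_switch_density d (T : measurableType d) n (a b : T -> R) :
  measurable_fun [set: T] a -> measurable_fun [set: T] b ->
  measurable_fun [set: T] (fun z => switch_density m n (a z) (b z)).
Proof.
move=> ma mb.
exact: (measurableT_comp (measurable_switch_density_pair n) (measurable_fun_pair ma mb)).
Qed.

Definition line_integral n h r : \bar R :=
  (\int[mu]_(v in `]0%R, r[) ((h v)%:E * switch_density m n (r - v)%R v))%E.

(** The substitution p = s + v, the time of the last switch, followed by an
    exchange of the two integrals. *)
Lemma line_integralS n h r : measurable_fun [set: R] h -> (forall x, 0 <= h x) ->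
  line_integral n.+1 h r =
  (\int[mu]_(p in `]0%R, r[) ((m p)%:E * line_integral n (fun x => h (p - x)%R) p))%E.
Proof.
move=> mh h0.
pose F (q : R * R) : \bar R := ((oo_ind 0 r q.1)%:E * ((h q.1)%:E *
   ((oo_ind 0 (r - q.1) (q.2 - q.1))%:E * ((m q.2)%:E * switch_density m n q.1 (q.2 - q.1)))))%E.
have F0 q : (0 <= F q)%E.
  by rewrite /F !mule_ge0 ?lee_fin// switch_density_ge0.
have mF : measurable_fun [set: R * R] F.
  have m21 : measurable_fun [set: R * R] (fun q : R * R => q.2 - q.1) by exact: measurable_funB.
  apply: emeasurable_funM; first by apply/measurable_EFinP; apply: measurable_oo_ind.
  apply: emeasurable_funM; first by apply/measurable_EFinP; exact: measurableT_comp.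
  apply: emeasurable_funM.
    by apply/measurable_EFinP; apply: measurable_oo_ind => //; exact: measurable_funB.
  apply: emeasurable_funM; first by apply/measurable_EFinP; exact: measurableT_comp.
  exact: measurable_switch_density.
have mFs v : measurable_fun [set: R] (fun s => F (v, s)) by exact: (measurableT_comp mF (pair1_measurable v)).
have mFp p : measurable_fun [set: R] (fun v => F (v, p)) by exact: (measurableT_comp mF (pair2_measurable p)).
transitivity (\int[mu]_v \int[mu]_p F (v, p))%E.
  rewrite /line_integral integral_oo_ind; apply: eq_integral => v _ /=.
  rewrite integral_oo_ind.
  under [RHS]eq_integral do rewrite /F muleA/=.
  have mG : measurable_fun [set: R] (fun s => ((oo_ind 0 (r - v) s)%:E * ((m (s + v))%:E * switch_density m n v s))%E).
    apply: emeasurable_funM; first by apply/measurable_EFinP; apply: measurable_oo_ind.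
    apply: emeasurable_funM.
      by apply/measurable_EFinP; apply: measurableT_comp => //; exact: measurable_funD.
    exact: measurable_switch_density.
  have G0 s : (0 <= (oo_ind 0 (r - v) s)%:E * ((m (s + v))%:E * switch_density m n v s))%E.
    by rewrite !mule_ge0 ?lee_fin// switch_density_ge0.
  rewrite (@ge0_integral_affine R 1 (- v) _ (oner_neq0 _) mG G0) normr1 mul1e muleA.
  rewrite -ge0_integralZl//.
  - by apply: eq_integral => p _; rewrite mul1r subrK.
  - apply: (measurableT_comp mG); exact: measurable_affine.
  - by rewrite mule_ge0 ?lee_fin.
rewrite fubini_tonelli// [RHS]integral_oo_ind; apply: eq_integral => p _ /=.
pose K v := ((oo_ind 0 p v)%:E * ((h v)%:E * switch_density m n v (p - v)))%E.
have mK : measurable_fun [set: R] K.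
  apply: emeasurable_funM; first by apply/measurable_EFinP; apply: measurable_oo_ind.
  apply: emeasurable_funM; first exact/measurable_EFinP.
  by apply: measurable_switch_density => //; exact: measurable_funB.
have K0 v : (0 <= K v)%E by rewrite /K !mule_ge0 ?lee_fin// switch_density_ge0.
have -> : line_integral n (fun x => h (p - x)%R) p = (\int[mu]_v K v)%E.
  rewrite (@ge0_integral_affine R (-1) p K _ mK K0)// ?oppr_eq0// normrN normr1 mul1e.
  rewrite /line_integral integral_oo_ind; apply: eq_integral => v _.
  have -> : -1 * (v : R) + p = p - v by rewrite mulN1r addrC.
  by rewrite /K oo_ind_refl subKr.
rewrite muleA -ge0_integralZl//; last by rewrite mule_ge0 ?lee_fin.
apply: eq_integral => v _; rewrite /F /K/=.
rewrite !muleA; congr (_ * _)%E.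
rewrite -!EFinM; congr EFin.
rewrite /oo_ind subr_gt0 ltrD2r.
have [v0|v0] := ltP 0 v; have [pr|rp] := ltP p r; have [vp|pv] := ltP v p;
  rewrite ?andbF ?andbT/= ?(mul0r, mulr0)//.
- have vr : (v : R) < r by exact: lt_trans pr.
  have p0 : 0 < (p : R) by exact: lt_trans vp.
  by rewrite vr p0 /= !mulr1 !mul1r mulrC.
Qed.
End positive_rate.
End density.

Section density_law.
Context d (Omega : measurableType d) (R : realType) (P : probability Omega R).
Local Notation mu := (@lebesgue_measure R).
Variable m : R -> R.
Hypothesis mm : measurable_fun [set: R] m.
Hypothesis m0 : forall s, 0 <= m s.
Hypothesis mi : forall t, mu.-integrable `]0, t] (EFin \o m).
Variable N : R -> Omega -> nat.
Hypothesis NP : poisson_process P m N.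
Variable L : R.
Hypothesis L0 : 0 <= L.
Implicit Types (h : R -> R) (n : nat) (r t : R).

Lemma reflected_mean0 h t : lip01 L h -> 0 <= t -> reflected_mean P m N h 0 t = h t.
Proof.
move=> hL t0; rewrite /reflected_mean /compensated_mean /count_mean.
rewrite (_ : \int[P]_w _ = \int[P]_w (h t * \1_(count_event N 0 t) w)); last first.
  apply: eq_Rintegral => w _; rewrite /count_part.
  have [Nw|Nw] := pselect (count_event N 0 t w); last by rewrite indicE memNset// !mulr0.
  by rewrite (other_time_same NP (lexx 0) t0) ?other_time0 ?subr0// (poisson0 NP).
have mE : measurable (count_event N 0 t) by exact: (measurable_count_event NP 0 t0).
rewrite RintegralZl//; last exact: integrable_indic_probability.
rewrite Rintegral_indicP//.
have := poisson_incr mi NP 0 (lexx 0) t0; rewrite cumulative_rate0 subr0 expr0 fact0 divr1 mul1r => e.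
rewrite (_ : fine _ = expR (- cumulative_rate m t)); last first.
  rewrite -[RHS]/(fine (expR (- cumulative_rate m t))%:E) -e; congr (fine (P _)).
  by apply/seteqP; split => w; rewrite /count_event/= (poisson0 NP) subn0.
by rewrite mulrCA -expRD subrr expR0 mulr1.
Qed.

(** Induction on the number of switches: [compensated_mean_integral] and
    [line_integralS] are the same recursion. *)
Lemma compensated_meanE n h t : lip01 L h -> 0 < t ->
  (compensated_mean P m N h n.+1 t)%:E = line_integral m n h t.
Proof.
move=> hL t0.
suff H n' h' t' : lip01 L h' -> 0 < t' ->
    (forall r, 0 < r -> (reflected_mean P m N h' n' r)%:E =
      if n' is k.+1 then line_integral m k (fun x => h' (r - x)) r else (h' r)%:E) ->
    (compensated_mean P m N h' n'.+1 t')%:E = line_integral m n' h' t'.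
  elim: n h t hL t0 => [|n IH] h t hL t0; apply: H => // r r0.
    by rewrite reflected_mean0// ltW.
  by apply: IH => //; exact: lip01_refl.
move=> {hL t0 n h t} hL t0 kE; move: n' h' t' hL t0 kE => n h t hL t0 kE.
have mh := lip01_measurable hL.
have h0 x : 0 <= h x by case: hL => h01 _; have /andP[] := h01 x.
have mk : measurable_fun `]0, t] (reflected_mean P m N h n).
  apply/measurable_EFinP; case: n kE => [|n] kE.
    apply: (eq_measurable_fun (EFin \o h)).
      by move=> r; rewrite inE/= in_itv/= => /andP[r0 _]; rewrite kE.
    by apply/measurable_EFinP; exact: measurable_funTS.
  apply: (eq_measurable_fun (fun r => line_integral m n (fun x => h (r - x)) r)).
    by move=> r; rewrite inE/= in_itv/= => /andP[r0 _]; rewrite kE.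
  apply: measurable_funTS; rewrite /line_integral.
  under eq_fun do rewrite integral_oo_ind.
  pose F (q : R * R) : \bar R := ((oo_ind 0 q.1 q.2)%:E *
    ((h (q.1 - q.2))%:E * switch_density m n (q.1 - q.2) q.2))%E.
  have m12 : measurable_fun [set: R * R] (fun q : R * R => q.1 - q.2) by exact: measurable_funB.
  apply: (measurable_fun_fubini_tonelli_F (m2 := mu) F).
    apply: emeasurable_funM; first by apply/measurable_EFinP; apply: measurable_oo_ind.
    apply: emeasurable_funM; first by apply/measurable_EFinP; exact: measurableT_comp.
    exact: measurable_switch_density.
  by move=> q; rewrite /F !mule_ge0 ?lee_fin// switch_density_ge0.
rewrite (compensated_mean_integral mm m0 mi NP L0 hL t0 mk).
have ik := integrable_rate_reflected_mean mm m0 mi NP hL (ltW t0) (lexx t) mk.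
rewrite /Rintegral fineK; last exact: integrable_fin_num.
have -> : (\int[mu]_(r in `]0%R, t]) (m r * reflected_mean P m N h n r)%:E =
   \int[mu]_(r in `]0%R, t[) (m r * reflected_mean P m N h n r)%:E)%E.
  apply/esym; apply: integral_itv_bndo_bndc.
  by apply: measurable_funS (measurable_int mu ik) => //; exact: subset_itv_oo_oc.
case: n kE mk ik => [|n] kE mk ik.
  rewrite /line_integral; apply: eq_integral => r; rewrite inE/= in_itv/= => /andP[r0 rt].
  by rewrite EFinM kE// muleC.
rewrite line_integralS//; apply: eq_integral => r; rewrite inE/= in_itv/= => /andP[r0 rt].
by rewrite EFinM kE.
Qed.
End density_law.

(** * The joint law of the number of switches and of the time in the other state *)

Section density_measure.
Context d (T : measurableType d) (R : realType) (mu : {measure set T -> \bar R}).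
Variable g : T -> \bar R.
Hypothesis mg : measurable_fun [set: T] g.
Hypothesis g0 : forall x, (0 <= g x)%E.

Definition density_measure (A : set T) : \bar R := (\int[mu]_(x in A) g x)%E.

Let density_measure0 : density_measure set0 = 0%E.
Proof. by rewrite /density_measure integral_set0. Qed.

Let density_measure_ge0 A : (0 <= density_measure A)%E.
Proof. by rewrite /density_measure integral_ge0. Qed.

Let density_measure_sigma_additive : semi_sigma_additive density_measure.
Proof.
move=> F mF tF mUF; rewrite /density_measure; apply: cvg_toP.
  apply: ereal_nondecreasing_is_cvgn => a b ab.
  by apply: lee_sum_nneg_natr => // k _ _; exact: integral_ge0.
by rewrite ge0_integral_bigcup//; exact: measurable_funTS.
Qed.

HB.instance Definition _ := isMeasure.Build _ _ _
  density_measure density_measure0 density_measure_ge0 density_measure_sigma_additive.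

Definition density_measure_of : {measure set T -> \bar R} := density_measure.
End density_measure.

Section ramp.
Context {R : realType}.
Implicit Types (a x : R) (k : nat).

(** Lipschitz approximations from below of the indicator of the ray ]-oo, a[.
    *)
Definition ramp a k x : R := Num.min 1 (Num.max 0 (k%:R * (a - x))).

Lemma ramp_lip a k : lip01 k%:R (ramp a k).
Proof.
split=> [x|x y]; rewrite /ramp.
  by rewrite le_min ler01 le_max lexx/= ge_min lexx.
have H (u v : R) : `|Num.min 1 (Num.max 0 u) - Num.min 1 (Num.max 0 v)| <= `|u - v|.
  rewrite /Num.min /Num.max.
  have n1 : u - v <= `|u - v| := ler_norm _.
  have n2 : v - u <= `|u - v| by rewrite distrC ler_norm.
  move: `|u - v| n1 n2 => n n1 n2; rewrite ler_norml /Num.min /Num.max.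
  have [hu|hu] := ltP 0 u; have [hv|hv] := ltP 0 v; rewrite ?ltr10.
  - by have [hu1|hu1] := ltP 1 u; have [hv1|hv1] := ltP 1 v; lra.
  - by have [hu1|hu1] := ltP 1 u; lra.
  - by have [hv1|hv1] := ltP 1 v; lra.
  - by lra.
apply: (le_trans (H _ _)).
have -> : k%:R * (a - x) - k%:R * (a - y) = k%:R * (y - x) by ring.
by rewrite normrM normr_nat (distrC y).
Qed.

Lemma ramp_near a x : \forall k \near \oo, ramp a k x = \1_(`]-oo, a[%classic) x.
Proof.
have [xa|ax] := ltP x a.
  rewrite indicE mem_set/= ?in_itv//=.
  exists (Num.bound (a - x)^-1) => // k /= hk.
  have ax : 0 < a - x by rewrite subr_gt0.
  have kx : 1 <= k%:R * (a - x).
    rewrite -ler_pdivrMr// mul1r.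
    apply: (@le_trans _ _ (Num.bound (a - x)^-1)%:R); last by rewrite ler_nat.
    by apply/ltW/archi_boundP; rewrite invr_ge0 ltW.
  have kx0 : 0 <= k%:R * (a - x) := le_trans ler01 kx.
  rewrite /ramp; move: (k%:R * (a - x)) kx kx0 => z z1 z0.
  by rewrite (max_idPr z0) (min_idPl z1).
rewrite indicE memNset/=; last by rewrite in_itv/= ltNge ax.
apply: nearW => k.
have kx0 : k%:R * (a - x) <= 0 by rewrite mulr_ge0_le0// subr_le0.
rewrite /ramp; move: (k%:R * (a - x)) kx0 => z z0.
by rewrite (max_idPl z0) (min_idPr ler01).
Qed.
End ramp.

Section law_unique.
Context d (Omega : measurableType d) (R : realType) (P : probability Omega R).
Local Notation mu := (@lebesgue_measure R).
Variables (E : set Omega) (X : Omega -> R) (g : R -> \bar R).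
Hypothesis mE : measurable E.
Hypothesis mX : measurable_fun [set: Omega] X.
Hypothesis mg : measurable_fun [set: R] g.
Hypothesis g0 : forall x, (0 <= g x)%E.
Hypothesis Eg : forall (L : R) (h : R -> R), 0 <= L -> lip01 L h ->
  (\int[P]_w (h (X w) * \1_E w))%:E = (\int[mu]_v ((h v)%:E * g v))%E.

Lemma law_unique_ray a :
  P (E `&` X @^-1` `]-oo, a[) = (\int[mu]_(v in `]-oo, a[) g v)%E.
Proof.
have finS : mu.-integrable setT g.
  apply/integrableP; split=> //.
  have l1 : lip01 0 (cst 1 : R -> R).
    by split => [x|x y] /=; rewrite ?ler01 ?lexx// subrr normr0 mul0r.
  have := Eg (lexx 0) l1.
  under [X in _ = X -> _]eq_integral do rewrite mul1e.
  under [X in _ -> (X < _)%E]eq_integral do rewrite gee0_abs//.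
  by move=> <-; exact: ltry.
pose B := X @^-1` `]-oo, a[.
have mB : measurable B by rewrite -[B]setTI; exact: mX.
have -> : P (E `&` B) = (\int[P]_w (\1_(`]-oo, a[%classic) (X w) * \1_E w))%:E.
  rewrite (@eq_Rintegral _ _ _ _ _ (\1_(E `&` B) : Omega -> R)) => [|w _].
    by rewrite Rintegral_indicP ?fineK ?fin_num_measure//; exact: measurableI.
  by rewrite indicI mulrC; congr (_ * _); apply: indic_iff.
have c1 : (\int[P]_w (ramp a k (X w) * \1_E w))%:E @[k --> \oo] -->
    (\int[P]_w (\1_(`]-oo, a[%classic) (X w) * \1_E w))%:E.
  apply: cvg_EFin; first exact: nearW.
  have [|||||_ H] := @cvg_Rintegral_bounded _ _ _ P setT (fun k w => ramp a k (X w) * \1_E w)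
    (fun w => \1_(`]-oo, a[%classic) (X w) * \1_E w) 1; last exact: H.
  - exact: measurableT.
  - exact: probability_lty.
  - move=> k; apply: measurable_funM; last exact: measurable_indic.
    by apply: (measurableT_comp _ mX); exact: lip01_measurable (ramp_lip a k).
  - by move=> k w _; apply: normr_indic_le; exact: lip01_norm (ramp_lip a k).
  - move=> w _; apply: cvgM; last exact: cvg_cst.
    by apply: cvg_near_cst; exact: ramp_near.
have c2 : (\int[mu]_v ((ramp a k v)%:E * g v))%E @[k --> \oo] -->
    (\int[mu]_v ((\1_(`]-oo, a[%classic) v)%:E * g v))%E.
  have [|||||_ _ H] := @dominated_convergence _ _ _ mu setT measurableT
    (fun k v => (ramp a k v)%:E * g v)%E (fun v => (\1_(`]-oo, a[%classic) v)%:E * g v)%E g; last exact: H.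
  - move=> k; apply: emeasurable_funM => //; apply/measurable_EFinP.
    exact: lip01_measurable (ramp_lip a k).
  - apply: emeasurable_funM => //; apply/measurable_EFinP; exact: measurable_indic.
  - apply: aeW => v _; apply: cvg_near_cst.
    by apply: filterS (ramp_near a v) => k ->.
  - exact: finS.
  - apply: aeW => v k _; have /andP[h0 h1] := (ramp_lip a k).1 v.
    rewrite gee0_abs; last by rewrite mule_ge0// lee_fin.
    by rewrite -[leRHS]mul1e; apply: lee_wpmul2r => //; rewrite lee_fin.
have c3 : (\int[mu]_v ((ramp a k v)%:E * g v))%E @[k --> \oo] -->
    (\int[P]_w (\1_(`]-oo, a[%classic) (X w) * \1_E w))%:E.
  by under eq_cvg do rewrite -(Eg (ler0n _ _) (ramp_lip a _)).
rewrite -(cvg_unique _ c2 c3)//.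
rewrite [RHS]integral_mkcond epatch_indic.
by apply: eq_integral => v _; rewrite muleC.
Qed.

(** The rays generate the Borel sets and are stable under intersection. *)
Lemma law_unique A : measurable A -> P (E `&` X @^-1` A) = (\int[mu]_(v in A) g v)%E.
Proof.
move=> mA.
pose m0 : {measure set Omega -> \bar R} := mrestr P mE.
pose m1F : {measure set (measurableTypeR R) -> \bar R} := pushforward m0 (X : Omega -> measurableTypeR R).
pose m1 := m1F mX.
pose m2 : {measure set (measurableTypeR R) -> \bar R} := density_measure_of mu mg g0.
have m1E B : m1 B = P (E `&` X @^-1` B) by rewrite setIC.
rewrite -m1E; change (m1 A = m2 A).
have uniq := @measure_unique _ R (measurableTypeR R) (@RGenInftyO.G R) (fun k => `]-oo, k%:R[%classic).
apply: (uniq _ _ _ _ m1 m2 _ _ A mA).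
- exact: RGenInftyO.measurableE.
- move=> _ _ [x ->] [y ->]; exists (Num.min x y); apply/seteqP; split => z /=; rewrite !in_itv/= lt_min.
    by move=> [-> ->].
  by move=> /andP[].
- by move=> k; exists k%:R.
- apply/seteqP; split => // x _; exists (Num.bound `|x|) => //=.
  by rewrite in_itv/= (le_lt_trans (ler_norm _))// archi_boundP.
- by move=> _ [x ->]; rewrite m1E law_unique_ray.
- by move=> k; rewrite m1E probability_lty//; apply: measurableI => //; rewrite -[X in measurable X]setTI; exact: mX.
Qed.
End law_unique.

Section switch_law.
Context d (Omega : measurableType d) (R : realType) (P : probability Omega R).
Local Notation mu := (@lebesgue_measure R).
Variable m : R -> R.
Hypothesis mm : measurable_fun [set: R] m.
Hypothesis m0 : forall s, 0 <= m s.
Hypothesis mi : forall t, mu.-integrable `]0, t] (EFin \o m).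
Variable N : R -> Omega -> nat.
Hypothesis NP : poisson_process P m N.

(** Lipschitz test functions determine the law, and [compensated_meanE]
    evaluates them. *)
Lemma switch_law n (t : R) (A : set R) : 0 < t -> measurable A ->
  P ([set w | N t w = n.+1] `&` other_time N t @^-1` A) =
  (\int[mu]_(v in A) ((expR (- cumulative_rate m t))%:E *
     ((oo_ind 0 t v)%:E * switch_density m n (t - v) v)))%E.
Proof.
move=> t0 mA.
have mS : measurable_fun [set: R] (fun v => (oo_ind 0 t v)%:E * switch_density m n (t - v) v)%E.
  apply: emeasurable_funM; first by apply/measurable_EFinP; apply: measurable_oo_ind.
  by apply: measurable_switch_density => //; exact: measurable_funB.
have S0 v : (0 <= (oo_ind 0 t v)%:E * switch_density m n (t - v) v)%E.
  by rewrite mule_ge0 ?lee_fin// switch_density_ge0.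
apply: (@law_unique _ _ _ P) => //.
- exact: (measurable_count_event NP n.+1 (ltW t0)).
- exact: (measurable_other_time NP (ltW t0)).
- exact: emeasurable_funM.
- by move=> v; rewrite mule_ge0// lee_fin expR_ge0.
- move=> L h L0 hL.
  have := compensated_meanE mm m0 mi NP L0 n hL t0.
  rewrite /line_integral integral_oo_ind /compensated_mean EFinM => /(congr1 (fun x => ((expR (- cumulative_rate m t))%:E * x)%E)).
  rewrite -!EFinM mulrA -expRD addNr expR0 mul1r.
  rewrite -[X in X = _ -> _]/((\int[P]_w (h (other_time N t w) * \1_(count_event N n.+1 t) w))%:E) => ->.
  have h0 x : 0 <= h x by case: hL => h01 _; have /andP[] := h01 x.
  have mh := lip01_measurable hL.
  rewrite -ge0_integralZl//.
  + by apply: eq_integral => v _; rewrite !muleA; congr (_ * _)%E; rewrite -!EFinM; congr EFin; ring.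
  + under eq_fun do rewrite muleCA.
    by apply: emeasurable_funM => //; exact/measurable_EFinP.
  + by move=> v _; rewrite muleCA mule_ge0// lee_fin.
Qed.
End switch_law.

(** * The generating density *)

Section scaling.
Context {R : realType}.
Local Notation mu := (@lebesgue_measure R).
Implicit Types (m : R -> R) (z u v : R) (n : nat).

Lemma switch_density_scale m z n u v :
  measurable_fun [set: R] m -> (forall s, 0 <= m s) -> 0 <= z ->
  switch_density (fun s => z * m s) n u v = ((z ^+ n.+1)%:E * switch_density m n u v)%E.
Proof.
move=> mm m0 z0; elim: n u v => [|n IH] u v /=; first by rewrite expr1 EFinM.
rewrite -ge0_integralZl//.
- apply: eq_integral => s _; rewrite IH !muleA; congr (_ * _)%E.
  by rewrite -!EFinM; congr EFin; rewrite (exprS z n.+1); ring.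
- apply: measurable_funTS; apply: emeasurable_funM.
    by apply/measurable_EFinP; apply: (measurableT_comp mm); exact: measurable_funD.
  by apply: measurable_switch_density.
- by move=> s _; rewrite mule_ge0 ?lee_fin// switch_density_ge0.
- by rewrite lee_fin exprn_ge0.
Qed.
End scaling.

Lemma continuous_itv_bounded (R : realType) (f : R -> R) (a b : R) :
  (forall x, a <= x <= b -> {for x, continuous f}) ->
  exists2 B, 0 <= B & forall x, a <= x <= b -> `|f x| <= B.
Proof.
move=> cf; have [ab|ba] := leP a b; last first.
  by exists 0 => // x /andP[h1 h2]; have := le_lt_trans (le_trans h1 h2) ba; rewrite ltxx.
have cn : {within `[a, b], continuous (fun x => `|f x|)}.
  apply: continuous_in_subspaceT => x; rewrite inE/= in_itv/= => xab.
  by apply: (@continuous_comp _ _ _ f (fun y => `|y|)); [exact: cf|exact: norm_continuous].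
have [c cab hc] := EVT_max ab cn.
exists `|f c| => // x xab; exact: hc.
Qed.

Section total_density.
Context {R : realType}.
Local Notation mu := (@lebesgue_measure R).
Variable k : R -> R.
Hypothesis mk : measurable_fun [set: R] k.
Hypothesis k0 : forall s, 0 <= k s.
Hypothesis kc : forall s, 0 < s -> {for s, continuous k}.
Implicit Types (n : nat) (s t u v : R).

(** Every switch has weight 1 here. A clock of rate z * k with weight 1 / z per
    switch leads to the same sum, by [switch_density_scale]. *)
Definition total_density u v : \bar R := (\sum_(n <oo) switch_density k n u v)%E.

Lemma total_density_ge0 u v : (0 <= total_density u v)%E.
Proof. by apply: nneseries_ge0 => n _ _; exact: switch_density_ge0. Qed.

Lemma measurable_total_density d (T : measurableType d) (a b : T -> R) :
  measurable_fun [set: T] a -> measurable_fun [set: T] b ->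
  measurable_fun [set: T] (fun z => total_density (a z) (b z)).
Proof.
move=> ma mb; apply: ge0_emeasurable_sum => //.
  by move=> n x _ _; exact: switch_density_ge0.
by move=> n _; exact: measurable_switch_density.
Qed.

(** The single switch is isolated and the recursion is summed under the
    integral. *)
Lemma total_density_eq u v : total_density u v =
  ((k v)%:E + \int[mu]_(s in `]0%R, u[) ((k (s + v)%R)%:E * total_density v s))%E.
Proof.
rewrite /total_density nneseries_recl//=; last by move=> n _; exact: switch_density_ge0.
congr (_ + _)%E; rewrite -nneseries_addn; last by move=> n; exact: switch_density_ge0.
under eq_eseriesr do rewrite addn1/=.
rewrite -integral_nneseries//.
- apply: eq_integral => s _; rewrite nneseriesZl// => n _; exact: switch_density_ge0.
- move=> n; apply: measurable_funTS; apply: emeasurable_funM.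
    by apply/measurable_EFinP; apply: (measurableT_comp mk); exact: measurable_funD.
  by apply: measurable_switch_density.
- by move=> n s _; rewrite mule_ge0 ?lee_fin// switch_density_ge0.
Qed.

Lemma measurable_rate_density v (D : set R) :
  measurable_fun D (fun s => (k (s + v))%:E * total_density v s)%E.
Proof.
apply: measurable_funTS; apply: emeasurable_funM.
  by apply/measurable_EFinP; apply: (measurableT_comp mk); exact: measurable_funD.
exact: measurable_total_density.
Qed.

(** In [total_density_eq] the variable u is only a bound of integration, and
    the integrand is nonnegative. *)
Lemma total_density_le u u' v : u <= u' -> (total_density u v <= total_density u' v)%E.
Proof.
move=> uu'; rewrite !(total_density_eq _ v) leeD2l//.
apply: ge0_subset_integral => //.
- exact: measurable_rate_density.
- by move=> s _; rewrite mule_ge0 ?lee_fin// total_density_ge0.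
- by move=> x /=; rewrite !in_itv/= => /andP[-> /lt_le_trans]; exact.
Qed.

Hypothesis mass : forall t, 0 < t ->
  (\int[mu]_(v in `]0%R, t[) total_density (t - v)%R v < +oo)%E.

(** Finiteness of the mass along the line of total time u + v is carried to the
    strip by the monotonicity in the first argument. *)
Lemma total_density_strip u v : 0 < u -> 0 < v ->
  (\int[mu]_(s in `]0%R, u[) total_density v s < +oo)%E.
Proof.
move=> u0 v0; apply: le_lt_trans (mass (addr_gt0 u0 v0)).
have mG : measurable_fun [set: R] (fun s => total_density (u + v - s) s).
  by apply: measurable_total_density => //; exact: measurable_funB.
apply: (@le_trans _ _ (\int[mu]_(s in `]0%R, u[) total_density (u + v - s)%R s)%E).
  apply: ge0_le_integral => //.
  - by move=> s _; exact: total_density_ge0.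
  - by apply: measurable_funTS; exact: measurable_total_density.
  - exact: measurable_funTS.
  - move=> s /=; rewrite in_itv/= => /andP[_ su]; apply: total_density_le.
    by rewrite addrAC lerDr subr_ge0 ltW.
apply: ge0_subset_integral => //.
- exact: measurable_funTS.
- by move=> s _; exact: total_density_ge0.
- move=> s /=; rewrite !in_itv/= => /andP[-> /lt_le_trans]; apply; by rewrite lerDl ltW.
Qed.

Lemma rate_bounded a b : 0 < a -> exists2 B, 0 <= B & forall s, a <= s <= b -> k s <= B.
Proof.
move=> a0; have [|B B0 hB] := @continuous_itv_bounded _ k a b.
  by move=> x /andP[ax _]; apply: kc; exact: lt_le_trans ax.
by exists B => // s sab; rewrite (le_trans (ler_norm _))// hB.
Qed.

Lemma rate_density_strip u v : 0 < u -> 0 < v ->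
  (\int[mu]_(s in `]0%R, u[) ((k (s + v)%R)%:E * total_density v s) < +oo)%E.
Proof.
move=> u0 v0; have [B B0 hB] := rate_bounded (u + v) v0.
apply: (@le_lt_trans _ _ (\int[mu]_(s in `]0%R, u[) (B%:E * total_density v s))%E).
  apply: ge0_le_integral => //.
  - by move=> s _; rewrite mule_ge0 ?lee_fin// total_density_ge0.
  - exact: measurable_rate_density.
  - apply: measurable_funTS; apply: emeasurable_funM => //.
    exact: measurable_total_density.
  - move=> s /=; rewrite in_itv/= => /andP[s0 su]; apply: lee_wpmul2r.
      exact: total_density_ge0.
    by rewrite lee_fin hB// lerDr ltW//= lerD2r ltW.
rewrite ge0_integralZl//.
- by rewrite lte_mul_pinfty// total_density_strip.
- by apply: measurable_funTS; exact: measurable_total_density.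
- by move=> s _; exact: total_density_ge0.
Qed.

Lemma total_density_fin u v : 0 < u -> 0 < v -> total_density u v \is a fin_num.
Proof.
move=> u0 v0; rewrite ge0_fin_numE ?total_density_ge0// total_density_eq.
by rewrite lte_add_pinfty ?ltry// rate_density_strip.
Qed.

Definition density u v : R := fine (total_density u v).

Lemma densityK u v : 0 < u -> 0 < v -> (density u v)%:E = total_density u v.
Proof. by move=> u0 v0; rewrite fineK// total_density_fin. Qed.

Lemma density_ge0 u v : 0 <= density u v.
Proof. by rewrite fine_ge0// total_density_ge0. Qed.

Lemma density_le u u' v : 0 < u -> 0 < v -> u <= u' -> density u v <= density u' v.
Proof.
move=> u0 v0 uu'; rewrite -lee_fin !densityK// ?total_density_le//.
exact: lt_le_trans uu'.
Qed.

Lemma measurable_density d (T : measurableType d) (D : set T) (a b : T -> R) :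
  measurable_fun [set: T] a -> measurable_fun [set: T] b ->
  measurable_fun D (fun z => density (a z) (b z)).
Proof.
move=> ma mb; apply: measurable_funTS.
exact: (measurableT_comp (fine_measurable measurableT) (measurable_total_density ma mb)).
Qed.

Lemma measurable_symmetric_density (a t v : R) (D : set R) :
  measurable_fun D (fun x => a * (density ((t + x / v) / 2) ((t - x / v) / 2) +
                                  density ((t - x / v) / 2) ((t + x / v) / 2))).
Proof.
have mp : measurable_fun [set: R] (fun x => (t + x / v) / 2).
  by apply: measurable_funM => //; apply: measurable_funD => //; exact: measurable_funM.
have mm : measurable_fun [set: R] (fun x => (t - x / v) / 2).
  by apply: measurable_funM => //; apply: measurable_funB => //; exact: measurable_funM.
by apply: measurable_funM => //; apply: measurable_funD; exact: measurable_density.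
Qed.

Lemma density_strip_integrable u v : 0 < u -> 0 < v ->
  mu.-integrable `]0, u[ (EFin \o (fun s => density v s)).
Proof.
move=> u0 v0; apply/integrableP; split.
  by apply/measurable_EFinP; exact: measurable_density.
rewrite [X in (X < _)%E](_ : _ = \int[mu]_(s in `]0%R, u[) total_density v s)%E.
  exact: total_density_strip.
apply: eq_integral => s; rewrite inE/= in_itv/= => /andP[s0 _].
by rewrite /= ger0_norm ?density_ge0// densityK.
Qed.

Lemma rate_density_integrable u v : 0 < u -> 0 < v ->
  mu.-integrable `]0, u[ (EFin \o (fun s => k (s + v) * density v s)).
Proof.
move=> u0 v0; apply/integrableP; split.
  apply/measurable_EFinP; apply: measurable_funM.
    by apply: measurable_funTS; apply: (measurableT_comp mk); exact: measurable_funD.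
  exact: measurable_density.
rewrite [X in (X < _)%E](_ : _ = \int[mu]_(s in `]0%R, u[) ((k (s + v)%R)%:E * total_density v s))%E.
  exact: rate_density_strip.
apply: eq_integral => s; rewrite inE/= in_itv/= => /andP[s0 _].
by rewrite /= ger0_norm ?mulr_ge0 ?density_ge0// EFinM densityK.
Qed.

Lemma density_eq u v : 0 < u -> 0 < v ->
  density u v = k v + \int[mu]_(s in `]0, u[) (k (s + v) * density v s).
Proof.
move=> u0 v0; apply: EFin_inj; rewrite densityK// total_density_eq EFinD; congr (_ + _)%E.
rewrite /Rintegral fineK; last by apply: integrable_fin_num => //; exact: rate_density_integrable.
apply: eq_integral => s; rewrite inE/= in_itv/= => /andP[s0 _].
by rewrite EFinM densityK.
Qed.
End total_density.

(** * Calculus in two variables *)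

Section two_variables.
Context {R : realType}.
Local Notation mu := (@lebesgue_measure R).
Implicit Types (f : R -> R) (g : R -> R -> R) (u v x y e d C a b : R).

Lemma continuous_epsP f x : {for x, continuous f} <->
  forall e, 0 < e -> exists2 d, 0 < d & forall y, `|y - x| < d -> `|f y - f x| < e.
Proof.
split=> [cf e e0|cf].
  have /cvgrPdist_lt/(_ _ e0)/nbhs_ballP[d /= d0 hd] := cf.
  exists d => // y yx; rewrite distrC; apply: hd.
  by rewrite /ball/= distrC.
apply/cvgrPdist_lt => e e0; have [d d0 hd] := cf e e0.
apply/nbhs_ballP; exists d => //= y; rewrite /ball/= => xy.
by rewrite distrC; apply: hd; rewrite distrC.
Qed.

Definition continuous2_at g u v : Prop :=
  {for (u, v), continuous (fun q : R * R => g q.1 q.2)}.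

Lemma continuous2_epsP g u v : continuous2_at g u v <->
  forall e, 0 < e -> exists2 d, 0 < d &
    forall x y, `|x - u| < d -> `|y - v| < d -> `|g x y - g u v| < e.
Proof.
split=> [cf e e0|cf].
  have /cvgrPdist_lt/(_ _ e0)/nbhs_ballP[d /= d0 hd] := cf.
  exists d => // x y xu yv; rewrite distrC; apply: (hd (x, y)).
  by split; rewrite /ball/= distrC.
apply/cvgrPdist_lt => e e0; have [d d0 hd] := cf e e0.
apply: filterS (nbhsx_ballx (u, v) d d0) => -[x y] [/=]; rewrite /ball/= => ux vy.
by rewrite distrC; apply: hd; rewrite distrC.
Qed.

(** The argument of Dini: monotonicity in one variable makes separate
    continuity joint. *)
Lemma continuous2_monotone g u v : 0 < u -> 0 < v ->
  (forall x x' y, 0 < x -> 0 < y -> x <= x' -> g x y <= g x' y) ->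
  {for u, continuous (g^~ v)} ->
  (forall x, 0 < x -> {for v, continuous (g x)}) -> continuous2_at g u v.
Proof.
move=> u0 v0 mono cu cv; apply/continuous2_epsP => e e0.
have e2 : 0 < e / 2 by rewrite divr_gt0.
have [d1 d10 h1] := (continuous_epsP _ _).1 cu _ e2.
have [d [d0 dd1 du]] : exists d, [/\ 0 < d, d < d1 & d < u].
  exists (Num.min (d1 / 2) (u / 2)); split; first by rewrite lt_min !divr_gt0.
  - by rewrite gt_min ltr_pdivrMr// ltr_pMr// ltr1n.
  - by rewrite gt_min [X in _ || X]ltr_pdivrMr// [X in _ || X]ltr_pMr// ltr1n orbT.
have um0 : 0 < u - d by rewrite subr_gt0.
have up0 : 0 < u + d by rewrite addr_gt0.
have [d2 d20 h2] := (continuous_epsP _ _).1 (cv _ um0) _ e2.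
have [d3 d30 h3] := (continuous_epsP _ _).1 (cv _ up0) _ e2.
exists (Num.min d (Num.min v (Num.min d2 d3))); first by rewrite !lt_min d0 v0 d20.
move=> x y; rewrite !lt_min => /andP[xd _] /and4P[_ yv y2 y3].
have y0 : 0 < y by move: yv; rewrite ltr_norml => /andP[]; lra.
move: xd; rewrite ltr_norml => /andP[xd xd'].
have k1 : g (u - d) y <= g x y by apply: mono => //; lra.
have k2 : g x y <= g (u + d) y by apply: mono => //; lra.
have k3 := h2 _ y2; have k4 := h3 _ y3.
have k5 : `|g (u - d) v - g u v| < e / 2 by apply: h1; rewrite addrC addKr normrN gtr0_norm.
have k6 : `|g (u + d) v - g u v| < e / 2 by apply: h1; rewrite addrC addKr gtr0_norm.
move: k3 k4 k5 k6; rewrite !ltr_norml => /andP[? ?] /andP[? ?] /andP[? ?] /andP[? ?].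
by apply/andP; split; lra.
Qed.

Lemma continuous2_lipschitz g u v C d : 0 < d ->
  {for v, continuous (g u)} ->
  (forall x y, `|x - u| < d -> `|y - v| < d -> `|g x y - g u y| <= C * `|x - u|) ->
  continuous2_at g u v.
Proof.
move=> d0 cv gC; apply/continuous2_epsP => e e0.
have e2 : 0 < e / 2 by rewrite divr_gt0.
have [d1 d10 h1] := (continuous_epsP _ _).1 cv _ e2.
have C1 : 0 < `|C| + 1 by rewrite ltr_wpDl.
exists (Num.min d (Num.min d1 (e / 2 / (`|C| + 1)))); first by rewrite !lt_min d0 d10 !divr_gt0.
move=> x y; rewrite !lt_min => /and3P[xd _ xe] /and3P[yd yd1 _].
have k1 := gC _ _ xd yd; have := h1 _ yd1.
have : C * `|x - u| < e / 2.
  apply: (@le_lt_trans _ _ ((`|C| + 1) * `|x - u|)).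
    by apply: ler_wpM2r => //; rewrite (le_trans (ler_norm C))// lerDl.
  by rewrite mulrC -ltr_pdivlMr.
move=> k2 k3.
rewrite (_ : g x y - g u v = (g x y - g u y) + (g u y - g u v)); last by ring.
by rewrite (le_lt_trans (ler_normD _ _))//; lra.
Qed.

Lemma is_derive_eps f x l :
  (forall e, 0 < e -> exists2 d, 0 < d & forall y, `|y - x| < d ->
     `|f y - f x - l * (y - x)| <= e * `|y - x|) -> is_derive x 1 f l.
Proof.
move=> H.
have c : h^-1 *: (f (h *: 1 + x) - f x) @[h --> 0^'] --> l.
  apply/cvgrPdist_le => e e0; have [d d0 hd] := H e e0.
  exists d => //= h; rewrite /ball_/= sub0r normrN => hd' h0.
  have := hd (h *: 1 + x); rewrite addrK scaler1 => /(_ hd').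
  rewrite -ler_pdivrMr ?normr_gt0// -normrV ?unitfE// -normrM.
  congr (_ <= _); rewrite distrC; congr `|_|.
  by rewrite /GRing.scale/=; field.
apply: DeriveDef; first by apply/cvg_ex; exists l.
by apply/cvg_lim => //; exact: Rhausdorff.
Qed.

Lemma is_derive_epsP f x l : is_derive x 1 f l ->
  forall e, 0 < e -> exists2 d, 0 < d & forall y, `|y - x| < d ->
     `|f y - f x - l * (y - x)| <= e * `|y - x|.
Proof.
move=> [df fl] e e0.
have c : h^-1 *: (f (h *: 1 + x) - f x) @[h --> 0^'] --> l by rewrite -fl; exact: df.
have /cvgrPdist_le/(_ _ e0)[d /= d0 hd] := c.
exists d => // y yx; have [->|yx0] := eqVneq y x; first by rewrite !subrr mulr0 subrr normr0 mulr0.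
have h0 : y - x != 0 by rewrite subr_eq0.
have := hd (y - x); rewrite /ball_/= sub0r normrN => /(_ yx h0).
rewrite scaler1 subrK -(ler_pM2r (_ : 0 < `|y - x|)) ?normr_gt0// -normrM.
have -> : f y - f x - l * (y - x) = - ((l - (y - x)^-1 *: (f y - f x)) * (y - x)).
  by rewrite /GRing.scale/=; field.
by rewrite normrN.
Qed.

Lemma is_derive_continuous f x l : is_derive x 1 f l -> {for x, continuous f}.
Proof. by move=> [/derivable1_diffP/differentiable_continuous]. Qed.

Lemma mean_value f (df : R -> R) x d : 
  (forall z, `|z - x| < d -> is_derive z 1 f (df z)) ->
  forall y, `|y - x| < d -> exists2 c, `|c - x| <= `|y - x| & f y - f x = df c * (y - x).
Proof.
move=> H y yx; have [xy|yx'|->] := ltgtP x y; last first.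
- by exists y => //; rewrite !subrr mulr0.
- have K z : z \in `[y, x] -> `|z - x| <= `|y - x|.
    rewrite in_itv/= => /andP[yz zx].
    by rewrite (distrC z) (distrC y) !ger0_norm ?subr_ge0 ?(ltW yx')// lerB.
  have [||c cxy e] := @MVT_segment _ f df y x (ltW yx').
  + by move=> z /subset_itv_oo_cc/K zx; apply: H; exact: le_lt_trans yx.
  + apply: derivable_within_continuous => z /K zx.
    by have [] := H z (le_lt_trans zx yx).
  + exists c; first exact: K.
    by rewrite -[LHS]opprB e -mulrN opprB.
- have K z : z \in `[x, y] -> `|z - x| <= `|y - x|.
    rewrite in_itv/= => /andP[xz zy].
    by rewrite !ger0_norm ?subr_ge0 ?(ltW xy)// lerB.
  have [||c cxy e] := @MVT_segment _ f df x y (ltW xy).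
  + by move=> z /subset_itv_oo_cc/K zx; apply: H; exact: le_lt_trans yx.
  + apply: derivable_within_continuous => z /K zx.
    by have [] := H z (le_lt_trans zx yx).
  + by exists c => //; exact: K.
Qed.

(** The mean value theorem controls the increment in the first variable by the
    continuity of g1; the increment in the second one only involves the
    derivative at the point. *)
Lemma is_derive_line g (g1 : R -> R -> R) (g2 u v a b d : R) (x : R) : 0 < d ->
  (forall z y, `|z - (u + a * x)| < d -> `|y - (v + b * x)| < d -> is_derive z 1 (g^~ y) (g1 z y)) ->
  continuous2_at g1 (u + a * x) (v + b * x) ->
  is_derive (v + b * x) 1 (g (u + a * x)) g2 ->
  is_derive x 1 (fun z => g (u + a * z) (v + b * z)) (a * g1 (u + a * x) (v + b * x) + b * g2).
Proof.
move=> d0; set u0 := u + a * x; set v0 := v + b * x => H c1 dg.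
apply: is_derive_eps => e e0.
pose ea := e / 2 / (`|a| + 1); pose eb := e / 2 / (`|b| + 1).
have a1 : 0 < `|a| + 1 by rewrite ltr_wpDl.
have b1 : 0 < `|b| + 1 by rewrite ltr_wpDl.
have ea0 : 0 < ea by rewrite !divr_gt0.
have eb0 : 0 < eb by rewrite !divr_gt0.
have [d1 d10 h1] := (continuous2_epsP _ _ _).1 c1 _ ea0.
have [d2 d20 h2] := is_derive_epsP dg eb0.
pose D := Num.min d (Num.min d1 d2).
have D0 : 0 < D by rewrite !lt_min d0 d10.
pose r := D / (`|a| + `|b| + 1).
have ab1 : 0 < `|a| + `|b| + 1 by rewrite ltr_wpDl// addr_ge0.
exists r; first by rewrite divr_gt0.
move=> y yx.
have eu : u + a * y - u0 = a * (y - x) by rewrite /u0; ring.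
have ev : v + b * y - v0 = b * (y - x) by rewrite /v0; ring.
have yD : (`|a| + `|b| + 1) * `|y - x| < D by rewrite mulrC -ltr_pdivlMr.
have n0 : 0 <= `|y - x| := normr_ge0 _.
have uD : `|u + a * y - u0| < D.
  rewrite eu normrM; apply: le_lt_trans yD; apply: ler_wpM2r => //.
  by rewrite -addrA lerDl addr_ge0.
have vD : `|v + b * y - v0| < D.
  rewrite ev normrM; apply: le_lt_trans yD; apply: ler_wpM2r => //.
  by rewrite addrAC lerDr addr_ge0.
move: uD vD; rewrite !lt_min => /and3P[ud ud1 _] /and3P[vd vd1 vd2].
have [z zu ez] := @mean_value (g^~ (v + b * y)) (g1^~ (v + b * y)) u0 d
  (fun z zd => H z _ zd vd) _ ud.
have k1 := h1 z _ (le_lt_trans zu ud1) vd1.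
have k2 := h2 _ vd2.
have -> : g (u + a * y) (v + b * y) - g u0 v0 - (a * g1 u0 v0 + b * g2) * (y - x) =
   (g1 z (v + b * y) - g1 u0 v0) * (u + a * y - u0) +
   (g u0 (v + b * y) - g u0 v0 - g2 * (v + b * y - v0)).
  rewrite mulrBl -ez eu ev; ring.
apply: (le_trans (ler_normD _ _)).
have -> : e * `|y - x| = e / 2 * `|y - x| + e / 2 * `|y - x| by rewrite -mulrDl -splitr.
apply: lerD.
  rewrite normrM eu normrM.
  apply: (@le_trans _ _ (ea * (`|a| * `|y - x|))).
    by apply: ler_wpM2r; [rewrite mulr_ge0|exact: ltW].
  rewrite mulrA; apply: ler_wpM2r => //.
  by rewrite /ea mulrAC ler_pdivrMr// ler_wpM2l ?lerDl// divr_ge0// ltW.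
apply: (le_trans k2); rewrite ev normrM mulrA; apply: ler_wpM2r => //.
by rewrite /eb mulrAC ler_pdivrMr// ler_wpM2l ?lerDl// divr_ge0// ltW.
Qed.

Lemma Rintegral_oo_oc f u : mu.-integrable `]0, u[ (EFin \o f) ->
  \int[mu]_(s in `]0, u[) f s = \int[mu]_(s in `]0, u]) f s.
Proof. by move=> intf; exact: Rintegral_itv_bndo_bndc. Qed.

Lemma integrable_oo_oc f u : mu.-integrable `]0, u[ (EFin \o f) ->
  mu.-integrable `]0, u] (EFin \o f).
Proof.
move=> /integrableP[mf intf]; apply/integrableP; split.
  by apply/emeasurable_fun_itv_bndo_bndcP.
by rewrite -integral_itv_bndo_bndc//; exact: measurableT_comp.
Qed.

Lemma integrable_oo_cc f u : 0 < u -> mu.-integrable `]0, u[ (EFin \o f) ->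
  mu.-integrable `[0, u] (EFin \o f).
Proof.
move=> u0 /integrable_oo_oc/integrableP[mf intf]; apply/integrableP; split.
  by apply/emeasurable_fun_itv_obnd_cbndP.
by rewrite -integral_itv_obnd_cbnd//; exact: measurableT_comp.
Qed.

Section primitive.
Variables (f : R -> R) (u : R).
Hypothesis u0 : 0 < u.
Hypothesis intf : forall x, 0 < x -> mu.-integrable `]0, x[ (EFin \o f).

Lemma Rintegral_oo_cc x : 0 < x ->
  \int[mu]_(s in `]0, x[) f s = \int[mu]_(s in `[0, x]) f s.
Proof.
move=> x0; rewrite Rintegral_oo_oc; last exact: intf.
by apply: Rintegral_itv_obnd_cbnd; apply: integrable_oo_oc; exact: intf.
Qed.

Lemma primitive_continuous : {for u, continuous (fun x => \int[mu]_(s in `]0, x[) f s)}.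
Proof.
have u1 : 0 < u + 1 by rewrite addr_gt0.
have := parameterized_integral_continuous (ltW u1) (integrable_oo_cc u1 (intf u1)).
move=> /(continuous_within_itvP _ u1)[/(_ u) c _ _].
have {}c := c _; rewrite in_itv/= u0 ltrDl ltr01 in c.
apply/continuous_epsP => e e0.
have [d d0 hd] := (continuous_epsP _ _).1 (c isT) e e0.
exists (Num.min d u); first by rewrite lt_min d0.
move=> y; rewrite lt_min => /andP[yd yu].
have y0 : 0 < y by move: yu; rewrite ltr_norml => /andP[]; lra.
by rewrite !Rintegral_oo_cc//; exact: hd.
Qed.

Lemma primitive_derive : {for u, continuous f} ->
  is_derive u 1 (fun x => \int[mu]_(s in `]0, x[) f s) (f u).
Proof.
move=> cf.
have u1 : 0 < u + 1 by rewrite addr_gt0.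
have uu1 : u < u + 1 by rewrite ltrDl.
have [|d1 d2] := @continuous_FTC1 R f (BRight 0) u (u + 1) uu1 (integrable_oo_oc (intf u1)) _ cf; first exact: u0.
apply: (@near_eq_is_derive _ _ _ (fun x => \int[mu]_(s in `]0, x]) f s)); last first.
  by apply: DeriveDef; [exact: d1|rewrite -derive1E; exact: d2].
exists u => //= y; rewrite /ball/= => yu.
have y0 : 0 < y by move: yu; rewrite ltr_norml => /andP[]; lra.
by rewrite Rintegral_oo_oc//; exact: intf.
Qed.
End primitive.
End two_variables.

(** * Regularity of the generating density *)

Lemma integrable_cst_oo (R : realType) (a b c : R) :
  (@lebesgue_measure R).-integrable `]a, b[ (EFin \o (fun=> c)).
Proof.
apply: (integrableS _ _ _ (integrable_cst_itv a b c)) => //; exact: subset_itv_oo_cc.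
Qed.

Lemma C1_pos_is_derive (R : realType) (f : R -> R) (s : R) : C1_pos f -> 0 < s ->
  is_derive s 1 f (f^`()%classic s).
Proof. by move=> f1 s0; have [df _] := f1 s s0; apply: DeriveDef; [exact: df|rewrite derive1E]. Qed.

Section density_regularity.
Context {R : realType}.
Local Notation mu := (@lebesgue_measure R).
Variable k : R -> R.
Hypothesis mk : measurable_fun [set: R] k.
Hypothesis k0 : forall s, 0 <= k s.
Hypothesis k1 : C1_pos k.
Hypothesis mass : forall t, 0 < t ->
  (\int[mu]_(v in `]0%R, t[) total_density k (t - v)%R v < +oo)%E.
Implicit Types (s t u v x y : R).
Local Notation G := (density k).
Local Notation k' := (k^`()%classic).

Lemma rate_is_derive s : 0 < s -> is_derive s 1 k (k' s).
Proof. exact: C1_pos_is_derive. Qed.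

Lemma rate_continuous s : 0 < s -> {for s, continuous k}.
Proof. by move=> /rate_is_derive/is_derive_continuous. Qed.

Local Notation kc := rate_continuous.

Lemma shift_rate_is_derive s v : 0 < s + v -> is_derive v 1 (fun y => k (s + y)) (k' (s + v)).
Proof.
move=> sv; have := rate_is_derive sv => H.
have H2 : is_derive v 1 (fun y => s + y) 1.
  apply: (is_derive_eq (is_deriveD (is_derive_cst s v 1) (is_derive_id v 1))).
  by rewrite add0r.
have H' : is_derive ((fun y => s + y) v) 1 k (k' (s + v)) by [].
by have := is_derive1_comp H' H2; rewrite mulr1.
Qed.

Lemma shift_rate_is_derive1 s v : 0 < s + v -> is_derive s 1 (fun x => k (x + v)) (k' (s + v)).
Proof.
rewrite addrC => sv; rewrite (_ : (fun x => k (x + v)) = (fun x => k (v + x))).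
  exact: shift_rate_is_derive.
by apply/funext => x; rewrite addrC.
Qed.

Let intG u v : 0 < u -> 0 < v -> mu.-integrable `]0, u[ (EFin \o (fun s => G v s)).
Proof. by move=> u0 v0; exact: (density_strip_integrable mk k0 kc mass). Qed.

Let intkG u v : 0 < u -> 0 < v ->
  mu.-integrable `]0, u[ (EFin \o (fun s => k (s + v) * G v s)).
Proof. by move=> u0 v0; exact: (rate_density_integrable mk k0 kc mass). Qed.

Lemma density_eq_fun v : 0 < v -> forall u, 0 < u ->
  G u v = k v + \int[mu]_(s in `]0, u[) (k (s + v) * G v s).
Proof. by move=> v0 u u0; exact: (density_eq mk k0 kc mass). Qed.

Lemma density_continuous1 u v : 0 < u -> 0 < v -> {for u, continuous (G^~ v)}.
Proof.
move=> u0 v0; have c := primitive_continuous u0 (fun x (x0 : 0 < x) => intkG x0 v0).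
apply/continuous_epsP => e e0; have [d d0 hd] := (continuous_epsP _ _).1 c e e0.
exists (Num.min d u); first by rewrite lt_min d0.
move=> y; rewrite lt_min => /andP[yd yu].
have y0 : 0 < y by move: yu; rewrite ltr_norml => /andP[]; lra.
by rewrite !(density_eq_fun v0)// opprD addrACA subrr add0r; exact: hd.
Qed.

Lemma oo_near v : 0 < v -> (`]v / 2, 2 * v[%classic : set R) v.
Proof. by move=> v0; rewrite /= in_itv/=; apply/andP; split; lra. Qed.

Lemma Rintegral_oo_continuous (phi : R -> R -> R) (b : R -> R) (B : set R) v :
  measurable B -> 0 < v ->
  (forall y, v / 2 < y < 2 * v -> measurable_fun B (phi y)) ->
  (forall y s, v / 2 < y < 2 * v -> B s -> {for y, continuous (phi^~ s)}) ->
  mu.-integrable B (EFin \o b) ->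
  (forall y s, v / 2 < y < 2 * v -> B s -> `|phi y s| <= b s) ->
  {for v, continuous (fun y => \int[mu]_(s in B) phi y s)}.
Proof.
move=> mB v0 mphi cphi intb hb.
have int_phi y : (`]v / 2, 2 * v[%classic : set R) y -> mu.-integrable B (EFin \o phi y).
  rewrite /= in_itv/= => yv; apply: (le_integrable _ _ _ intb) => //.
    by apply/measurable_EFinP; exact: mphi.
  by move=> s Bs; rewrite /= lee_fin (le_trans (hb y s yv Bs))// ler_norm.
have := @continuity_under_integral R _ _ mu phi B mB (v / 2) (2 * v) int_phi _ b intb _.
move=> H; apply: (H _ _ v (mem_set (oo_near v0))).
- apply: aeW => s Bs y; rewrite inE/= in_itv/= => yv; exact: cphi.
- move=> y; rewrite /= in_itv/= => yv; apply: aeW => s Bs; exact: hb.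
Qed.

Lemma density_continuous2 u v : 0 < u -> 0 < v -> {for v, continuous (G u)}.
Proof.
move=> u0 v0.
have v20 : 0 < v / 2 by rewrite divr_gt0.
have V0 : 0 < 2 * v by rewrite mulr_gt0.
have pos y : v / 2 < y < 2 * v -> 0 < y by move=> /andP[/(lt_trans v20)].
have [B B0 hB] := rate_bounded kc (u + 2 * v) v20.
have c : {for v, continuous (fun y => \int[mu]_(s in `]0, u[) (k (s + y) * G y s))}.
  apply: (@Rintegral_oo_continuous (fun y s => k (s + y) * G y s) (fun s => B * G (2 * v) s)) => //.
  - move=> y _; apply: measurable_funM; last exact: (measurable_density mk k0).
    by apply: measurable_funTS; apply: (measurableT_comp mk); exact: measurable_funD.
  - move=> y s yv; rewrite /= in_itv/= => /andP[s0 su]; have y0 := pos y yv.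
    apply: cvgM; last exact: density_continuous1.
    by apply: is_derive_continuous; apply: shift_rate_is_derive; rewrite addr_gt0.
  - by apply: integrable_EFinZ => //; exact: intG.
  - move=> y s yv; rewrite /= in_itv/= => /andP[s0 su]; have y0 := pos y yv.
    rewrite ger0_norm ?mulr_ge0 ?density_ge0//; apply: ler_pM; rewrite ?density_ge0//.
      by apply: hB; move/andP: yv => [? ?]; apply/andP; split; lra.
    apply: (density_le mk k0 kc mass) => //; by move/andP: yv => [_ /ltW].
have c' : {for v, continuous (fun y => k y + \int[mu]_(s in `]0, u[) (k (s + y) * G y s))}.
  by apply: cvgD => //; exact: kc.
apply/continuous_epsP => e e0; have [d d0 hd] := (continuous_epsP _ _).1 c' e e0.
exists (Num.min d v); first by rewrite lt_min d0.
move=> y; rewrite lt_min => /andP[yd yv].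
have y0 : 0 < y by move: yv; rewrite ltr_norml => /andP[]; lra.
by rewrite (density_eq_fun y0 u0) (density_eq_fun v0 u0); exact: hd.
Qed.

Lemma density_continuous u v : 0 < u -> 0 < v -> continuous2_at G u v.
Proof.
move=> u0 v0; apply: continuous2_monotone => //.
- by move=> x x' y x0 y0 xx'; exact: (density_le mk k0 kc mass).
- exact: density_continuous1.
- by move=> x x0; exact: density_continuous2.
Qed.

(** The variable u is the upper bound of the integral in [density_eq]. This is
    the transport equation of the density along one of the two families of
    characteristics. *)
Lemma density_derive1 u v : 0 < u -> 0 < v ->
  is_derive u 1 (G^~ v) (k (u + v) * G v u).
Proof.
move=> u0 v0.
have cf : {for u, continuous (fun s => k (s + v) * G v s)}.
  apply: cvgM; last exact: density_continuous2.
  by apply: is_derive_continuous; apply: shift_rate_is_derive1; rewrite addr_gt0.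
have D := primitive_derive u0 (fun x (x0 : 0 < x) => intkG x0 v0) cf.
have D' : is_derive u 1 (fun x => k v + \int[mu]_(s in `]0, x[) (k (s + v) * G v s)) (k (u + v) * G v u).
  by rewrite -[X in is_derive _ _ _ X]add0r; exact: is_deriveD.
apply: near_eq_is_derive D'.
exists u => //= y; rewrite /ball/= => yu.
have y0 : 0 < y by move: yu; rewrite ltr_norml => /andP[]; lra.
by rewrite (density_eq_fun v0).
Qed.

Lemma Rintegral_oo_derive (phi dphi : R -> R -> R) (b : R -> R) (B : set R) v :
  measurable B -> 0 < v ->
  (forall y, v / 2 < y < 2 * v -> mu.-integrable B (EFin \o phi y)) ->
  (forall y s, v / 2 < y < 2 * v -> B s -> is_derive y 1 (phi^~ s) (dphi y s)) ->
  mu.-integrable B (EFin \o b) ->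
  (forall y s, v / 2 < y < 2 * v -> B s -> `|dphi y s| <= b s) ->
  is_derive v 1 (fun y => \int[mu]_(s in B) phi y s) (\int[mu]_(s in B) dphi v s).
Proof.
move=> mB v0 iphi dphi_ intb hb.
have Iy y : (`]v / 2, 2 * v[%classic : set R) y -> v / 2 < y < 2 * v by rewrite /= in_itv.
have intb' : mu.-integrable B (EFin \o (fun s => `|b s|)) by exact: integrable_norm intb.
have d1 y s : (`]v / 2, 2 * v[%classic : set R) y -> B s -> derivable (phi^~ s) y 1.
  by move=> /Iy yv Bs; have [] := dphi_ y s yv Bs.
have e1 y s : (`]v / 2, 2 * v[%classic : set R) y -> B s -> partial1of2 phi y s = dphi y s.
  by move=> /Iy yv Bs; rewrite partial1of2E; exact: (@derive_val _ _ _ _ _ _ _ (dphi_ y s yv Bs)).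
have ub y s : (`]v / 2, 2 * v[%classic : set R) y -> B s -> `|partial1of2 phi y s| <= `|b s|.
  move=> yv Bs; rewrite e1// (le_trans (hb y s (Iy y yv) Bs))// ler_norm//.
have H1 := @derivable_under_integral R _ _ mu phi B mB v (v / 2) (2 * v) (oo_near v0)
  (fun y yv => iphi y (Iy y yv)) d1 (fun s => `|b s|) (fun s => normr_ge0 _) intb' ub.
have H2 := @differentiation_under_integral R _ _ mu phi B mB v (v / 2) (2 * v) (oo_near v0)
  (fun y yv => iphi y (Iy y yv)) d1 (fun s => `|b s|) (fun s => normr_ge0 _) intb' ub.
apply: DeriveDef; first exact: H1.
rewrite -derive1E H2; apply: eq_Rintegral => s; rewrite inE => Bs.
by apply: e1 => //; exact: oo_near.
Qed.

(** The derivative in v of k (s + v) * G v s, where [density_derive1] replaces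
    the derivative of G in its first argument. *)
Definition kernel2 s v : R := k' (s + v) * G v s + k (s + v) ^+ 2 * G s v.
(** The partial derivative of the density in its second argument. *)
Definition density2 u v : R := k' v + \int[mu]_(s in `]0, u[) kernel2 s v.

Lemma rate'_continuous s : 0 < s -> {for s, continuous k'}.
Proof. by move=> s0; have [] := k1 s0. Qed.

Lemma measurable_rate' u y : 0 <= y -> measurable_fun `]0, u[ (fun s => k' (s + y)).
Proof.
move=> y0; apply: open_continuous_measurable_fun; first exact: interval_open.
move=> s; rewrite inE/= in_itv/= => /andP[s0 _].
have sy : 0 < s + y by rewrite ltr_wpDr.
suff H : (fun x => x + y) x @[x --> s] --> s + y by exact: (cvg_comp _ _ H (rate'_continuous sy)).
by apply: cvgD; [exact: cvg_id|exact: cvg_cst].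
Qed.

Lemma measurable_kernel2 u y : 0 <= y -> measurable_fun `]0, u[ (fun s => kernel2 s y).
Proof.
move=> y0; apply: measurable_funD; apply: measurable_funM.
- exact: measurable_rate'.
- exact: (measurable_density mk k0).
- apply: measurable_funX; apply: measurable_funTS.
  by apply: (measurableT_comp mk); exact: measurable_funD.
- exact: (measurable_density mk k0).
Qed.

Lemma rate_density_derive s v : 0 < s -> 0 < v ->
  is_derive v 1 (fun y => k (s + y) * G y s) (kernel2 s v).
Proof.
move=> s0 v0; have sv : 0 < s + v by rewrite addr_gt0.
have H : is_derive v 1 (fun y => k (s + y) * G y s) _ :=
  is_deriveM (shift_rate_is_derive sv) (density_derive1 v0 s0).
by apply: (is_derive_eq H); rewrite /kernel2 /GRing.scale/= (addrC v); ring.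
Qed.

(** These bounds allow to differentiate under the integral. The rate may be
    unbounded near 0, so y is kept away from 0, and G y s is dominated by an
    integrable function of s instead of a constant. *)
Lemma kernel2_bounds u v : 0 < u -> 0 < v -> exists B : R, [/\ 0 <= B,
  forall s y, 0 < s < u -> v / 2 < y < 2 * v ->
    [/\ `|k (s + y)| <= B, `|k' (s + y)| <= B, `|k' y| <= B & `|G s y| <= B] &
  forall s y, 0 < s < u -> v / 2 < y < 2 * v -> `|G y s| <= G (2 * v) s].
Proof.
move=> u0 v0.
have v20 : 0 < v / 2 by rewrite divr_gt0.
have V0 : 0 < 2 * v by rewrite mulr_gt0.
have pos y : v / 2 < y < 2 * v -> 0 < y by move=> /andP[/(lt_trans v20)].
have [B1 B10 hB1] := rate_bounded kc (u + 2 * v) v20.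
have [|B2 B20 hB2] := @continuous_itv_bounded _ k' (v / 2) (u + 2 * v).
  by move=> x /andP[vx _]; apply: rate'_continuous; exact: lt_le_trans vx.
pose I := \int[mu]_(s in `]0, u[) (B1 * G (2 * v) s).
have I0 : 0 <= I by apply: Rintegral_ge0 => s _; rewrite mulr_ge0// density_ge0.
have K s y : 0 < s < u -> v / 2 < y < 2 * v -> v / 2 <= s + y <= u + 2 * v.
  by move=> /andP[? ?] /andP[? ?]; apply/andP; split; lra.
have K' y : v / 2 < y < 2 * v -> v / 2 <= y <= u + 2 * v.
  by move=> /andP[? ?]; apply/andP; split; lra.
have mono s y : 0 < s < u -> v / 2 < y < 2 * v -> G y s <= G (2 * v) s.
  move=> /andP[s0 _] yv; apply: (density_le mk k0 kc mass) => //; first exact: pos.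
  by move/andP: yv => [_ /ltW].
exists (B1 + B2 + I); split; first by rewrite !addr_ge0.
- move=> s y su yv; have y0 := pos y yv; have sy := K s y su yv.
  have h1 := hB1 _ sy; have h1' := hB1 _ (K' y yv).
  split.
  + by rewrite ger0_norm//; lra.
  + by apply: (le_trans (hB2 _ sy)); lra.
  + by apply: (le_trans (hB2 _ (K' y yv))); lra.
  + rewrite ger0_norm ?density_ge0//.
    apply: (@le_trans _ _ (G u y)).
      by move/andP: su => [s0 su]; apply: (density_le mk k0 kc mass) => //; exact: ltW.
    rewrite (density_eq_fun y0 u0).
    apply: (@le_trans _ _ (B1 + I)); last by lra.
    apply: lerD => //; apply: le_Rintegral => //; first exact: intkG.
      by apply: integrable_EFinZ => //; exact: intG.
    move=> x; rewrite /= in_itv/= => xu; apply: ler_pM; rewrite ?density_ge0//.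
      exact: hB1 _ (K x y xu yv).
    exact: mono.
- by move=> s y su yv; rewrite ger0_norm ?density_ge0//; exact: mono.
Qed.

Lemma kernel2_dominated u v : 0 < u -> 0 < v -> exists b : R -> R,
  mu.-integrable `]0, u[ (EFin \o b) /\
  forall y s, v / 2 < y < 2 * v -> 0 < s < u -> `|kernel2 s y| <= b s.
Proof.
move=> u0 v0; have [B [B0 h1 h2]] := kernel2_bounds u0 v0.
have V0 : 0 < 2 * v by rewrite mulr_gt0.
exists (fun s => B * G (2 * v) s + B ^+ 2 * B); split.
  apply: integrable_EFinD => //; first by apply: integrable_EFinZ => //; exact: intG.
  exact: integrable_cst_oo.
move=> y s yv su; have [b1 b2 _ b3] := h1 s y su yv; have b4 := h2 s y su yv.
apply: (le_trans (ler_normD _ _)); rewrite (normrM (k' (s + y))) (normrM (k (s + y) ^+ 2)).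
apply: lerD; first by apply: ler_pM.
by apply: ler_pM => //; rewrite normrX lerXn2r// ?nnegrE.
Qed.

Lemma kernel2_integrable u v : 0 < u -> 0 < v -> mu.-integrable `]0, u[ (EFin \o (fun s => kernel2 s v)).
Proof.
move=> u0 v0; have [b [intb hb]] := kernel2_dominated u0 v0.
apply: (le_integrable _ _ _ intb) => //.
  by apply/measurable_EFinP; apply: measurable_kernel2; exact: ltW.
move=> s; rewrite /= in_itv/= => su; rewrite lee_fin (le_trans (hb v s _ su))// ?ler_norm//.
by have := oo_near v0; rewrite /= in_itv.
Qed.

Lemma near_pos_is_derive (f g : R -> R) x l : 0 < x -> (forall y, 0 < y -> f y = g y) ->
  is_derive x 1 f l -> is_derive x 1 g l.
Proof.
move=> x0 fg; apply: near_eq_is_derive.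
exists x => //= y; rewrite /ball/= => yx; apply: fg.
by move: yx; rewrite ltr_norml => /andP[]; lra.
Qed.

Lemma density_derive2 u v : 0 < u -> 0 < v -> is_derive v 1 (G u) (density2 u v).
Proof.
move=> u0 v0; have [b [intb hb]] := kernel2_dominated u0 v0.
have v20 : 0 < v / 2 by rewrite divr_gt0.
have pos y : v / 2 < y < 2 * v -> 0 < y by move=> /andP[/(lt_trans v20)].
have D : is_derive v 1 (fun y => \int[mu]_(s in `]0, u[) (k (s + y) * G y s))
    (\int[mu]_(s in `]0, u[) kernel2 s v).
  apply: (@Rintegral_oo_derive (fun y s => k (s + y) * G y s) (fun y s => kernel2 s y) b) => //.
  - by move=> y /pos y0; exact: intkG.
  - move=> y s /pos y0; rewrite /= in_itv/= => /andP[s0 _]; exact: rate_density_derive.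
have D' : is_derive v 1 (fun y => k y + \int[mu]_(s in `]0, u[) (k (s + y) * G y s)) (density2 u v).
  exact: is_deriveD (rate_is_derive v0) D.
by apply: near_pos_is_derive D' => // y y0; rewrite (density_eq_fun y0 u0).
Qed.

Lemma continuous2_swap (g : R -> R -> R) u v : continuous2_at g v u ->
  continuous2_at (fun x y => g y x) u v.
Proof.
move=> /continuous2_epsP c; apply/continuous2_epsP => e e0; have [d d0 hd] := c e e0.
by exists d => // x y xu yv; exact: hd.
Qed.

Lemma continuous2_add (f : R -> R) u v : {for u + v, continuous f} ->
  continuous2_at (fun x y => f (x + y)) u v.
Proof.
move=> /continuous_epsP c; apply/continuous2_epsP => e e0; have [d d0 hd] := c e e0.
exists (d / 2); first by rewrite divr_gt0.
move=> x y xu yv; apply: hd; rewrite opprD addrACA.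
by rewrite (le_lt_trans (ler_normD _ _))// [ltRHS]splitr ltrD.
Qed.

Lemma kernel2_continuous u v : 0 < u -> 0 < v -> continuous2_at kernel2 u v.
Proof.
move=> u0 v0; have uv : 0 < u + v by rewrite addr_gt0.
have c1 := continuous2_add (rate'_continuous uv).
have c2 := continuous2_add (kc uv).
have c3 := density_continuous u0 v0.
have c4 := continuous2_swap (density_continuous v0 u0).
by apply: cvgD; apply: cvgM => //; apply: cvgM.
Qed.

Lemma continuous2_section2 (g : R -> R -> R) u v : continuous2_at g u v -> {for v, continuous (g u)}.
Proof.
move=> /continuous2_epsP c; apply/continuous_epsP => e e0; have [d d0 hd] := c e e0.
by exists d => // y yv; apply: hd => //; rewrite subrr normr0.
Qed.

Lemma continuous2_section1 (g : R -> R -> R) u v : continuous2_at g u v -> {for u, continuous (g^~ v)}.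
Proof. by move=> /continuous2_swap/continuous2_section2. Qed.

Lemma density2_derive1 u v : 0 < u -> 0 < v -> is_derive u 1 (density2^~ v) (kernel2 u v).
Proof.
move=> u0 v0.
have D := primitive_derive u0 (fun x (x0 : 0 < x) => kernel2_integrable x0 v0)
  (continuous2_section1 (kernel2_continuous u0 v0)).
by rewrite -[X in is_derive _ _ _ X]add0r; exact: is_deriveD.
Qed.

Lemma density2_continuous2 u v : 0 < u -> 0 < v -> {for v, continuous (density2 u)}.
Proof.
move=> u0 v0; have [b [intb hb]] := kernel2_dominated u0 v0.
have v20 : 0 < v / 2 by rewrite divr_gt0.
have pos y : v / 2 < y < 2 * v -> 0 < y by move=> /andP[/(lt_trans v20)].
apply: cvgD; first exact: rate'_continuous.
apply: (@Rintegral_oo_continuous (fun y s => kernel2 s y) b) => //.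
- by move=> y /pos/ltW; exact: measurable_kernel2.
- move=> y s /pos y0; rewrite /= in_itv/= => /andP[s0 _].
  exact: continuous2_section2 (kernel2_continuous s0 y0).
Qed.

Lemma density2_continuous u v : 0 < u -> 0 < v -> continuous2_at density2 u v.
Proof.
move=> u0 v0.
have [d d0 hd] := (continuous2_epsP _ _ _).1 (kernel2_continuous u0 v0) 1 ltr01.
pose D := Num.min d (Num.min u v).
have D0 : 0 < D by rewrite !lt_min d0 u0.
apply: (@continuous2_lipschitz _ _ _ _ (`|kernel2 u v| + 1) D D0); first exact: density2_continuous2.
move=> x y xu yv.
have y0 : 0 < y by move: yv; rewrite !lt_min => /and3P[_ _]; rewrite ltr_norml => /andP[]; lra.
have yd : `|y - v| < d by move: yv; rewrite lt_min => /andP[].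
have der z : `|z - u| < D -> is_derive z 1 (density2^~ y) (kernel2 z y).
  rewrite !lt_min => /and3P[_ zu _]; apply: density2_derive1 => //.
  by move: zu; rewrite ltr_norml => /andP[]; lra.
have [c cu ->] := mean_value der xu.
rewrite normrM; apply: ler_wpM2r => //.
have cd : `|c - u| < d by move: (le_lt_trans cu xu); rewrite lt_min => /andP[].
rewrite -lerBlDl (le_trans (lerB_dist _ _))// ltW//; exact: hd.
Qed.

(** The second derivative of the rate enters here, through the term k' v of
    [density2] and through the kernel. *)
Lemma density2_derive2 u v : C1_pos k' -> 0 < u -> 0 < v ->
  exists W, is_derive v 1 (density2 u) W.
Proof.
move=> k2 u0 v0; have [B [B0 h1 h2]] := kernel2_bounds u0 v0.
have [b [intb hb]] := kernel2_dominated u0 v0.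
have V0 : 0 < 2 * v by rewrite mulr_gt0.
have v20 : 0 < v / 2 by rewrite divr_gt0.
have pos y : v / 2 < y < 2 * v -> 0 < y by move=> /andP[/(lt_trans v20)].
pose k'' := (k'^`()%classic).
have k'd s : 0 < s -> is_derive s 1 k' (k'' s).
  exact: C1_pos_is_derive.
have [|B2 B20 hB2] := @continuous_itv_bounded _ k'' (v / 2) (u + 2 * v).
  by move=> x /andP[vx _]; have [] := k2 x (lt_le_trans v20 vx).
pose kernel3 s y := k'' (s + y) * G y s + k' (s + y) * (k (y + s) * G s y) +
  (2 * k (s + y) * k' (s + y) * G s y + k (s + y) ^+ 2 * density2 s y).
have der s y : 0 < s -> 0 < y -> is_derive y 1 (kernel2 s) (kernel3 s y).
  move=> s0 y0; have sy : 0 < s + y by rewrite addr_gt0.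
  have shift_der (f : R -> R) l : is_derive (s + y) 1 f l -> is_derive y 1 (fun x => f (s + x)) l.
    move=> H; have H2 : is_derive y 1 (fun x => s + x) 1.
      apply: (is_derive_eq (is_deriveD (is_derive_cst s y 1) (is_derive_id y 1))).
      by rewrite add0r.
    have H' : is_derive ((fun x => s + x) y) 1 f l by [].
    by have := is_derive1_comp H' H2; rewrite mulr1.
  have d1 : is_derive y 1 (fun x => k' (s + x) * G x s) _ :=
    is_deriveM (shift_der _ _ (k'd _ sy)) (density_derive1 y0 s0).
  have d2 : is_derive y 1 (fun x => k (s + x) * k (s + x)) _ :=
    is_deriveM (shift_rate_is_derive sy) (shift_rate_is_derive sy).
  have d3 : is_derive y 1 (fun x => k (s + x) * k (s + x) * G s x) _ :=
    is_deriveM d2 (density_derive2 s0 y0).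
  have d4 : is_derive y 1 (fun x => k' (s + x) * G x s + k (s + x) * k (s + x) * G s x) _ :=
    is_deriveD d1 d3.
  apply: (is_derive_eq d4); rewrite /kernel3 /GRing.scale/=; ring.
pose C := B + \int[mu]_(s in `]0, u[) b s.
have b0 s : 0 < s < u -> 0 <= b s.
  by move=> su; apply: le_trans (hb v s _ su) => //; have := oo_near v0; rewrite /= in_itv.
have hC s y : 0 < s < u -> v / 2 < y < 2 * v -> `|density2 s y| <= C.
  move=> su yv; have [_ _ b3 _] := h1 s y su yv; have y0 := pos y yv; have /andP[s0 su'] := su.
  apply: (le_trans (ler_normD _ _)); apply: lerD => //.
  apply: (le_trans (le_normr_Rintegral _ (kernel2_integrable s0 y0))) => //.
  have ib : mu.-integrable `]0, s[ (EFin \o b).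
    apply: (integrableS _ _ _ intb) => //.
    by move=> x /=; rewrite !in_itv/= => /andP[-> /lt_trans]; exact.
  apply: (@le_trans _ _ (\int[mu]_(x in `]0, s[) b x)).
    apply: le_Rintegral => //; first exact: (integrable_norm (kernel2_integrable s0 y0)).
    move=> x; rewrite /= in_itv/= => /andP[x0 xs]; apply: hb => //.
    by rewrite x0 (lt_trans xs).
  rewrite -lee_fin /Rintegral !fineK; try exact: integrable_fin_num.
  apply: ge0_subset_integral => //.
  - by have /integrableP[] := intb.
  - by move=> x; rewrite /= !in_itv/= => /andP[-> /lt_trans]; exact.
pose b' s := B2 * G (2 * v) s + B * (B * B) + (2 * B * B * B + B ^+ 2 * C).
have hb' y s : v / 2 < y < 2 * v -> 0 < s < u -> `|kernel3 s y| <= b' s.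
  move=> yv su; have [b1 b2 _ b3] := h1 s y su yv; have b4 := h2 s y su yv; have b5 := hC s y su yv.
  have b6 : `|k'' (s + y)| <= B2.
    by apply: hB2; move/andP: yv => [? ?]; move/andP: su => [? ?]; apply/andP; split; lra.
  rewrite /kernel3 /b' (addrC y s).
  move: (k'' (s + y)) (k' (s + y)) (k (s + y)) (G y s) (G s y) (density2 s y) (G (2 * v) s) b1 b2 b3 b4 b5 b6.
  move=> a1 a2 a3 a4 a5 a6 a7 b1 b2 b3 b4 b5 b6.
  apply: (le_trans (ler_normD _ _)); apply: lerD; apply: (le_trans (ler_normD _ _)); apply: lerD; rewrite !normrM.
  - by apply: ler_pM.
  - by apply: ler_pM => //; apply: ler_pM.
  - rewrite (ger0_norm (ler0n R 2)); have n2 := ler0n R 2.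
    apply: ler_pM; [by rewrite !mulr_ge0|exact: normr_ge0| |exact: b3].
    apply: ler_pM; [by rewrite mulr_ge0|exact: normr_ge0| |exact: b2].
    by apply: ler_wpM2l.
  - rewrite expr2; apply: ler_pM; [by rewrite mulr_ge0|exact: normr_ge0| |exact: b5].
    exact: ler_pM.
exists (k'' v + \int[mu]_(s in `]0, u[) kernel3 s v).
apply: is_deriveD; first exact: k'd.
apply: (@Rintegral_oo_derive (fun y s => kernel2 s y) (fun y s => kernel3 s y) b') => //.
- by move=> y /pos y0; exact: kernel2_integrable.
- by move=> y s /pos y0; rewrite /= in_itv/= => /andP[s0 _]; exact: der.
- apply: integrable_EFinD => //; last exact: integrable_cst_oo.
  apply: integrable_EFinD => //; last exact: integrable_cst_oo.
  by apply: integrable_EFinZ => //; exact: intG.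
Qed.
End density_regularity.

(** * The classical equation *)

Section cone_agreement.
Context {R : realType}.
Variable c : R.
Hypothesis c_gt0 : 0 < c.
Implicit Types (f g : R -> R -> R) (eta t : R).

Lemma cone_near_t eta t : `|eta| < c * t -> \forall s \near t, `|eta| < c * s.
Proof.
move=> h; exists (t - `|eta| / c); rewrite /= ?subr_gt0 ?ltr_pdivrMr// 1?mulrC// => s.
rewrite /ball/= ltr_norml => /andP[_ h2]; have h3 : `|eta| / c < s by lra.
by rewrite mulrC -ltr_pdivrMr.
Qed.

Lemma cone_near_eta eta t : `|eta| < c * t -> \forall e \near eta, `|e| < c * t.
Proof.
move=> h; exists (c * t - `|eta|); rewrite /= ?subr_gt0// => s.
rewrite /ball/= distrC => h2; have := ler_normD (s - eta) eta; rewrite subrK; lra.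
Qed.

(** The properties to be proved of a density depend on its values on the open
    cone alone. *)
Definition cone_agree f g := forall eta t, `|eta| < c * t -> f eta t = g eta t.

Lemma agree_near_t f g eta t : cone_agree f g -> `|eta| < c * t ->
  \forall s \near t, f eta s = g eta s.
Proof. by move=> fg /cone_near_t; apply: filterS => s; exact: fg. Qed.

Lemma agree_near_eta f g eta t : cone_agree f g -> `|eta| < c * t ->
  \forall e \near eta, f^~ t e = g^~ t e.
Proof. by move=> fg /cone_near_eta; apply: filterS => s; exact: fg. Qed.

Lemma agree_is_derive_t f g eta t x : cone_agree f g -> `|eta| < c * t ->
  is_derive t 1 (f eta) x -> is_derive t 1 (g eta) x.
Proof. by move=> fg h; apply: near_eq_is_derive; exact: agree_near_t. Qed.

Lemma agree_is_derive_eta f g eta t x : cone_agree f g -> `|eta| < c * t ->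
  is_derive eta 1 (f^~ t) x -> is_derive eta 1 (g^~ t) x.
Proof. by move=> fg h; apply: near_eq_is_derive; exact: agree_near_eta. Qed.

Lemma is_derive_d_t f eta t x : is_derive t 1 (f eta) x -> d_t f eta t = x.
Proof. by move=> H; rewrite /d_t derive1E; exact: (@derive_val _ _ _ _ _ _ _ H). Qed.

Lemma is_derive_d_eta f eta t x : is_derive eta 1 (f^~ t) x -> d_eta f eta t = x.
Proof. by move=> H; rewrite /d_eta derive1E; exact: (@derive_val _ _ _ _ _ _ _ H). Qed.

Lemma pde_classical_of (l : R -> R) f (ft fe ftt fee : R -> R -> R) :
  (forall eta t, `|eta| < c * t -> is_derive t 1 (f eta) (ft eta t)) ->
  (forall eta t, `|eta| < c * t -> is_derive eta 1 (f^~ t) (fe eta t)) ->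
  (forall eta t, `|eta| < c * t -> is_derive t 1 (ft eta) (ftt eta t)) ->
  (forall eta t, `|eta| < c * t -> is_derive eta 1 (fe^~ t) (fee eta t)) ->
  (forall eta t, `|eta| < c * t ->
    ftt eta t + 2 * l t * ft eta t
      + 2 / 3 * (4 / 3 * l t ^+ 2 + l^`()%classic t) * f eta t = c ^+ 2 * fee eta t) ->
  pde_classical c l f.
Proof.
move=> h1 h2 h3 h4 E eta t h.
have aft : cone_agree (d_t f) ft by move=> x s xs; apply: is_derive_d_t; exact: h1.
have afe : cone_agree (d_eta f) fe by move=> x s xs; apply: is_derive_d_eta; exact: h2.
have atf : cone_agree ft (d_t f) by move=> x s xs; rewrite aft.
have aef : cone_agree fe (d_eta f) by move=> x s xs; rewrite afe.
have D1 := agree_is_derive_t atf h (h3 _ _ h).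
have D2 := agree_is_derive_eta aef h (h4 _ _ h).
split.
- by split; [have [] := h1 _ _ h|have [] := D1].
- by split; [have [] := h2 _ _ h|have [] := D2].
- by rewrite (is_derive_d_t D1) (is_derive_d_eta D2) aft// E.
Qed.

Lemma agree_pde_classical (l : R -> R) f g : cone_agree f g ->
  pde_classical c l f -> pde_classical c l g.
Proof.
move=> fg H.
have gf : cone_agree g f by move=> x s xs; rewrite fg.
apply: (@pde_classical_of l g (d_t f) (d_eta f) (d_t (d_t f)) (d_eta (d_eta f))) => eta t h;
  have [[a1 a2] [b1 b2] e] := H eta t h.
- by apply: (agree_is_derive_t fg h); apply: DeriveDef; [exact: a1|rewrite /d_t derive1E].
- by apply: (agree_is_derive_eta fg h); apply: DeriveDef; [exact: b1|rewrite /d_eta derive1E].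
- by apply: DeriveDef; [exact: a2|rewrite {2}/d_t derive1E].
- by apply: DeriveDef; [exact: b2|rewrite {2}/d_eta derive1E].
- by rewrite gf.
Qed.
End cone_agreement.

Section characteristic_derivative.
Context {R : realType}.
Variables (g g1 g2 : R -> R -> R).
Hypothesis d1 : forall u v : R, 0 < u -> 0 < v -> is_derive u 1 (g^~ v) (g1 u v).
Hypothesis c1 : forall u v : R, 0 < u -> 0 < v -> continuous2_at g1 u v.
Hypothesis d2 : forall u v : R, 0 < u -> 0 < v -> is_derive v 1 (g u) (g2 u v).

Lemma characteristic_derive (p q : R -> R) (p0 q0 a b x : R) :
  (forall z, p z = p0 + a * z) -> (forall z, q z = q0 + b * z) -> 0 < p x -> 0 < q x ->
  is_derive x 1 (fun z => g (p z) (q z)) (a * g1 (p x) (q x) + b * g2 (p x) (q x)).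
Proof.
move=> hp hq px qx.
rewrite (_ : (fun z => g (p z) (q z)) = (fun z => g (p0 + a * z) (q0 + b * z))); last first.
  by apply/funext => z; rewrite hp hq.
have D0 : 0 < Num.min (p x) (q x) by rewrite lt_min px.
rewrite !hp !hq in px qx D0 *.
apply: (@is_derive_line _ g g1 _ p0 q0 a b _ x D0).
- move=> z y; rewrite !lt_min => /andP[zp _] /andP[_ yq]; apply: d1.
    by move: zp; rewrite ltr_norml => /andP[]; lra.
  by move: yq; rewrite ltr_norml => /andP[]; lra.
- exact: c1.
- exact: d2.
Qed.
End characteristic_derivative.

Section explicit_density.
Context {R : realType}.
Local Notation mu := (@lebesgue_measure R).
Variable k : R -> R.
Hypothesis mk : measurable_fun [set: R] k.
Hypothesis k0 : forall s, 0 <= k s.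
Hypothesis k1 : C1_pos k.
Hypothesis ki : forall t, mu.-integrable `]0, t] (EFin \o k).
Hypothesis mass : forall t, 0 < t ->
  (\int[mu]_(v in `]0%R, t[) total_density k (t - v)%R v < +oo)%E.
Variable c : R.
Hypothesis c_gt0 : 0 < c.
Implicit Types (s t u v x y eta : R).
Local Notation G := (density k).
Local Notation k' := (k^`()%classic).
Local Notation M := (cumulative_rate k).

(** The characteristic coordinates. On the edge they are the times spent up to
    t in the directions d_0 and d_1. *)
Definition char_u eta t : R := (t + eta / c) / 2.
Definition char_v eta t : R := (t - eta / c) / 2.

Lemma char_sum eta t : char_u eta t + char_v eta t = t.
Proof. by rewrite /char_u /char_v; field; rewrite gt_eqF. Qed.

Lemma char_u_gt0 eta t : `|eta| < c * t -> 0 < char_u eta t.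
Proof.
rewrite ltr_norml => /andP[h _]; rewrite divr_gt0//.
by rewrite -(pmulr_rgt0 _ c_gt0) mulrDr mulrCA divff ?gt_eqF// mulr1; lra.
Qed.

Lemma char_v_gt0 eta t : `|eta| < c * t -> 0 < char_v eta t.
Proof.
rewrite ltr_norml => /andP[_ h]; rewrite divr_gt0//.
by rewrite -(pmulr_rgt0 _ c_gt0) mulrBr mulrCA divff ?gt_eqF// mulr1; lra.
Qed.

Lemma cone_time_gt0 eta t : `|eta| < c * t -> 0 < t.
Proof. by move=> h; rewrite -(pmulr_rgt0 _ c_gt0) (le_lt_trans _ h). Qed.

Lemma cumulative_rate_derive t : 0 < t -> is_derive t 1 M (k t).
Proof.
move=> t0.
have ki' x : 0 < x -> mu.-integrable `]0, x[ (EFin \o k).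
  move=> x0; apply: (integrableS _ _ _ (ki x)) => //.
  by move=> y /=; rewrite !in_itv/= => /andP[-> /ltW].
have := primitive_derive t0 ki' (rate_continuous k1 t0).
apply: (@near_pos_is_derive _ _ _ t (k t) t0) => y y0.
by rewrite Rintegral_oo_oc//; exact: ki'.
Qed.

(** The probability that a clock of rate 3 * k does not ring before t. *)
Definition damping t : R := expR (- (3 * M t)).

Lemma damping_derive t : 0 < t -> is_derive t 1 damping (- (3 * k t) * damping t).
Proof.
move=> t0.
have H1 : is_derive t 1 (fun s => 3 * M s) (3 * k t).
  have H : is_derive t 1 (fun s => 3 * M s) _ := is_deriveZ 3 (cumulative_rate_derive t0).
  exact: (is_derive_eq H).
have H2 : is_derive t 1 (fun s => - (3 * M s)) (- (3 * k t)) := is_deriveN H1.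
have H3 := @is_derive_expR R (- (3 * M t)).
pose h s : R := - (3 * M s).
have H2' : is_derive t 1 h (- (3 * k t)) by [].
have H3' : is_derive (h t) 1 expR (expR (h t)) by [].
by have := is_derive1_comp H3' H2'; rewrite mulrC.
Qed.

Lemma along_t (g g1 g2 : R -> R -> R) eta t :
  (forall u v, 0 < u -> 0 < v -> is_derive u 1 (g^~ v) (g1 u v)) ->
  (forall u v, 0 < u -> 0 < v -> continuous2_at g1 u v) ->
  (forall u v, 0 < u -> 0 < v -> is_derive v 1 (g u) (g2 u v)) ->
  `|eta| < c * t ->
  let u := char_u eta t in let v := char_v eta t in
  [/\ is_derive t 1 (fun s => g (char_u eta s) (char_v eta s)) ((g1 u v + g2 u v) / 2),
      is_derive t 1 (fun s => g (char_v eta s) (char_u eta s)) ((g1 v u + g2 v u) / 2),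
      is_derive eta 1 (fun e => g (char_u e t) (char_v e t)) ((g1 u v - g2 u v) / (2 * c))
    & is_derive eta 1 (fun e => g (char_v e t) (char_u e t)) ((g2 v u - g1 v u) / (2 * c))].
Proof.
move=> d1 c1 d2 h u v; have u0 := char_u_gt0 h; have v0 := char_v_gt0 h.
have cn : c != 0 by rewrite gt_eqF.
have A1 z : char_u eta z = eta / c / 2 + 2^-1 * z by rewrite /char_u; field.
have A2 z : char_v eta z = - (eta / c / 2) + 2^-1 * z by rewrite /char_v; field.
have A3 z : char_u z t = t / 2 + (2 * c)^-1 * z by rewrite /char_u; field.
have A4 z : char_v z t = t / 2 + (- (2 * c)^-1) * z by rewrite /char_v; field.
split.
- apply: (is_derive_eq (characteristic_derive d1 c1 d2 A1 A2 u0 v0)).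
  by rewrite -/u -/v; field.
- apply: (is_derive_eq (characteristic_derive d1 c1 d2 A2 A1 v0 u0)).
  by rewrite -/u -/v; field.
- apply: (is_derive_eq (characteristic_derive d1 c1 d2 A3 A4 u0 v0)).
  by rewrite -/u -/v; field.
- apply: (is_derive_eq (characteristic_derive d1 c1 d2 A4 A3 v0 u0)).
  by rewrite -/u -/v; field.
Qed.

Let cR u v : 0 < u -> 0 < v -> continuous2_at (fun x y => k (x + y) * G y x) u v.
Proof.
move=> u0 v0; have uv : 0 < u + v by rewrite addr_gt0.
by apply: cvgM; [exact: continuous2_add (rate_continuous k1 uv)|
  exact: continuous2_swap (density_continuous mk k0 k1 mass v0 u0)].
Qed.

Lemma density_along eta t : `|eta| < c * t ->
  let u := char_u eta t in let v := char_v eta t in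
  [/\ is_derive t 1 (fun s => G (char_u eta s) (char_v eta s))
        ((k t * G v u + density2 k u v) / 2),
      is_derive t 1 (fun s => G (char_v eta s) (char_u eta s))
        ((k t * G u v + density2 k v u) / 2),
      is_derive eta 1 (fun e => G (char_u e t) (char_v e t))
        ((k t * G v u - density2 k u v) / (2 * c))
    & is_derive eta 1 (fun e => G (char_v e t) (char_u e t))
        ((density2 k v u - k t * G u v) / (2 * c))].
Proof.
move=> h u v.
have := along_t (density_derive1 mk k0 k1 mass) cR (density_derive2 mk k0 k1 mass) h.
by cbv zeta; rewrite -/u -/v (addrC v u) (char_sum eta t : u + v = t).
Qed.

(** Up to a constant, the densities on the edge of the particles that move in
    the direction d_0, respectively d_1. *)
Definition forward eta t : R := damping t * G (char_u eta t) (char_v eta t).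
Definition backward eta t : R := damping t * G (char_v eta t) (char_u eta t).

(** The density of X - Y on the edge X + Y = c * t, see [edge_law]. *)
Definition edge eta t : R := (forward eta t + backward eta t) / (8 * c).

Definition edge_t eta t : R :=
  let u := char_u eta t in let v := char_v eta t in
  damping t * (- (5 / 2) * (k t * (G u v + G v u)) + (density2 k u v + density2 k v u) / 2) / (8 * c).
Definition edge_eta eta t : R :=
  let u := char_u eta t in let v := char_v eta t in
  damping t * (density2 k v u - density2 k u v + k t * (G v u - G u v)) / (16 * c ^+ 2).

(** Together with [backward_derive] this is the hyperbolic system f+_t + c
    f+_eta = - 3 k f+ + k f-, f-_t - c f-_eta = - 3 k f- + k f+ with f+ =
    forward and f- = backward. *)
Lemma forward_derive eta t : `|eta| < c * t ->
  let u := char_u eta t in let v := char_v eta t in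
  is_derive t 1 (forward eta)
    (damping t * (- (3 * k t) * G u v + (k t * G v u + density2 k u v) / 2)) /\
  is_derive eta 1 (forward^~ t)
    (damping t * ((k t * G v u - density2 k u v) / (2 * c))).
Proof.
move=> h u v; have [a1 _ a3 _] := density_along h; have t0 := cone_time_gt0 h.
rewrite -/u -/v in a1 a3; split.
- have H : is_derive t 1 (forward eta) _ := is_deriveM (damping_derive t0) a1.
  by apply: (is_derive_eq H); rewrite /GRing.scale/= -/u -/v; ring.
- have H : is_derive eta 1 (forward^~ t) _ := is_deriveZ (damping t) a3.
  exact: (is_derive_eq H).
Qed.

Lemma backward_derive eta t : `|eta| < c * t ->
  let u := char_u eta t in let v := char_v eta t in
  is_derive t 1 (backward eta)
    (damping t * (- (3 * k t) * G v u + (k t * G u v + density2 k v u) / 2)) /\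
  is_derive eta 1 (backward^~ t)
    (damping t * ((density2 k v u - k t * G u v) / (2 * c))).
Proof.
move=> h u v; have [_ a1 _ a3] := density_along h; have t0 := cone_time_gt0 h.
rewrite -/u -/v in a1 a3; split.
- have H : is_derive t 1 (backward eta) _ := is_deriveM (damping_derive t0) a1.
  by apply: (is_derive_eq H); rewrite /GRing.scale/= -/u -/v; ring.
- have H : is_derive eta 1 (backward^~ t) _ := is_deriveZ (damping t) a3.
  exact: (is_derive_eq H).
Qed.

Lemma edge_derive eta t : `|eta| < c * t ->
  is_derive t 1 (edge eta) (edge_t eta t) /\ is_derive eta 1 (edge^~ t) (edge_eta eta t).
Proof.
move=> h; have [f1 f2] := forward_derive h; have [b1 b2] := backward_derive h.
have cn : c != 0 by rewrite gt_eqF.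
split.
- have H0 : is_derive t 1 (fun s => (8 * c)^-1 * (forward eta s + backward eta s)) _ :=
    is_deriveZ (8 * c)^-1 (is_deriveD f1 b1).
  rewrite (_ : edge eta = fun s => (8 * c)^-1 * (forward eta s + backward eta s)); last first.
    by apply/funext => s; rewrite /edge mulrC.
  apply: (is_derive_eq H0); rewrite /edge_t /GRing.scale/=.
  move: (G _ _) (G _ _) (density2 _ _ _) (density2 _ _ _) (damping t) (k t) => x1 x2 x3 x4 x5 x6.
  by field.
- have H0 : is_derive eta 1 (fun s => (8 * c)^-1 * (forward s t + backward s t)) _ :=
    is_deriveZ (8 * c)^-1 (is_deriveD f2 b2).
  rewrite (_ : edge^~ t = fun s => (8 * c)^-1 * (forward s t + backward s t)); last first.
    by apply/funext => s; rewrite /edge mulrC.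
  apply: (is_derive_eq H0); rewrite /edge_eta /GRing.scale/=.
  move: (G _ _) (G _ _) (density2 _ _ _) (density2 _ _ _) (damping t) (k t) => x1 x2 x3 x4 x5 x6.
  by field.
Qed.

(** All derivatives are taken along lines in the characteristic coordinates.
    The second derivatives of the density in its second argument occur in both
    members with the same coefficient and cancel. *)
Lemma edge_pde (l : R -> R) :
  (forall t, 0 < t -> l t = 3 * k t) -> (forall t, 0 < t -> l^`()%classic t = 3 * k' t) ->
  C1_pos k' -> pde_classical c l edge.
Proof.
move=> lk lk' k2.
have cn : c != 0 by rewrite gt_eqF.
have [W hW] : exists W : R -> R -> R, forall u v, 0 < u -> 0 < v ->
    is_derive v 1 (density2 k u) (W u v).
  pose W u v : R := (density2 k u)^`()%classic v.
  exists W => u v u0 v0; have [w [dw _]] := density2_derive2 mk k0 k1 mass k2 u0 v0.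
  by apply: DeriveDef; [exact: dw|rewrite /W derive1E].
have A eta t (h : `|eta| < c * t) := along_t (density2_derive1 mk k0 k1 mass)
  (kernel2_continuous mk k0 k1 mass) hW h.
pose S eta t : R := G (char_u eta t) (char_v eta t) + G (char_v eta t) (char_u eta t).
pose D eta t : R := G (char_v eta t) (char_u eta t) - G (char_u eta t) (char_v eta t).
pose T eta t : R := density2 k (char_u eta t) (char_v eta t) + density2 k (char_v eta t) (char_u eta t).
pose E eta t : R := density2 k (char_v eta t) (char_u eta t) - density2 k (char_u eta t) (char_v eta t).
pose V eta t : R := W (char_u eta t) (char_v eta t) + W (char_v eta t) (char_u eta t).
pose ftt eta t : R := damping t * (- (3 * k t) * (- (5 / 2) * (k t * S eta t) + T eta t / 2)
  + (- (5 / 2) * (k' t * S eta t + k t * ((k t * S eta t + T eta t) / 2)))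
  + ((k' t + k t ^+ 2) * S eta t + V eta t) / 4) / (8 * c).
pose fee eta t : R := damping t * ((V eta t - (k' t + k t ^+ 2) * S eta t) / (2 * c)
   + k t * ((T eta t - k t * S eta t) / (2 * c))) / (16 * c ^+ 2).
apply: (@pde_classical_of _ c c_gt0 l edge edge_t edge_eta ftt fee) => eta t h.
- by have [] := edge_derive h.
- by have [] := edge_derive h.
- have t0 := cone_time_gt0 h; have [a1 a2 _ _] := density_along h; have [b1 b2 _ _] := A eta t h.
  have kd := rate_is_derive k1 t0.
  have S1 : is_derive t 1 (S eta) _ := is_deriveD a1 a2.
  have T1 : is_derive t 1 (T eta) _ := is_deriveD b1 b2.
  have K1 : is_derive t 1 (fun s => k s * S eta s) _ := is_deriveM kd S1.
  have K2 : is_derive t 1 (fun s => - (5 / 2) * (k s * S eta s)) _ := is_deriveZ (- (5 / 2)) K1.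
  have T2 : is_derive t 1 (fun s => 2^-1 * T eta s) _ := is_deriveZ 2^-1 T1.
  have H1 : is_derive t 1 (fun s => - (5 / 2) * (k s * S eta s) + 2^-1 * T eta s) _ := is_deriveD K2 T2.
  have H2 : is_derive t 1 (fun s => damping s * (- (5 / 2) * (k s * S eta s) + 2^-1 * T eta s)) _ :=
    is_deriveM (damping_derive t0) H1.
  have H3 : is_derive t 1 (fun s => (8 * c)^-1 * (damping s * (- (5 / 2) * (k s * S eta s) + 2^-1 * T eta s))) _ :=
    is_deriveZ (8 * c)^-1 H2.
  rewrite (_ : edge_t eta = fun s => (8 * c)^-1 * (damping s * (- (5 / 2) * (k s * S eta s) + 2^-1 * T eta s))); last first.
    by apply/funext => s; rewrite /edge_t /S /T [RHS]mulrC [in RHS](mulrC 2^-1).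
  apply: (is_derive_eq H3); rewrite /ftt /S /T /V /kernel2 /GRing.scale/= (addrC (char_v eta t)) (char_sum eta t).
  move: (G _ _) (G _ _) (density2 _ _ _) (density2 _ _ _) (damping t) (k t) (k' t) (W _ _) (W _ _) => x1 x2 x3 x4 x5 x6 x7 x8 x9.
  by field.
- have t0 := cone_time_gt0 h; have [_ _ a1 a2] := density_along h; have [_ _ b1 b2] := A eta t h.
  have S1 : is_derive eta 1 (D^~ t) _ := is_deriveB a2 a1.
  have T1 : is_derive eta 1 (E^~ t) _ := is_deriveB b2 b1.
  have K1 : is_derive eta 1 (fun s => k t * D s t) _ := is_deriveZ (k t) S1.
  have H1 : is_derive eta 1 (fun s => E s t + k t * D s t) _ := is_deriveD T1 K1.
  have H2 : is_derive eta 1 (fun s => (16 * c ^+ 2)^-1 * damping t * (E s t + k t * D s t)) _ :=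
    is_deriveZ ((16 * c ^+ 2)^-1 * damping t) H1.
  rewrite (_ : edge_eta^~ t = fun s => (16 * c ^+ 2)^-1 * damping t * (E s t + k t * D s t)); last first.
    apply/funext => s; rewrite /edge_eta /E /D.
    move: (G _ _) (G _ _) (density2 _ _ _) (density2 _ _ _) (damping t) (k t) => x1 x2 x3 x4 x5 x6.
    by field.
  apply: (is_derive_eq H2); rewrite /fee /S /T /V /kernel2 /GRing.scale/= (addrC (char_v eta t)) (char_sum eta t).
  move: (G _ _) (G _ _) (density2 _ _ _) (density2 _ _ _) (damping t) (k t) (k' t) (W _ _) (W _ _) => x1 x2 x3 x4 x5 x6 x7 x8 x9.
  by field.
- have t0 := cone_time_gt0 h; rewrite lk// lk'// /ftt /fee /edge_t /edge /forward /backward /S /T /V /=.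
  move: (G _ _) (G _ _) (density2 _ _ _) (density2 _ _ _) (damping t) (k t) (k' t) (W _ _) (W _ _) => x1 x2 x3 x4 x5 x6 x7 x8 x9.
  by field.
Qed.
End explicit_density.

(** * A divergence theorem on the cone *)

Section plane.
Context {R : realType}.
Local Notation mu := (@lebesgue_measure R).
Implicit Types (g f : R -> R -> R) (x y u v s t eta : R).

(** An open set of the plane is the countable union of the rational boxes that
    it contains. *)
Lemma open2_measurable (O : set (R * R)) : open O -> measurable (O : set (measurableTypeR R * measurableTypeR R)).
Proof.
move=> oO.
pose box (q r e : rat) : set (measurableTypeR R * measurableTypeR R) :=
  `](ratr q - ratr e)%R, (ratr q + ratr e)%R[%classic `*`
  `](ratr r - ratr e)%R, (ratr r + ratr e)%R[%classic.
pose U q r e := if `[< box q r e `<=` O >] then box q r e else set0.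
have -> : O = \bigcup_q \bigcup_r \bigcup_e U q r e.
  apply/seteqP; split=> [[x y] Oxy|p [q _ [r _ [e _]]]]; last first.
    by rewrite /U; case: asboolP => // h; exact: h.
  have /nbhs_ballP[e /= e0 he] := open_nbhs_nbhs (conj oO Oxy).
  have [d /itvP dP] := rat_in_itvoo (divr_gt0 e0 (ltr0Sn R 1)).
  have d0 : (0 : R) < ratr d by rewrite dP.
  have d2 : ratr d < e / 2 by rewrite dP.
  have xd : x - ratr d < x + ratr d by lra.
  have yd : y - ratr d < y + ratr d by lra.
  have [q /itvP qP] := rat_in_itvoo xd.
  have [r /itvP rP] := rat_in_itvoo yd.
  have q1 : x - ratr d < ratr q by rewrite qP.
  have q2 : ratr q < x + ratr d by rewrite qP.
  have r1 : y - ratr d < ratr r by rewrite rP.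
  have r2 : ratr r < y + ratr d by rewrite rP.
  have hbox : box q r d `<=` O.
    move=> [a b] [/=]; rewrite !in_itv/= => /andP[a1 a2] /andP[b1 b2].
    by apply: he; split; rewrite /ball/= ltr_norml; apply/andP; split; lra.
  exists q => //; exists r => //; exists d => //; rewrite /U asboolT//.
  by split; rewrite /= in_itv/=; apply/andP; split; lra.
apply: bigcupT_measurable_rat => q; apply: bigcupT_measurable_rat => r.
apply: bigcupT_measurable_rat => e; rewrite /U; case: ifP => // _.
by apply: measurableX; exact: measurable_itv.
Qed.

Lemma continuous2_measurable g : (forall x y, continuous2_at g x y) ->
  measurable_fun [set: measurableTypeR R * measurableTypeR R] (fun p => g p.1 p.2).
Proof.
move=> cg; apply: (measurability _ (RGenOpens.measurableE R)).
move=> _ [_ [a [b ->] <-]]; rewrite setTI; apply: open2_measurable.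
have cg' : continuous (fun q : R * R => g q.1 q.2) by move=> [x y]; exact: cg.
by move/continuousP: cg'; apply; exact: interval_open.
Qed.

Lemma compact2_bounded (C : set (R * R)) : compact C ->
  exists2 M, 0 < M & forall x y, C (x, y) -> `|x| < M /\ `|y| < M.
Proof.
move=> /compact_bounded[M [_ hM]]; exists (`|M| + 2).
  by rewrite ltr_wpDl.
move=> x y Cxy.
have M1 : M < `|M| + 1 by rewrite (le_lt_trans (ler_norm M))// ltrDl.
have := hM _ M1 _ Cxy; rewrite /= prod_normE ge_max => /andP[hx hy].
by split; [apply: (le_lt_trans hx)|apply: (le_lt_trans hy)]; lra.
Qed.

Lemma continuous2_bounded (C : set (R * R)) g : compact C ->
  (forall x y, continuous2_at g x y) ->
  exists2 B, 0 <= B & forall x y, C (x, y) -> `|g x y| <= B.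
Proof.
move=> cC cg.
have cg' : {within C, continuous (fun q : R * R => g q.1 q.2)}.
  by apply: continuous_subspaceT => -[x y]; exact: cg.
have [M [_ hM]] := compact_bounded (continuous_compact cg' cC).
exists (`|M| + 1); first by rewrite addr_ge0.
move=> x y Cxy.
have M1 : M < `|M| + 1 by rewrite (le_lt_trans (ler_norm M))// ltrDl.
by apply: (hM _ M1); exists (x, y).
Qed.

Lemma continuous2_compact_integrable (C : set (R * R)) g : compact C ->
  (forall x y, continuous2_at g x y) -> (forall x y, ~ C (x, y) -> g x y = 0) ->
  (mu \x mu)%E.-integrable [set: measurableTypeR R * measurableTypeR R]
    (fun p => (g p.1 p.2)%:E).
Proof.
move=> cC cg g0.
have [M M0 hM] := compact2_bounded cC.
have [B B0 hB] := continuous2_bounded cC cg.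
pose D : set (measurableTypeR R * measurableTypeR R) := `[-M, M] `*` `[-M, M].
have mD : measurable D by apply: measurableX.
have -> : (fun p : measurableTypeR R * measurableTypeR R => (g p.1 p.2)%:E) =
    (fun p => (g p.1 p.2)%:E) \_ D.
  apply/funext => -[x y]; rewrite patchE; case: ifPn => // /negP nD.
  rewrite g0// => Cxy; apply: nD; rewrite inE; have [hx hy] := hM _ _ Cxy.
  by split; rewrite /= in_itv/= -ler_norml ltW.
apply/(integrable_mkcond _ mD).
apply: (@integrable_bounded _ _ _ (mu \x mu)%E D
  (fun p : measurableTypeR R * measurableTypeR R => g p.1 p.2) B) => //.
- have DE : (mu \x mu)%E D = (mu `[(- M)%R, M]%classic * mu `[(- M)%R, M]%classic)%E.
    by apply: product_measure1E.
  refine (eq_ind_r (fun z => (z < +oo)%E) _ DE).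
  by apply: lte_mul_pinfty; rewrite ?ge0_fin_numE//; exact: lebesgue_itvcc_lty.
- by apply: measurable_funTS; exact: continuous2_measurable.
- move=> [x y] _ /=; have [Cxy|nC] := pselect (C (x, y)); first exact: hB.
  by rewrite g0// normr0.
Qed.

Lemma integral_derivative0 (F f : R -> R) (M : R) : 0 < M ->
  (forall x, is_derive x 1 F (f x)) -> continuous f ->
  (forall x, M <= `|x| -> F x = 0) -> (forall x, M <= `|x| -> f x = 0) ->
  (\int[mu]_x (f x)%:E)%E = 0%E.
Proof.
move=> M0 dF cf F0 f0.
have MM : - M < M by lra.
transitivity (\int[mu]_(x in `[(- M)%R, M]) (f x)%:E)%E.
  rewrite [RHS]integral_mkcond; apply: eq_integral => x _; rewrite patchE.
  case: ifPn => // /negP h; rewrite f0// leNgt; apply/negP => xM.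
  by apply: h; rewrite inE/= in_itv/= -ler_norml ltW.
have cF : continuous F by move=> x; exact: is_derive_continuous (dF x).
rewrite (continuous_FTC2 MM (F := F)).
- by rewrite !F0 ?subee// ?normrN ger0_norm// ltW.
- by apply: continuous_subspaceT.
- split; [by move=> x _; have [] := dF x| |].
    by apply: cvg_at_right_filter; exact: cF.
  by apply: cvg_at_left_filter; exact: cF.
- by move=> x _; rewrite derive1E; exact: (@derive_val _ _ _ _ _ _ _ (dF x)).
Qed.

(** Two applications of the mean value theorem, in either order, express the
    same second difference by values of the two mixed derivatives near the
    point. *)
Lemma mixed_partials g (gx gy gxy gyx : R -> R -> R) x y :
  (forall u v, is_derive u 1 (g^~ v) (gx u v)) ->
  (forall u v, is_derive v 1 (g u) (gy u v)) ->
  (forall u v, is_derive v 1 (gx u) (gxy u v)) ->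
  (forall u v, is_derive u 1 (gy^~ v) (gyx u v)) ->
  continuous2_at gxy x y -> continuous2_at gyx x y -> gxy x y = gyx x y.
Proof.
move=> dx dy dxy dyx c1 c2; apply/eqP; rewrite -subr_eq0 -normr_le0; apply/ler_addgt0Pl => e e0.
rewrite addr0; have e2 : 0 < e / 2 by rewrite divr_gt0.
have [d1 d10 h1] := (continuous2_epsP _ _ _).1 c1 _ e2.
have [d2 d20 h2] := (continuous2_epsP _ _ _).1 c2 _ e2.
have [h [h0 hd1 hd2]] : exists h, [/\ 0 < h, h < d1 & h < d2].
  exists (Num.min d1 d2 / 2); have m0 : 0 < Num.min d1 d2 by rewrite lt_min d10.
  have [ma mb] : Num.min d1 d2 <= d1 /\ Num.min d1 d2 <= d2 by rewrite !ge_min !lexx orbT.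
  by split; move: m0 ma mb; set m := Num.min _ _; lra.
have hn : `|y + h - y| < h + h by rewrite addrC addKr gtr0_norm//; lra.
have hnx : `|x + h - x| < h + h by rewrite addrC addKr gtr0_norm//; lra.
have hx' : x + h - x = h by ring.
have hy' : y + h - y = h by ring.
pose Delta := g (x + h) (y + h) - g (x + h) y - (g x (y + h) - g x y).
have [a ax [b bx E1]] : exists2 a, `|a - x| <= h & exists2 b, `|b - y| <= h & Delta = gxy a b * h * h.
  have D (z : R) : `|z - x| < h + h ->
      is_derive z 1 (fun z => g z (y + h) - g z y) (gx z (y + h) - gx z y).
    by move=> _; exact: is_deriveB (dx z (y + h)) (dx z y).
  have [a ah Ea] := mean_value D hnx.
  have D' (z : R) : `|z - y| < h + h -> is_derive z 1 (gx a) (gxy a z) by move=> _; exact: dxy.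
  have [b bh Eb] := mean_value D' hn.
  move: ah bh Ea Eb; rewrite hx' hy' (gtr0_norm h0) => ah bh Ea Eb.
  exists a => //; exists b => //; rewrite -Eb -Ea; rewrite /Delta; ring.
have [a' ax' [b' bx' E2]] : exists2 a, `|a - x| <= h & exists2 b, `|b - y| <= h & Delta = gyx a b * h * h.
  have D (z : R) : `|z - y| < h + h ->
      is_derive z 1 (fun z => g (x + h) z - g x z) (gy (x + h) z - gy x z).
    by move=> _; exact: is_deriveB (dy (x + h) z) (dy x z).
  have [b0 bh Eb] := mean_value D hn.
  have D' (z : R) : `|z - x| < h + h -> is_derive z 1 (gy^~ b0) (gyx z b0) by move=> _; exact: dyx.
  have [a0 ah Ea] := mean_value D' hnx.
  move: ah bh Ea Eb; rewrite hx' hy' (gtr0_norm h0) => ah bh Ea Eb.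
  exists a0 => //; exists b0 => //; rewrite -Ea -Eb; rewrite /Delta; ring.
have E : gxy a b = gyx a' b'.
  have hn0 : h != 0 by rewrite gt_eqF.
  by apply: (mulIf hn0); apply: (mulIf hn0); rewrite -E1 -E2.
have k1 := h1 a b (le_lt_trans ax hd1) (le_lt_trans bx hd1).
have k2 := h2 a' b' (le_lt_trans ax' hd2) (le_lt_trans bx' hd2).
rewrite E in k1; move: k1 k2; rewrite !ltr_norml ler_norml => /andP[? ?] /andP[? ?].
by apply/andP; split; lra.
Qed.

Section divergence.
Variable c : R.
Hypothesis c_gt0 : 0 < c.

(** The partial derivatives are parameters, so that the derivatives of sums and
    products are computed by unification. *)
Record cone_C1 (f ft fe : R -> R -> R) : Prop := ConeC1 {
  cone_derive_t : forall eta t, `|eta| < c * t -> is_derive t 1 (f eta) (ft eta t);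
  cone_derive_eta : forall eta t, `|eta| < c * t -> is_derive eta 1 (f^~ t) (fe eta t);
  cone_continuous : forall eta t, `|eta| < c * t -> continuous2_at f eta t;
  cone_continuous_t : forall eta t, `|eta| < c * t -> continuous2_at ft eta t;
  cone_continuous_eta : forall eta t, `|eta| < c * t -> continuous2_at fe eta t }.

Lemma cone_C1_cst a : cone_C1 (fun _ _ => a) (fun _ _ => 0) (fun _ _ => 0).
Proof.
by split=> eta t _; try exact: is_derive_cst; exact: cst_continuous.
Qed.

Lemma cone_C1D f ft fe g gt ge : cone_C1 f ft fe -> cone_C1 g gt ge ->
  cone_C1 (fun x s => f x s + g x s) (fun x s => ft x s + gt x s) (fun x s => fe x s + ge x s).
Proof.
move=> [f1 f2 f3 f4 f5] [g1 g2 g3 g4 g5]; split=> eta t h.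
- exact: is_deriveD (f1 _ _ h) (g1 _ _ h).
- exact: is_deriveD (f2 _ _ h) (g2 _ _ h).
- exact: cvgD (f3 _ _ h) (g3 _ _ h).
- exact: cvgD (f4 _ _ h) (g4 _ _ h).
- exact: cvgD (f5 _ _ h) (g5 _ _ h).
Qed.

Lemma cone_C1M f ft fe g gt ge : cone_C1 f ft fe -> cone_C1 g gt ge ->
  cone_C1 (fun x s => f x s * g x s) (fun x s => ft x s * g x s + f x s * gt x s)
    (fun x s => fe x s * g x s + f x s * ge x s).
Proof.
move=> [f1 f2 f3 f4 f5] [g1 g2 g3 g4 g5]; split=> eta t h.
- have H : is_derive t 1 (fun s => f eta s * g eta s) _ := is_deriveM (f1 _ _ h) (g1 _ _ h).
  by apply: (is_derive_eq H); rewrite /GRing.scale/=; ring.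
- have H : is_derive eta 1 (fun s => f s t * g s t) _ := is_deriveM (f2 _ _ h) (g2 _ _ h).
  by apply: (is_derive_eq H); rewrite /GRing.scale/=; ring.
- exact: cvgM (f3 _ _ h) (g3 _ _ h).
- by apply: cvgD; [exact: cvgM (f4 _ _ h) (g3 _ _ h)|exact: cvgM (f3 _ _ h) (g4 _ _ h)].
- by apply: cvgD; [exact: cvgM (f5 _ _ h) (g3 _ _ h)|exact: cvgM (f3 _ _ h) (g5 _ _ h)].
Qed.

Variable C : set (R * R).
Hypothesis cC : compact C.
Hypothesis Ccone : C `<=` cone c.

Lemma off_support_near x y : ~ C (x, y) -> exists2 d, 0 < d &
  forall x' y', `|x' - x| < d -> `|y' - y| < d -> ~ C (x', y').
Proof.
move=> nC.
have oC : open (~` C).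
  by apply: closed_openC; apply: compact_closed => //; exact: norm_hausdorff.
have /nbhs_ballP[d /= d0 hd] := open_nbhs_nbhs (conj oC nC).
by exists d => // x' y' hx hy; apply: hd; split; rewrite /ball/= distrC.
Qed.

Lemma supported_continuous f : (forall eta t, `|eta| < c * t -> continuous2_at f eta t) ->
  (forall x y, ~ C (x, y) -> f x y = 0) -> forall x y, continuous2_at f x y.
Proof.
move=> cf f0 x y; have [Cxy|nC] := pselect (C (x, y)); first by apply: cf; exact: (Ccone Cxy).
apply/continuous2_epsP => e e0; have [d d0 hd] := off_support_near nC.
by exists d => // x' y' hx hy; rewrite !f0// ?subrr ?normr0//; exact: hd.
Qed.

Lemma supported_derive (f : R -> R -> R) ft : 
  (forall eta t, `|eta| < c * t -> is_derive t 1 (f eta) (ft eta t)) ->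
  (forall x y, ~ C (x, y) -> f x y = 0) -> (forall x y, ~ C (x, y) -> ft x y = 0) ->
  forall eta t, is_derive t 1 (f eta) (ft eta t).
Proof.
move=> df f0 ft0 x y; have [Cxy|nC] := pselect (C (x, y)); first by apply: df; exact: (Ccone Cxy).
rewrite ft0//; have [d d0 hd] := off_support_near nC.
apply: near_eq_is_derive (is_derive_cst 0 y 1).
exists d => //= z; rewrite /ball/= distrC => hz; rewrite f0//; apply: hd => //.
by rewrite subrr normr0.
Qed.

Lemma supported_derive_eta (f : R -> R -> R) fe : 
  (forall eta t, `|eta| < c * t -> is_derive eta 1 (f^~ t) (fe eta t)) ->
  (forall x y, ~ C (x, y) -> f x y = 0) -> (forall x y, ~ C (x, y) -> fe x y = 0) ->
  forall eta t, is_derive eta 1 (f^~ t) (fe eta t).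
Proof.
move=> df f0 ft0 x y; have [Cxy|nC] := pselect (C (x, y)); first by apply: df; exact: (Ccone Cxy).
rewrite ft0//; have [d d0 hd] := off_support_near nC.
apply: near_eq_is_derive (is_derive_cst 0 x 1).
exists d => //= z; rewrite /ball/= distrC => hz; rewrite f0//; apply: hd => //.
by rewrite subrr normr0.
Qed.

(** The functions vanish off C together with their derivatives, hence are
    continuously differentiable on the whole plane. Each term integrates to 0
    in the variable of its derivative, by the fundamental theorem of calculus,
    and the other variable is treated by the theorem of Fubini. *)
Lemma divergence0 A At Ae B Bt Be : cone_C1 A At Ae -> cone_C1 B Bt Be ->
  (forall x y, ~ C (x, y) -> [/\ A x y = 0, At x y = 0, B x y = 0 & Be x y = 0]) ->
  (\int[(mu \x mu)%E]_p (At p.1 p.2 + Be p.1 p.2)%:E)%E = 0%E.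
Proof.
move=> [A1 _ A3 A4 _] [_ B2 B3 _ B5] off.
have a0 x y : ~ C (x, y) -> A x y = 0 by move=> /off[].
have at0 x y : ~ C (x, y) -> At x y = 0 by move=> /off[].
have b0 x y : ~ C (x, y) -> B x y = 0 by move=> /off[].
have be0 x y : ~ C (x, y) -> Be x y = 0 by move=> /off[].
have cAt := supported_continuous A4 at0.
have cBe := supported_continuous B5 be0.
have iAt := continuous2_compact_integrable cC cAt at0.
have iBe := continuous2_compact_integrable cC cBe be0.
have [M M0 hM] := compact2_bounded cC.
have offM1 x y : M <= `|x| -> ~ C (x, y) by move=> Mx /hM[]; rewrite ltNge Mx.
have offM2 x y : M <= `|y| -> ~ C (x, y) by move=> Mx /hM[_]; rewrite ltNge Mx.
have IA : (\int[(mu \x mu)%E]_p (At p.1 p.2)%:E)%E = 0%E.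
  rewrite -(integral12_prod_meas1 iAt); apply: integral0_eq => x _ /=.
  apply: (integral_derivative0 M0 (supported_derive A1 a0 at0 x)).
  - by move=> y; exact: continuous2_section2 (cAt x y).
  - by move=> y My; apply: a0; exact: offM2.
  - by move=> y My; apply: at0; exact: offM2.
have IB : (\int[(mu \x mu)%E]_p (Be p.1 p.2)%:E)%E = 0%E.
  rewrite -(integral21_prod_meas1 iBe); apply: integral0_eq => x _ /=.
  apply: (integral_derivative0 M0 (fun y => supported_derive_eta B2 b0 be0 y x)).
  - by move=> y; exact: continuous2_section1 (cBe y x).
  - by move=> y My; apply: b0; exact: offM1.
  - by move=> y My; apply: be0; exact: offM1.
transitivity (\int[(mu \x mu)%E]_p ((At p.1 p.2)%:E + (Be p.1 p.2)%:E))%E => //.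
by rewrite integralD// IA IB adde0.
Qed.
End divergence.
End plane.

(** * The equation in the sense of distributions *)

Section smooth.
Context {R : realType}.
Variable phi : R -> R -> R.
Hypothesis sphi : smooth2 phi.
Implicit Types (a : seq bool) (x y : R).

Lemma smooth_continuous a x y : continuous2_at (iter_partial a phi) x y.
Proof. exact: differentiable_continuous (sphi a (x, y)). Qed.

Lemma smooth_d_t a x y :
  is_derive y 1 (iter_partial a phi x) (iter_partial (true :: a) phi x y).
Proof.
have d1 : differentiable (fun s : R => (x, s)) y.
  by apply: differentiable_pair; [exact: ex_diff|exact: ex_diff].
have d2 : derivable (iter_partial a phi x) y 1.
  exact/derivable1_diffP/(differentiable_comp d1 (sphi a (x, y))).
by apply: DeriveDef; [exact: d2|rewrite /= /d_t derive1E].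
Qed.

Lemma smooth_d_eta a x y :
  is_derive x 1 ((iter_partial a phi)^~ y) (iter_partial (false :: a) phi x y).
Proof.
have d1 : differentiable (fun s : R => (s, y)) x.
  by apply: differentiable_pair; [exact: ex_diff|exact: ex_diff].
have d2 : derivable ((iter_partial a phi)^~ y) x 1.
  exact/derivable1_diffP/(differentiable_comp d1 (sphi a (x, y))).
by apply: DeriveDef; [exact: d2|rewrite /= /d_eta derive1E].
Qed.

Lemma smooth_mixed x y :
  iter_partial [:: true; false] phi x y = iter_partial [:: false; true] phi x y.
Proof.
apply: (@mixed_partials _ phi (iter_partial [:: false] phi) (iter_partial [:: true] phi)).
- by move=> u v; exact: (smooth_d_eta [::]).
- by move=> u v; exact: (smooth_d_t [::]).
- by move=> u v; exact: (smooth_d_t [:: false]).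
- by move=> u v; exact: (smooth_d_eta [:: true]).
- exact: smooth_continuous.
- exact: smooth_continuous.
Qed.

Lemma smooth_cone_C1 c a : cone_C1 c (iter_partial a phi)
  (iter_partial (true :: a) phi) (iter_partial (false :: a) phi).
Proof.
split=> x y _; [exact: smooth_d_t|exact: smooth_d_eta|exact: smooth_continuous..].
Qed.

Lemma smooth_off_support (C : set (R * R)) : compact C ->
  (forall p, ~ C p -> phi p.1 p.2 = 0) ->
  forall a x y, ~ C (x, y) -> iter_partial a phi x y = 0.
Proof.
move=> cC phi0; elim=> [|b a IH] x y nC; first exact: (phi0 (x, y)).
have [d d0 hd] := off_support_near cC nC.
case: b => /=.
- apply: is_derive_d_t; apply: near_eq_is_derive (is_derive_cst 0 y 1).
  exists d => //= z; rewrite /ball/= distrC => hz; rewrite IH//; apply: hd => //.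
  by rewrite subrr normr0.
- apply: is_derive_d_eta; apply: near_eq_is_derive (is_derive_cst 0 x 1).
  exists d => //= z; rewrite /ball/= distrC => hz; rewrite IH//; apply: hd => //.
  by rewrite subrr normr0.
Qed.
End smooth.

Section explicit_density_weak.
Context {R : realType}.
Local Notation mu := (@lebesgue_measure R).
Variable k : R -> R.
Hypothesis mk : measurable_fun [set: R] k.
Hypothesis k0 : forall s, 0 <= k s.
Hypothesis k1 : C1_pos k.
Hypothesis ki : forall t, mu.-integrable `]0, t] (EFin \o k).
Hypothesis mass : forall t, 0 < t ->
  (\int[mu]_(v in `]0%R, t[) total_density k (t - v)%R v < +oo)%E.
Variable c : R.
Hypothesis c_gt0 : 0 < c.
Implicit Types (s t u v x y eta : R).
Local Notation G := (density k).
Local Notation k' := (k^`()%classic).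
Local Notation fw := (forward k c).
Local Notation bw := (backward k c).

Lemma continuous2_char (g : R -> R -> R) eta t :
  continuous2_at g (char_u c eta t) (char_v c eta t) ->
  continuous2_at (fun x s => g (char_u c x s) (char_v c x s)) eta t.
Proof.
move=> /continuous2_epsP cg; apply/continuous2_epsP => e e0; have [d d0 hd] := cg e e0.
exists (d * (1 + c^-1)^-1).
  by rewrite mulr_gt0// invr_gt0 addr_gt0// invr_gt0.
move=> x s hx hs.
have ci : 0 < c^-1 by rewrite invr_gt0.
have c1 : 0 < 1 + c^-1 by rewrite addr_gt0.
have hx' : `|x - eta| * (1 + c^-1) < d by rewrite -ltr_pdivlMr.
have hs' : `|s - t| * (1 + c^-1) < d by rewrite -ltr_pdivlMr.
have B : (`|s - t| + `|x - eta| * c^-1) < d * 2.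
  have h1 := normr_ge0 (s - t); have h2 := normr_ge0 (x - eta).
  have h3 := mulr_ge0 h1 (ltW ci); have h4 := mulr_ge0 h2 (ltW ci).
  by move: hx' hs'; rewrite !mulrDr !mulr1; lra.
have B1 : `|s - t| + `|(x - eta) / c| < d * 2.
  by rewrite normrM (gtr0_norm ci).
apply: hd.
- rewrite (_ : _ - _ = ((s - t) + (x - eta) / c) / 2); last by rewrite /char_u; field; rewrite gt_eqF.
  rewrite normrM (ger0_norm (_ : 0 <= 2^-1 :> R))// ltr_pdivrMr//.
  exact: le_lt_trans (ler_normD _ _) B1.
- rewrite (_ : _ - _ = ((s - t) - (x - eta) / c) / 2); last by rewrite /char_v; field; rewrite gt_eqF.
  rewrite normrM (ger0_norm (_ : 0 <= 2^-1 :> R))// ltr_pdivrMr//.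
  exact: le_lt_trans (ler_normB _ _) B1.
Qed.

Lemma continuous2_time (f : R -> R) eta t : {for t, continuous f} ->
  continuous2_at (fun _ s => f s) eta t.
Proof.
move=> /continuous_epsP cf; apply/continuous2_epsP => e e0; have [d d0 hd] := cf e e0.
by exists d => // x s _ hs; exact: hd.
Qed.

Lemma time_cone_C1 (f f' : R -> R) : (forall s, 0 < s -> is_derive s 1 f (f' s)) ->
  (forall s, 0 < s -> {for s, continuous f'}) ->
  cone_C1 c (fun _ s => f s) (fun _ s => f' s) (fun _ _ => 0).
Proof.
move=> df cf'; split=> eta t h; have t0 := cone_time_gt0 c_gt0 h.
- exact: df.
- exact: is_derive_cst.
- by apply: continuous2_time; exact: is_derive_continuous (df _ t0).
- by apply: continuous2_time; exact: cf'.
- exact: cst_continuous.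
Qed.

Lemma damping_continuous t : 0 < t -> {for t, continuous (damping k)}.
Proof. by move=> t0; exact: is_derive_continuous (damping_derive k1 ki t0). Qed.

Let cG eta t : `|eta| < c * t ->
  continuous2_at (fun x s => G (char_u c x s) (char_v c x s)) eta t.
Proof.
move=> h; apply: continuous2_char; apply: density_continuous => //.
  exact: char_u_gt0. exact: char_v_gt0.
Qed.
Let cG' eta t : `|eta| < c * t ->
  continuous2_at (fun x s => G (char_v c x s) (char_u c x s)) eta t.
Proof.
move=> h; apply: (@continuous2_char (fun u v => G v u)); apply: continuous2_swap.
by apply: density_continuous => //; [exact: char_v_gt0|exact: char_u_gt0].
Qed.
Let cD eta t : `|eta| < c * t ->
  continuous2_at (fun x s => density2 k (char_u c x s) (char_v c x s)) eta t.
Proof.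
move=> h; apply: (@continuous2_char (density2 k)); apply: density2_continuous => //.
  exact: char_u_gt0. exact: char_v_gt0.
Qed.
Let cD' eta t : `|eta| < c * t ->
  continuous2_at (fun x s => density2 k (char_v c x s) (char_u c x s)) eta t.
Proof.
move=> h; apply: (@continuous2_char (fun u v => density2 k v u)); apply: continuous2_swap.
by apply: density2_continuous => //; [exact: char_v_gt0|exact: char_u_gt0].
Qed.
Let cK eta t : `|eta| < c * t -> continuous2_at (fun _ s => k s) eta t.
Proof.
by move=> h; apply: continuous2_time; apply: rate_continuous => //; exact: cone_time_gt0 h.
Qed.
Let cE eta t : `|eta| < c * t -> continuous2_at (fun _ s => damping k s) eta t.
Proof.
by move=> h; apply: continuous2_time; apply: damping_continuous; exact: cone_time_gt0 h.
Qed.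
Let cc (a : R) eta t : continuous2_at (fun _ _ => a) eta t.
Proof. exact: cst_continuous. Qed.

Lemma continuous2D (g h : R -> R -> R) u v : continuous2_at g u v -> continuous2_at h u v ->
  continuous2_at (fun x y => g x y + h x y) u v.
Proof. exact: cvgD. Qed.

Lemma continuous2M (g h : R -> R -> R) u v : continuous2_at g u v -> continuous2_at h u v ->
  continuous2_at (fun x y => g x y * h x y) u v.
Proof. exact: cvgM. Qed.

Lemma forward_cone_C1 : cone_C1 c fw
  (fun x s => damping k s * (- 3 * k s * G (char_u c x s) (char_v c x s) +
     (k s * G (char_v c x s) (char_u c x s) + density2 k (char_u c x s) (char_v c x s)) * 2^-1))
  (fun x s => damping k s * ((k s * G (char_v c x s) (char_u c x s) - density2 k (char_u c x s) (char_v c x s)) * (2 * c)^-1)).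
Proof.
split=> eta t h; have [d1 d2] := forward_derive mk k0 k1 ki mass c_gt0 h.
- by apply: (is_derive_eq d1); rewrite mulNr.
- exact: d2.
- exact: cvgM (cE h) (cG h).
- have T1 := continuous2M (continuous2M (@cc (- 3) eta t) (cK h)) (cG h).
  have T2 := continuous2M (continuous2D (continuous2M (cK h) (cG' h)) (cD h)) (@cc 2^-1 eta t).
  exact: continuous2M (cE h) (continuous2D T1 T2).
- exact: cvgM (cE h) (cvgM (cvgB (cvgM (cK h) (cG' h)) (cD h)) (@cc _ _ _)).
Qed.

Lemma backward_cone_C1 : cone_C1 c bw
  (fun x s => damping k s * (- 3 * k s * G (char_v c x s) (char_u c x s) +
     (k s * G (char_u c x s) (char_v c x s) + density2 k (char_v c x s) (char_u c x s)) * 2^-1))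
  (fun x s => damping k s * ((density2 k (char_v c x s) (char_u c x s) - k s * G (char_u c x s) (char_v c x s)) * (2 * c)^-1)).
Proof.
split=> eta t h; have [d1 d2] := backward_derive mk k0 k1 ki mass c_gt0 h.
- by apply: (is_derive_eq d1); rewrite mulNr.
- exact: d2.
- exact: cvgM (cE h) (cG' h).
- have T1 := continuous2M (continuous2M (@cc (- 3) eta t) (cK h)) (cG' h).
  have T2 := continuous2M (continuous2D (continuous2M (cK h) (cG h)) (cD' h)) (@cc 2^-1 eta t).
  exact: continuous2M (cE h) (continuous2D T1 T2).
- exact: cvgM (cE h) (cvgM (cvgB (cD' h) (cvgM (cK h) (cG h))) (@cc _ _ _)).
Qed.

Lemma rate_cone_C1 : cone_C1 c (fun _ s => k s) (fun _ s => k' s) (fun _ _ => 0).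
Proof. by apply: time_cone_C1 => s s0; [exact: rate_is_derive|exact: rate'_continuous]. Qed.

Lemma edge_continuous p : cone c p ->
  {for p, continuous (fun q : R * R => edge k c q.1 q.2)}.
Proof.
case: p => eta t h; rewrite /cone/= in h.
apply: (@cvgM _ _ _ _ (fun q : R * R => fw q.1 q.2 + bw q.1 q.2) (fun=> (8 * c)^-1)); last exact: cvg_cst.
exact: cvgD (cone_continuous forward_cone_C1 h) (cone_continuous backward_cone_C1 h).
Qed.

(** Let f+ = forward and f- = backward, nu = 4 k, L+ = d_t + c d_eta and L- =
    d_t - c d_eta. By the first-order system for f+ and f-, the product of f+ +
    f- and of the transposed operator applied to phi is the divergence d_t A +
    d_eta B of the field A = f+ (L- phi - nu phi) + f- (L+ phi - nu phi), B = c
    f+ (L- phi - nu phi) - c f- (L+ phi - nu phi). The field involves no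
    derivative of f+ and f-, so one derivative of the density is enough. *)
Lemma edge_pde_distributional (l : R -> R) :
  (forall t, 0 < t -> is_derive t 1 l (l^`()%classic t)) ->
  (forall t, 0 < t -> l t = 3 * k t) -> (forall t, 0 < t -> l^`()%classic t = 3 * k' t) ->
  pde_distributional c l (edge k c).
Proof.
move=> l1 lk lk'; split; first exact: edge_continuous.
move=> phi [sphi [C [cC Ccone phi0]]].
have off := smooth_off_support cC phi0.
have P0 := smooth_cone_C1 sphi c [::].
have P1 := smooth_cone_C1 sphi c [:: true].
have P2 := smooth_cone_C1 sphi c [:: false].
have cst := @cone_C1_cst R c.
(* The fields A and B, divided by the constant 8 * c of [edge]. *)
have N := cone_C1M (cst (- 4)) (cone_C1M rate_cone_C1 P0).
have Lm := cone_C1D (cone_C1D P1 (cone_C1M (cst (- c)) P2)) N.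
have Lp := cone_C1D (cone_C1D P1 (cone_C1M (cst c) P2)) N.
have F1 := cone_C1M forward_cone_C1 Lm.
have F2 := cone_C1M backward_cone_C1 Lp.
have A := cone_C1M (cst (8 * c)^-1) (cone_C1D F1 F2).
have B := cone_C1M (cst (8 * c)^-1 ) (cone_C1M (cst c) (cone_C1D F1 (cone_C1M (cst (- 1)) F2))).
have [off0 off1] : (forall x y, ~ C (x, y) -> phi x y = 0) /\
    (forall a x y, ~ C (x, y) -> iter_partial a phi x y = 0).
  by split; [exact: (off [::])|exact: off].
have D := divergence0 cC Ccone A B.
have {}D := D _; rewrite /Rintegral integral_mkcond.
pose J (p : R * R) : R := edge k c p.1 p.2 *
  (d_t (d_t phi) p.1 p.2 - 2 * d_t (fun eta t => l t * phi eta t) p.1 p.2 +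
   2 / 3 * (4 / 3 * l p.2 ^+ 2 + l^`()%classic p.2) * phi p.1 p.2 -
   c ^+ 2 * d_eta (d_eta phi) p.1 p.2).
suff : (\int[(mu \x mu)%E]_p ((EFin \o J) \_ (cone c)) p)%E = 0%E.
  by rewrite /J => ->.
rewrite -[RHS](D _); last first.
  move=> x y nC; rewrite (off [:: true; true] _ _ nC) (off [:: true; false] _ _ nC)
    (off [:: true] _ _ nC) (off [:: false; true] _ _ nC) (off [:: false; false] _ _ nC)
    (off [:: false] _ _ nC) (off [::] _ _ nC).
  by split; rewrite !(mulr0, mul0r, addr0, add0r).
apply: eq_integral => -[x y] _; rewrite patchE /=.
case: ifPn => [|/negP nc]; last first.
  have nC : ~ C (x, y) by move=> /Ccone h; apply: nc; rewrite inE.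
  have -> : d_t (d_t phi) x y = 0 := off [:: true; true] _ _ nC.
  have -> : d_t (d_eta phi) x y = 0 := off [:: true; false] _ _ nC.
  have -> : d_eta (d_t phi) x y = 0 := off [:: false; true] _ _ nC.
  have -> : d_eta (d_eta phi) x y = 0 := off [:: false; false] _ _ nC.
  have -> : d_t phi x y = 0 := off [:: true] _ _ nC.
  have -> : d_eta phi x y = 0 := off [:: false] _ _ nC.
  have -> : phi x y = 0 := off [::] _ _ nC.
  by rewrite !(mulr0, mul0r, addr0, add0r).
rewrite inE => /= h; have y0 := cone_time_gt0 c_gt0 h; congr (_%:E); rewrite /J /=.
have -> : d_t (fun eta t => l t * phi eta t) x y = 3 * k' y * phi x y + 3 * k y * d_t phi x y.
  apply: is_derive_d_t.
  have H : is_derive y 1 (fun s => l s * phi x s) _ := is_deriveM (l1 _ y0) (smooth_d_t sphi [::] x y).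
  by apply: (is_derive_eq H); rewrite /GRing.scale/= lk// lk'//; ring.
have -> : d_t (d_eta phi) x y = d_eta (d_t phi) x y := smooth_mixed sphi x y.
rewrite lk// lk'// /edge /forward /backward.
have cn : c != 0 by rewrite gt_eqF.
move: (d_t (d_t phi) x y) (d_eta (d_eta phi) x y) (d_eta (d_t phi) x y) (d_t phi x y) (d_eta phi x y) (phi x y).
move: (G _ _) (G _ _) (density2 _ _ _) (density2 _ _ _) (damping k y) (k y) (k' y).
move=> x1 x2 x3 x4 x5 x6 x7 y1 y2 y3 y4 y5 y6.
by field.
Qed.
End explicit_density_weak.

(** * Weighted laws of the switches *)

Section half_line.
Context {R : realType}.
Local Notation mu := (@lebesgue_measure R).
Implicit Types (f g l : R -> R) (a s t : R).

Lemma C1_pos_scale a f g : (forall t, 0 < t -> g t = a * f t) -> C1_pos f ->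
  C1_pos g /\ forall t, 0 < t -> g^`()%classic t = a * f^`()%classic t.
Proof.
move=> gf f1.
have dg t : 0 < t -> is_derive t 1 g (a * f^`()%classic t).
  move=> t0; have H : is_derive t 1 (fun s => a * f s) _ := is_deriveZ a (C1_pos_is_derive f1 t0).
  by apply: near_pos_is_derive H => // y y0; rewrite gf.
have g' t : 0 < t -> g^`()%classic t = a * f^`()%classic t.
  by move=> /dg H; rewrite derive1E; exact: (@derive_val _ _ _ _ _ _ _ H).
split=> // t t0; split; first by have [] := dg t t0.
have c : {for t, continuous (fun s => a * f^`()%classic s)}.
  by apply: cvgM; [exact: cvg_cst|have [] := f1 t t0].
apply/continuous_epsP => e e0; have [d d0 hd] := (continuous_epsP _ _).1 c e e0.
exists (Num.min d t); first by rewrite lt_min d0.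
move=> y; rewrite lt_min => /andP[yd yt].
have y0 : 0 < y by move: yt; rewrite ltr_norml => /andP[]; lra.
by rewrite !g'//; exact: hd.
Qed.

Lemma pos_continuous_measurable f : (forall s, 0 < s -> {for s, continuous f}) ->
  (forall s, s <= 0 -> f s = 0) -> measurable_fun [set: R] f.
Proof.
move=> cf f0.
have -> : f = f \_ `]0, +oo[.
  apply/funext => s; rewrite patchE; case: ifPn => // /negP h; apply: f0.
  by rewrite leNgt; apply/negP => s0; apply: h; rewrite inE/= in_itv/= s0.
have mf : measurable_fun (`]0%R, +oo[%classic : set R) f.
  apply: open_continuous_measurable_fun; first exact: interval_open.
  by move=> s; rewrite inE/= in_itv/= andbT; exact: cf.
have mD : measurable (`]0%R, +oo[%classic : set R) by exact: measurable_itv.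
exact: (measurable_restrictT f mD).1 mf.
Qed.

Lemma poisson_process_rate d (Omega : measurableType d) (P : probability Omega R) m m'
    (N : R -> Omega -> nat) : (forall s, 0 < s -> m s = m' s) ->
  poisson_process P m N -> poisson_process P m' N.
Proof.
move=> mm' [h1 h2 h3 h4 h5]; split=> //.
move=> s t k s0 st; rewrite h4//.
suff -> : \int[mu]_(u in `]s, t]) m u = \int[mu]_(u in `]s, t]) m' u by [].
apply: eq_Rintegral => u; rewrite inE/= in_itv/= => /andP[su _].
by apply: mm'; exact: le_lt_trans su.
Qed.
End half_line.

Section two_sided.
Context d (Omega : measurableType d) (R : realType) (P : probability Omega R).
Local Notation mu := (@lebesgue_measure R).
Variables (k : R -> R) (z : R).
Hypothesis mk : measurable_fun [set: R] k.
Hypothesis k0 : forall s, 0 <= k s.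
Hypothesis ki : forall t, mu.-integrable `]0, t] (EFin \o k).
Hypothesis z_gt0 : 0 < z.
Variable N : R -> Omega -> nat.
Hypothesis NP : poisson_process P (fun s => z * k s) N.
Implicit Types (s t u v x y : R).
Local Notation K := (cumulative_rate k).

Let mzk : measurable_fun [set: R] (fun s => z * k s).
Proof. exact: measurable_funM. Qed.
Let zk0 s : 0 <= z * k s. Proof. by rewrite mulr_ge0// ltW. Qed.
Let zki t : mu.-integrable `]0, t] (EFin \o (fun s => z * k s)).
Proof. exact: integrable_EFinZ. Qed.

Lemma cumulative_rateZ t : cumulative_rate (fun s => z * k s) t = z * K t.
Proof. by rewrite /cumulative_rate RintegralZl. Qed.

Let mS t : measurable_fun [set: R] (fun v => total_density k (t - v) v).
Proof. by apply: measurable_total_density => //; exact: measurable_funB. Qed.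

Let mo t : measurable_fun [set: R] (fun v : R => (oo_ind 0 t v)%:E).
Proof. by apply/measurable_EFinP; apply: measurable_oo_ind. Qed.

(** The weight 1 / z per switch turns the rate z * k of the clock into the rate
    k in the densities; z * k survives in the probability of no switch. *)
Lemma weighted_switch_law t (B : set R) : 0 < t -> measurable B ->
  (\sum_(n <oo) (z^-1 ^+ n.+1)%:E *
     P ([set w | N t w = n.+1] `&` other_time N t @^-1` B) =
   \int[mu]_(y in B) ((expR (- (z * K t)))%:E * ((oo_ind 0 t y)%:E * total_density k (t - y)%R y)))%E.
Proof.
move=> t0 mB.
pose f n y := ((expR (- (z * K t)))%:E * ((oo_ind 0 t y)%:E * switch_density k n (t - y)%R y))%E.
have f0 n y : (0 <= f n y)%E.
  by rewrite mule_ge0 ?lee_fin ?expR_ge0// mule_ge0 ?lee_fin// switch_density_ge0.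
have mf n : measurable_fun B (f n).
  apply: measurable_funTS; apply: emeasurable_funM => //; apply: emeasurable_funM => //.
  by apply: measurable_switch_density => //; exact: measurable_funB.
have E n : ((z^-1 ^+ n.+1)%:E * P ([set w | N t w = n.+1] `&` other_time N t @^-1` B) =
    \int[mu]_(y in B) f n y)%E.
  rewrite (switch_law mzk zk0 zki NP n t0 mB) cumulative_rateZ -ge0_integralZl//.
  - apply: eq_integral => y _; rewrite (switch_density_scale _ _ _ mk k0 (ltW z_gt0)) /f.
    rewrite muleCA; congr (_ * _)%E; rewrite muleCA; congr (_ * _)%E.
    by rewrite muleA -EFinM -exprMn mulVf ?gt_eqF// expr1n mul1e.
  - apply: measurable_funTS; apply: emeasurable_funM => //; apply: emeasurable_funM; first exact: mo.
    by apply: measurable_switch_density => //; exact: measurable_funB.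
  - move=> y _; rewrite mule_ge0 ?lee_fin ?expR_ge0// mule_ge0 ?lee_fin//.
    by apply: switch_density_ge0.
  - by rewrite lee_fin exprn_ge0// invr_ge0 ltW.
under eq_eseriesr do rewrite E.
transitivity (\int[mu]_(y in B) (\sum_(n <oo) f n y))%E.
  by symmetry; apply: integral_nneseries.
apply: eq_integral => y _.
rewrite /f nneseriesZl; last by move=> n _; rewrite mule_ge0 ?lee_fin// switch_density_ge0.
congr (_ * _)%E; rewrite nneseriesZl//; last by move=> n _; exact: switch_density_ge0.
Qed.

(** The weights turn the Poisson probabilities into the terms of the
    exponential series at K t, without the first one. *)
Lemma poisson_mass t : 0 < t ->
  (\sum_(n <oo) (z^-1 ^+ n.+1)%:E * P [set w | N t w = n.+1] =
   (expR (- (z * K t)) * (expR (K t) - 1))%:E)%E.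
Proof.
move=> t0.
have E n : ((z^-1 ^+ n.+1)%:E * P [set w | N t w = n.+1] =
    (expR (- (z * K t)))%:E * (exp_coeff (K t) n.+1)%:E)%E.
  have := poisson_incr zki NP n.+1 (lexx 0) (ltW t0).
  rewrite cumulative_rate0 subr0 cumulative_rateZ.
  have -> : [set w | (N t w - N 0 w)%N = n.+1] = [set w | N t w = n.+1].
    by apply/seteqP; split=> w /=; rewrite (poisson0 NP) subn0.
  move=> ->; rewrite -!EFinM; congr EFin; rewrite /exp_coeff exprMn exprVn.
  have zn : z ^+ n.+1 != 0 by rewrite expf_neq0// gt_eqF.
  by rewrite /= [RHS]mulrC !mulrA mulVf// mul1r.
under eq_eseriesr do rewrite E.
have c0 n : (0 <= (exp_coeff (K t) n)%:E)%E.
  by rewrite lee_fin exp_coeff_ge0// cumulative_rate_ge0.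
rewrite nneseriesZl//= EFinM; congr (_ * _)%E.
have S : (\sum_(n <oo) (exp_coeff (K t) n)%:E = (expR (K t))%:E)%E.
  rewrite expRE -EFin_lim; last first.
    rewrite /pseries/=; under eq_fun do rewrite mulrC.
    exact: is_cvg_series_exp_coeff.
  apply/congr_lim/funext => n/=; rewrite /pseries/= /series/= -sumEFin//.
  by apply: eq_bigr => i _; rewrite /exp_coeff/= mulrC.
move: S; rewrite nneseries_recl// => S.
have e0 : exp_coeff (K t) 0%N = 1 by rewrite /exp_coeff/= expr0 fact0 divr1.
rewrite EFinB -S e0 addeAC subee// add0e.
rewrite -[in RHS]nneseries_addn; last by move=> n.
by apply: eq_eseriesr => n _; rewrite addn1.
Qed.

Lemma total_mass t : 0 < t ->
  (\int[mu]_(v in `]0%R, t[) total_density k (t - v)%R v = (expR (K t) - 1)%:E)%E.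
Proof.
move=> t0; have := weighted_switch_law t0 measurableT.
under eq_eseriesr do rewrite preimage_setT setIT.
rewrite poisson_mass// integral_oo_ind ge0_integralZl//.
- rewrite EFinM => /(congr1 (fun x : \bar R => ((expR (z * K t))%:E * x)%E)).
  by rewrite !muleA -!EFinM -expRD subrr expR0 mul1e mul1r => ->.
- by apply: emeasurable_funM; [exact: mo|exact: mS].
- by move=> y _; rewrite mule_ge0 ?lee_fin// total_density_ge0.
Qed.

Lemma total_mass_lty t : 0 < t ->
  (\int[mu]_(v in `]0%R, t[) total_density k (t - v)%R v < +oo)%E.
Proof. by move=> t0; rewrite total_mass// ltry. Qed.

Hypothesis kc : forall s, 0 < s -> {for s, continuous k}.
Local Notation G := (density k).

(** The substitution is x = a * (t - 2 * y), where y is the time in the other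
    state and a the current velocity. *)
Lemma signed_switch_law t (a : R) (A : set R) : 0 < t -> a != 0 -> measurable A ->
  (\sum_(n <oo) (z^-1 ^+ n.+1)%:E *
     P ([set w | N t w = n.+1] `&` [set w | A (a * (t - 2 * other_time N t w))%R]) =
   \int[mu]_(x in A `&` `](- (`|a| * t))%R, (`|a| * t)%R[)
     (expR (- (z * K t)) / (2 * `|a|) * G ((t + x / a) / 2) ((t - x / a) / 2))%:E)%E.
Proof.
move=> t0 a0 mA.
have na0 : 0 < `|a| by rewrite normr_gt0.
pose B : set R := [set y | A (a * (t - 2 * y))].
have mphi : measurable_fun [set: R] (fun y : R => a * (t - 2 * y)).
  by apply: measurable_funM => //; apply: measurable_funB => //; exact: measurable_funM.
have mB : measurable B by rewrite -[B]setTI; exact: mphi.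
have := weighted_switch_law t0 mB.
rewrite /preimage /B /= => ->.
pose g y := ((expR (- (z * K t)))%:E * ((oo_ind 0 t y)%:E * total_density k (t - y)%R y))%E.
have g0 y : (0 <= g y)%E.
  by rewrite mule_ge0 ?lee_fin ?expR_ge0// mule_ge0 ?lee_fin// total_density_ge0.
have mg : measurable_fun [set: R] g by apply: emeasurable_funM => //; exact: emeasurable_funM.
pose f x := ((\1_A x)%:E * g ((t - x / a) / 2)%R)%E.
have f0 x : (0 <= f x)%E by rewrite mule_ge0// lee_fin.
have mf : measurable_fun [set: R] f.
  apply: emeasurable_funM; first by apply/measurable_EFinP; exact: measurable_indic.
  apply: (measurableT_comp mg); apply: measurable_funM => //; apply: measurable_funB => //.
  exact: measurable_funM.
have a2 : - (2 * a) != 0 by rewrite oppr_eq0 mulf_neq0.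
have := ge0_integral_affine (a * t) a2 mf f0.
have -> : (\int[mu]_x f (- (2 * a) * x + a * t)%R = \int[mu]_(y in B) g y)%E.
  rewrite [RHS]integral_mkcond epatch_indic; apply: eq_integral => y _ /=.
  rewrite /f muleC; congr (g _ * _)%E; first by field.
  rewrite !indicE; suff -> : (- (2 * a) * y + a * t \in A) = (y \in B) by [].
  rewrite (_ : - (2 * a) * y + a * t = a * (t - 2 * y)); last by ring.
  by apply/idP/idP; rewrite !inE.
rewrite normrN normrM (ger0_norm (_ : (0 : R) <= 2))// => E.
have -> : (\int[mu]_(y in B) g y = (2 * `|a|)^-1%:E * \int[mu]_x f x)%E.
  by rewrite E muleA -EFinM mulVf ?mul1e// gt_eqF// mulr_gt0.
rewrite -ge0_integralZl//.
rewrite [RHS]integral_mkcond epatch_indic; apply: eq_integral => x _ /=.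
rewrite /f indicI /= EFinM -[\1_(`]_, _[) x]oo_indE.
have -> : oo_ind (- (`|a| * t)) (`|a| * t) x = oo_ind 0 t ((t - x / a) / 2).
  rewrite /oo_ind; congr (_%:R).
  have -> : (- (`|a| * t) < x) && (x < `|a| * t) = (`|x / a| < t).
    by rewrite -ltr_norml normrM normfV ltr_pdivrMr// mulrC.
  have H (q : R) : (`|q| < t) = (0 < (t - q) / 2 < t).
    by rewrite ltr_norml; apply/andP/andP => -[h1 h2]; split; lra.
  by rewrite H.
rewrite /g /oo_ind; case: (boolP (_ && _)) => [/andP[h1 h2]|_]; last first.
  by rewrite /= mulr0 !(mule0, mul0e).
have e1 : t - (t - x / a) / 2 = (t + x / a) / 2 by field.
rewrite e1 -(densityK mk k0 kc total_mass_lty)//; last by lra.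
rewrite /= mulr1 !mul1e -!EFinM; congr EFin; field.
by rewrite gt_eqF.
Qed.

Lemma two_sided_law t v (A : set R) : 0 < t -> 0 < v -> measurable A ->
  (\sum_(n <oo) (z^-1 ^+ n.+1)%:E *
    (P ([set w | N t w = n.+1] `&` [set w | A (v * (t - 2 * other_time N t w))%R]) +
     P ([set w | N t w = n.+1] `&` [set w | A (- v * (t - 2 * other_time N t w))%R])) =
   \int[mu]_(x in A `&` `](- (v * t))%R, (v * t)%R[)
     (expR (- (z * K t)) / (2 * v) *
      (G ((t + x / v) / 2) ((t - x / v) / 2) + G ((t - x / v) / 2) ((t + x / v) / 2)))%:E)%E.
Proof.
move=> t0 v0 mA.
have vn : v != 0 by rewrite gt_eqF.
have vn' : - v != 0 by rewrite oppr_eq0.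
have zn n : (0 <= (z^-1 ^+ n.+1)%:E :> \bar R)%E by rewrite lee_fin exprn_ge0// invr_ge0 ltW.
under eq_eseriesr do rewrite ge0_muleDr//.
rewrite nneseriesD; [|by move=> n _ _; rewrite mule_ge0..].
rewrite !signed_switch_law// normrN (gtr0_norm v0) -ge0_integralD//.
- by apply: eq_integral => x _; rewrite -EFinD invrN mulrN opprK -mulrDr.
- by apply: measurableI.
- by move=> x _; rewrite lee_fin mulr_ge0 ?density_ge0// divr_ge0 ?expR_ge0// mulr_ge0// ltW.
- apply/measurable_EFinP; apply: measurable_funM => //; apply: (measurable_density mk k0).
  + by apply: measurable_funM => //; apply: measurable_funD => //; exact: measurable_funM.
  + by apply: measurable_funM => //; apply: measurable_funB => //; exact: measurable_funM.
- by move=> x _; rewrite lee_fin mulr_ge0 ?density_ge0// divr_ge0 ?expR_ge0// mulr_ge0// ltW.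
- apply/measurable_EFinP; apply: measurable_funM => //; apply: (measurable_density mk k0).
  + by apply: measurable_funM => //; apply: measurable_funD => //; exact: measurable_funM.
  + by apply: measurable_funM => //; apply: measurable_funB => //; exact: measurable_funM.
Qed.
End two_sided.

(** * Null events and occupation times *)

Section null_events.
Context d (Omega : measurableType d) (R : realType) (P : probability Omega R).

Lemma negligible_countable (T : countType) (E : set Omega) (F : T -> set Omega) :
  (forall x, P.-negligible (F x)) -> (forall w, E w -> exists x, F x w) -> P.-negligible E.
Proof.
move=> F0 EF.
apply: (@negligibleS _ _ _ _ (\bigcup_i (if unpickle i is Some x then F x else set0))).
  move=> w /EF[x Fxw]; exists (pickle x) => //; by rewrite pickleK.
apply: negligible_bigcup => i; case: (unpickle i) => [x|]; first exact: F0.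
exact: negligible_set0.
Qed.

Lemma probability_off_negligible (A B E : set Omega) : measurable A -> measurable B ->
  P.-negligible E -> (forall w, ~ E w -> (A w <-> B w)) -> P A = P B.
Proof.
move=> mA mB [E0 [mE0 PE0 EE0]] AB.
have key (C D : set Omega) : measurable C -> measurable D ->
    (forall w, ~ E w -> C w -> D w) -> (P C <= P D)%E.
  move=> mC mD CD; apply: (@le_trans _ _ (P (D `|` E0))).
    apply: le_measure; rewrite ?inE//; first exact: measurableU.
    move=> w Cw; have [Ew|nEw] := pselect (E w); first by right; exact: EE0.
    by left; exact: CD.
  have e0 : (P D + P E0 = P D)%E by rewrite PE0 adde0.
  by rewrite -[leRHS]e0; exact: measureU2.
by apply/eqP; rewrite eq_le !key// => w /AB[].
Qed.
End null_events.

Section poisson_paths.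
Context d (Omega : measurableType d) (R : realType) (P : probability Omega R).
Local Notation mu := (@lebesgue_measure R).
Variable m : R -> R.
Hypothesis m0 : forall s, 0 <= m s.
Hypothesis mi : forall t, mu.-integrable `]0, t] (EFin \o m).
Variable N : R -> Omega -> nat.
Hypothesis NP : poisson_process P m N.
Local Notation M := (cumulative_rate m).
Implicit Types (s t : R) (w : Omega) (i : nat).

(** A path that skips a value, or takes its last value at t only, has on every
    grid a cell with two jumps or a jump in the last cell. The values are to be
    taken before t because the state entered at t itself leaves no trace in the
    position. *)
Lemma skipped_value_negligible t : 0 < t ->
  P.-negligible [set w | ~ forall i, (i <= N t w)%N -> exists s, [/\ 0 <= s, s < t & N s w = i]].
Proof.
move=> t0.
have g0 k i : 0 <= grid t k i by rewrite -(grid0 t k); apply: grid_le => //; exact: ltW.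
pose D k i := [set w | (2 <= N (grid t k i.+1) w - N (grid t k i) w)%N].
pose J k := [set w | N t w <> N (grid t k k) w].
pose B k := (\big[setU/set0]_(i < k.+1) D k i) `|` J k.
have mD k i : measurable (D k i).
  exact: (poisson_set2_measurable NP (fun a b => is_true (2 <= b - a)%N) (g0 k i) (g0 k i.+1)).
have mJ k : measurable (J k).
  exact: (poisson_set2_measurable NP (fun a b => b <> a) (g0 k k) (ltW t0)).
have mU k : measurable (\big[setU/set0]_(i < k.+1) D k i) by exact: bigsetU_measurable.
have mB k : measurable (B k) by exact: measurableU.
have tk k : grid t k k < t by rewrite -[ltRHS](gridS t k); exact: grid_lt.
have mono k i : M (grid t k i) <= M (grid t k i.+1).
  by apply: cumulative_rate_le => //; exact: grid_le (ltW t0) (leqnSn i).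
have PB e : 0 < e -> exists k, (P (B k) <= (e * (M t + 1))%:E)%E.
  move=> e0; have [k _ /(_ k (leqnn k)) hk] := cumulative_rate_mesh m0 mi t0 e0.
  exists k; apply: (le_trans (measureU2 P (mU k) (mJ k))).
  rewrite mulrDr mulr1 EFinD; apply: leeD.
    apply: (le_trans (Boole_inequality P (fun i (_ : (i < k.+1)%N) => mD k i))).
    apply: (@le_trans _ _ (\sum_(i < k.+1) (e * (M (grid t k i.+1) - M (grid t k i)))%:E)%E).
      apply: lee_sum => i _; have gi : grid t k i <= grid t k i.+1 by exact: grid_le (ltW t0) (leqnSn i).
      apply: (le_trans (poisson_jump2 m0 mi NP (g0 k i) gi)).
      by rewrite lee_fin expr2; apply: ler_wpM2r; [rewrite subr_ge0|exact: hk].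
    by rewrite sumEFin -mulr_sumr -telescope_grid cumulative_rate0 subr0.
  apply: (le_trans (poisson_jump mi NP (g0 k k) (ltW (tk k)))).
  by rewrite lee_fin; have := hk k (ltnSn k); rewrite gridS.
exists (\bigcap_k B k); split.
- exact: bigcapT_measurable.
- apply/eqP; rewrite eq_le measure_ge0 andbT; apply/lee_addgt0Pr => e e0; rewrite add0e.
  have M1 : 0 < M t + 1 by rewrite ltr_wpDl// cumulative_rate_ge0.
  have [k hk] := PB _ (divr_gt0 e0 M1).
  apply: (@le_trans _ _ (P (B k))).
    apply: le_measure; rewrite ?inE//; first exact: bigcapT_measurable.
    by move=> w; apply.
  by move: hk; rewrite divfK// gt_eqF.
- move=> w /= nw; apply: contrapT => /existsNP[k nk]; apply: nw.
  have incr i : (i < k.+1)%N -> (N (grid t k i.+1) w <= (N (grid t k i) w).+1)%N.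
    move=> ik; rewrite leqNgt; apply/negP => h; apply: nk; left.
    rewrite -bigcup_mkord; exists i => //; rewrite /D /=.
    by move: h; lia.
  have Nt : N t w = N (grid t k k) w by apply: contrapT => h; apply: nk; right.
  have H j : (j <= k)%N -> forall i, (i <= N (grid t k j) w)%N ->
      exists s, [/\ 0 <= s, s < t & N s w = i].
    elim: j => [|j IH] jk i.
      by rewrite grid0 (poisson0 NP) leqn0 => /eqP->; exists 0; rewrite (poisson0 NP).
    have [h _|h] := leqP i (N (grid t k j) w); first exact: IH (ltnW jk) _ h.
    move=> hi; exists (grid t k j.+1); split => //.
      by apply: (le_lt_trans _ (tk k)); exact: grid_le (ltW t0) jk.
    apply/eqP; rewrite eqn_leq hi andbT (leq_trans (incr j (ltnW jk)))//.
  by move=> i; rewrite Nt; exact: H.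
Qed.

(** A state occupied at a time s < t is occupied on an interval to the right of
    s. *)
Lemma path_integral_eq0 (g : nat -> bool) t w : 0 < t ->
  \int[mu]_(s in `[0, t]) (g (N s w))%:R = 0 :> R <->
  forall s, 0 <= s -> s < t -> ~~ g (N s w).
Proof.
move=> t0; split=> [I0 s s0 st|h].
- apply/negP => gs.
  have [e e0 he] : exists2 e : R, 0 < e & forall u, s < u -> u < s + e -> N u w = N s w.
    case: NP => _ _ /(_ w s s0)[e /= e0 he] _ _; exists e => // u su ue; apply: he => //=.
    by rewrite ltr_norml; apply/andP; split; lra.
  have [r [sr rt re]] : exists r, [/\ s < r, r <= t & r < s + e].
    exists (Num.min t (s + e / 2)); rewrite lt_min st ge_min lexx gt_min; split => //; last first.
      by rewrite orbC; apply/orP; left; lra.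
    by lra.
  have r0 : 0 <= r by exact: le_trans (ltW sr).
  have h1 : \int[mu]_(u in `[s, r]) (g (N u w))%:R = r - s :> R.
    rewrite -[RHS]mul1r -Rintegral_itv_cst ?ltW//; apply: eq_Rintegral => u.
    rewrite inE/= in_itv/= => /andP[su ur].
    move: su; rewrite le_eqVlt => /predU1P[<-|su]; first by rewrite gs.
    by rewrite he ?gs// (le_lt_trans ur).
  have h2 := integral_path_itv NP g w (lexx 0) s0.
  have h3 := integral_path_itv NP g w r0 rt.
  move: I0; rewrite (integral_path_cat NP g w r0 rt) (integral_path_cat NP g w s0 (ltW sr)) h1.
  by move: h2 h3 => /andP[h2 _] /andP[h3 _]; lra.
- have it := integrable_path NP g t w (lexx 0).
  rewrite -Rintegral_itv_bndo_bndc; last first.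
    apply: (integrableS _ _ _ it) => //.
    by move=> x; rewrite /= !in_itv/= => /andP[-> /ltW].
  transitivity (\int[mu]_(s in `[0, t[) (0 : R)).
    by apply: eq_Rintegral => s; rewrite inE/= in_itv/= => /andP[s0 st]; rewrite (negbTE (h s s0 st)).
  by rewrite Rintegral_cst// mul0r.
Qed.

Lemma path_integral_linear (f : nat -> R) (g : nat -> bool) (a b t : R) w : 0 <= t ->
  (forall i, (i <= N t w)%N -> f i = a + b * (g i)%:R) ->
  \int[mu]_(s in `[0, t]) f (N s w) = a * t + b * \int[mu]_(s in `[0, t]) (g (N s w))%:R.
Proof.
move=> t0 fg; have ig := integrable_path NP g t w (lexx 0).
transitivity (\int[mu]_(s in `[0, t]) (a + b * (g (N s w))%:R)).
  apply: eq_Rintegral => s; rewrite inE/= in_itv/= => /andP[s0 st]; apply: fg.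
  exact: (poisson_le NP).
rewrite RintegralD//; last by apply: integrable_EFinZ.
  by rewrite RintegralZl// Rintegral_itv_cst// subr0.
exact: integrable_cst_itv.
Qed.
End poisson_paths.

(** * The law of the reflecting motion on the edge *)

Section generated.
Context (Omega I T : Type).
Implicit Types (D : set I) (Z : I -> Omega -> T).

Lemma generated_fibre D Z i x : D i -> generated_sigma D Z [set w | Z i w = x].
Proof. by move=> Di; apply: sub_sigma_algebra; exists i, x. Qed.
End generated.

Section motion_law.
Context d (Omega : measurableType d) (R : realType) (P : probability Omega R).
Local Notation mu := (@lebesgue_measure R).
Implicit Types (s t eta : R) (w : Omega) (n i : nat) (e : bool).

(** By [measurable_Rintegral_path] for the sigma-algebra generated by the
    process. *)
Lemma generated_other_time (N : R -> Omega -> nat) t n (B : set R) : 0 <= t ->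
  (forall (f : nat -> R) w, right_constant (fun s => f (N s w))) -> measurable B ->
  generated_sigma [set t : R | 0 <= t] N
    ([set w | N t w = n] `&` other_time N t @^-1` B).
Proof.
move=> t0 rN mB.
pose GG := [set A : set Omega | exists s x, [set t : R | 0 <= t] s /\ A = [set w | N s w = x]].
pose T := g_sigma_algebraType GG.
have mN s x : 0 <= s -> @measurable _ T [set w | N s w = x].
  by move=> s0; apply: sub_sigma_algebra; exists s, x.
have mN2 s (Q : nat -> nat -> Prop) : 0 <= s ->
    @measurable _ T [set w | Q (N s w) (N t w)].
  move=> s0.
  have -> : [set w | Q (N s w) (N t w)] = \bigcup_i \bigcup_j
      (if `[< Q i j >] then [set w | N s w = i] `&` [set w | N t w = j] else set0).
    apply/seteqP; split=> w /=.
      by move=> q; exists (N s w) => //; exists (N t w) => //; rewrite asboolT.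
    by move=> [i _ [j _]]; case: asboolP => // q [/= -> ->].
  apply: bigcupT_measurable => i; apply: bigcupT_measurable => j.
  by case: ifP => // _; apply: measurableI; exact: mN.
have mo : measurable_fun [set: T] (other_time N t : T -> R).
  apply: (@measurable_Rintegral_path _ _ T (fun s w => (odd (N s w) != odd (N t w))%:R) 1) => //.
  - move=> s s0 _ Y mY; rewrite setTI.
    exact: (mN2 s (fun a b => Y ((odd a != odd b)%:R))).
  - by move=> w; exact: (rN (fun a => (odd a != odd (N t w))%:R)).
  - by move=> s w; exact: normr_bool.
have := @measurableI _ T _ _ (mN t n t0) (mo measurableT B mB).
by rewrite setTI.
Qed.

Variable K : nat -> Omega -> 'I_4.

Lemma generated_prefix n (h : nat -> 'I_4) :
  generated_sigma [set: nat] K [set w | forall i, (i <= n)%N -> K i w = h i].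
Proof.
pose GG := [set A : set Omega | exists i x, [set: nat] i /\ A = [set w | K i w = x]].
pose T := g_sigma_algebraType GG.
have -> : [set w | forall i, (i <= n)%N -> K i w = h i] =
    \bigcap_i (if (i <= n)%N then [set w | K i w = h i] else [set: Omega]).
  apply/seteqP; split=> w /=.
    by move=> H i _; case: ifP => // /H.
  by move=> H i i_n; have := H i I; rewrite i_n.
suff : @measurable _ T (\bigcap_i (if (i <= n)%N then [set w | K i w = h i] else [set: Omega])) by [].
apply: bigcapT_measurable => i; case: ifP => _; last exact: measurableT.
by apply: sub_sigma_algebra; exists i, (h i).
Qed.

Hypothesis KP : direction_chain P K.

Lemma direction_set_measurable n (A : set 'I_4) : measurable [set w | A (K n w)].
Proof.
have -> : [set w | A (K n w)] = \bigcup_k (if `[< A k >] then [set w | K n w = k] else set0).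
  apply/seteqP; split=> w /=; first by move=> a; exists (K n w) => //; rewrite asboolT.
  by move=> [k _]; case: asboolP => // ak /= ->.
apply: countable_bigcupT_measurable => [|k]; first exact: countableP.
by case: ifP => // _; have [h _] := KP; exact: h.
Qed.

Lemma prefix_measurable n (h : nat -> 'I_4) :
  measurable [set w | forall i, (i <= n)%N -> K i w = h i].
Proof.
have -> : [set w | forall i, (i <= n)%N -> K i w = h i] =
    \bigcap_i (if (i <= n)%N then [set w | K i w = h i] else [set: Omega]).
  apply/seteqP; split=> w /=.
    by move=> H i _; case: ifP => // /H.
  by move=> H i i_n; have := H i I; rewrite i_n.
apply: bigcapT_measurable => i; case: ifP => _; last exact: measurableT.
by have [h' _] := KP; exact: h'.
Qed.

Lemma repeated_direction_negligible : P.-negligible [set w | exists n, K n.+1 w = K n w].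
Proof.
have H n : P.-negligible [set w | K n.+1 w = K n w].
  pose pre (h : {ffun 'I_n.+2 -> 'I_4}) := [set w | forall i, (i <= n.+1)%N -> K i w = h (inord i)].
  apply: (@negligible_countable _ _ _ _ {ffun 'I_n.+2 -> 'I_4} _
    (fun h => if h (inord n.+1) == h (inord n) then pre h else set0)).
    move=> h; case: ifPn => [hh|_]; last exact: negligible_set0.
    apply/negligibleP; first exact: (prefix_measurable n.+1 (fun i => h (inord i))).
    have [_ PK] := KP.
    apply: (eq_trans (PK n.+1 (fun i => h (inord i)))).
    by rewrite big_ord_recr/= hh !mulr0.
  move=> w /= e; exists [ffun i : 'I_n.+2 => K i w].
  rewrite !ffunE !inordK// e eqxx => i i_n.
  by rewrite ffunE inordK.
apply: negligibleS (negligible_bigcup H).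
by move=> w [n h]; exists n.
Qed.

(** The path that alternates between d_0 and d_1, indexed by its direction e
    after n switches. *)
Definition edge_path (e : bool) (n i : nat) : 'I_4 := inord (odd (n + i) (+) e).

Lemma edge_pathE e n i : edge_path e n i = (odd (n + i) (+) e) :> nat.
Proof. by rewrite /edge_path inordK//; case: (_ (+) _). Qed.

Lemma edge_path_probability e n :
  P [set w | forall i, (i <= n)%N -> K i w = edge_path e n i] = (4^-1 * 3^-1 ^+ n)%:E.
Proof.
have [_ ->] := KP; congr (_ * _)%:E.
rewrite -[in RHS](card_ord n) -prodr_const; apply: eq_bigr => i _.
case: ifP => // /eqP/(congr1 val) /=; rewrite !edge_pathE addnS /=.
by case: (odd _); case: e.
Qed.

Lemma edge_path_alternates w n : (forall i, K i.+1 w <> K i w) ->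
  (forall i, (i <= n)%N -> (K i w < 2)%N) ->
  exists e, forall i, (i <= n)%N -> K i w = edge_path e n i.
Proof.
move=> alt lt2.
have B i : (i <= n)%N -> exists b : bool, K i w = b :> nat.
  by move=> /lt2; case: (K i w : nat) => [|[|]] // _; [exists false|exists true].
have [e he] := B n (leqnn n).
exists e => i i_n; apply: val_inj; rewrite /= edge_pathE.
rewrite -(subKn i_n); have : (n - i <= n)%N by exact: leq_subr.
elim: (n - i)%N => [_|j IH jn].
  by rewrite subn0 he addnn odd_double.
have jn' : (n - j.+1).+1 = (n - j)%N by rewrite subnSK.
have := IH (ltnW jn); have := alt (n - j.+1)%N; rewrite jn'.
have [b hb] := B (n - j.+1)%N (leq_subr _ _).
have [b' hb'] := B (n - j)%N (leq_subr _ _).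
rewrite hb hb' => ne e1.
have nb : b' != b by apply/eqP => bb; apply: ne; apply: val_inj; rewrite /= hb hb' bb.
move: e1 nb; rewrite -jn' addnS /=.
by case: (odd _); case Ee : e; case Eb : b; case Eb' : b'.
Qed.

Lemma direction_along (k : 'I_4) :
  cos (k%:R * pi / 2) + sin (k%:R * pi / 2) = 1 - 2 * (1 < k)%N%:R :> R.
Proof.
case: k => -[|[|[|[|//]]]] h /=.
- by rewrite !mul0r cos0 sin0 mulr0 subr0 addr0.
- by rewrite !mul1r cos_pihalf sin_pihalf mulr0 subr0 add0r.
- rewrite mulrC mulrA mulVf// mul1r cospi sinpi; ring.
- have -> : 3 * pi / 2 = pi / 2 + pi :> R by field.
  by rewrite cosDpi sinDpi cos_pihalf sin_pihalf; ring.
Qed.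

Lemma direction_across (k : 'I_4) (b : bool) : k = b :> nat ->
  cos (k%:R * pi / 2) - sin (k%:R * pi / 2) = 1 - 2 * b%:R :> R.
Proof.
move=> ->; case: b => /=.
- by rewrite !mul1r cos_pihalf sin_pihalf; ring.
- by rewrite !mul0r cos0 sin0 mulr0 subr0.
Qed.

Variables (k : R -> R) (c : R) (N : R -> Omega -> nat) (X Y : R -> Omega -> R).
Hypothesis mk : measurable_fun [set: R] k.
Hypothesis k0 : forall s, 0 <= k s.
Hypothesis kc : forall s, 0 < s -> {for s, continuous k}.
Hypothesis ki : forall t, mu.-integrable `]0, t] (EFin \o k).
Hypothesis c_gt0 : 0 < c.
Hypothesis NP : poisson_process P (fun s => 3 * k s) N.
Hypothesis NK : independent_families P
  (generated_sigma [set t : R | 0 <= t] N) (generated_sigma [set: nat] K).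
Hypothesis XE : forall t w, 0 <= t -> X t w = c *
  \int[mu]_(s in `[0, t]) cos ((K (N s w) w)%:R * pi / 2).
Hypothesis YE : forall t w, 0 <= t -> Y t w = c *
  \int[mu]_(s in `[0, t]) sin ((K (N s w) w)%:R * pi / 2).

Lemma integrable_real_path (f : nat -> R) (B : R) t w : 0 < t -> (forall n, `|f n| <= B) ->
  mu.-integrable `[0, t] (EFin \o (fun u => f (N u w))).
Proof.
move=> t0 fB; apply: (@integrable_bounded_itv _ _ _ _ B); last by move=> x _; exact: fB.
apply/measurable_fun_itv_obnd_cbndP; apply: right_constant_measurable => //.
exact: (poisson_right_constant NP f w).
Qed.

Lemma cos_bound (x : R) : `|cos x| <= 1. Proof. by rewrite ler_norml cos_geN1 cos_le1. Qed.
Lemma sin_bound (x : R) : `|sin x| <= 1. Proof. by rewrite ler_norml sin_geN1 sin_le1. Qed.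

Lemma measurable_direction_integral (f : 'I_4 -> R) t : 0 <= t -> (forall j, `|f j| <= 1) ->
  measurable_fun [set: Omega] (fun w => \int[mu]_(s in `[0, t]) f (K (N s w) w)).
Proof.
move=> t0 f1; apply: (@measurable_Rintegral_path _ _ _ (fun s w => f (K (N s w) w)) 1) => //.
- move=> s s0 _ A mA; rewrite setTI.
  have -> : (fun w => f (K (N s w) w)) @^-1` A =
      \bigcup_n ([set w | N s w = n] `&` [set w | A (f (K n w))]).
    apply/seteqP; split=> w /=; first by move=> a; exists (N s w).
    by move=> [n _ [/= ->]].
  apply: bigcupT_measurable => n; apply: measurableI.
    exact: (poisson_set_measurable NP [set n] s0).
  exact: (direction_set_measurable n (fun j => A (f j))).
- by move=> w; exact: (poisson_right_constant NP (fun n => f (K n w)) w).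
Qed.

Lemma sum_coordinates t w : 0 < t ->
  X t w + Y t w = c * (t - 2 * \int[mu]_(s in `[0, t]) (1 < K (N s w) w)%N%:R).
Proof.
move=> t0; rewrite XE ?ltW// YE ?ltW// -mulrDr -RintegralD//; last 2 first.
- exact: (@integrable_real_path (fun n => cos ((K n w)%:R * pi / 2)) 1 t w t0 (fun n => cos_bound _)).
- exact: (@integrable_real_path (fun n => sin ((K n w)%:R * pi / 2)) 1 t w t0 (fun n => sin_bound _)).
congr (_ * _).
have := @path_integral_linear _ _ _ _ _ _ NP
  (fun n => cos ((K n w)%:R * pi / 2) + sin ((K n w)%:R * pi / 2)) (fun n => (1 < K n w)%N) 1 (- 2) t w (ltW t0).
rewrite mul1r mulNr; apply => i _; rewrite direction_along; ring.
Qed.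

Lemma difference_coordinates t w n e : 0 < t -> N t w = n ->
  (forall i, (i <= n)%N -> K i w = edge_path e n i) ->
  X t w - Y t w = (if e then - c else c) * (t - 2 * other_time N t w).
Proof.
move=> t0 Nt path; rewrite XE ?ltW// YE ?ltW// -mulrBr -RintegralB//; last 2 first.
- exact: (@integrable_real_path (fun n => cos ((K n w)%:R * pi / 2)) 1 t w t0 (fun n => cos_bound _)).
- exact: (@integrable_real_path (fun n => sin ((K n w)%:R * pi / 2)) 1 t w t0 (fun n => sin_bound _)).
pose sg : R := if e then - 1 else 1.
have := @path_integral_linear _ _ _ _ _ _ NP
  (fun n => cos ((K n w)%:R * pi / 2) - sin ((K n w)%:R * pi / 2))
  (fun i => odd i != odd (N t w)) sg (- 2 * sg) t w (ltW t0).
move=> -> => [|i]; last first.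
  rewrite Nt => i_n; rewrite (@direction_across _ (odd (n + i) (+) e)); last first.
    by rewrite path// edge_pathE.
  rewrite oddD /sg; case: (odd n); case: (odd i); case: e {path sg} => /=; ring.
rewrite /other_time /sg; case: e {path sg}; ring.
Qed.

Let edge_event t (A : set R) := [set w | X t w + Y t w = c * t /\ A (X t w - Y t w)].

Let switch_event t (A : set R) n e := [set w | N t w = n.+1] `&`
  [set w | A ((if e then - c else c) * (t - 2 * other_time N t w))].

Let path_event n e := [set w | forall i, (i <= n.+1)%N -> K i w = edge_path e n.+1 i].

Lemma measurable_edge_event t A : 0 < t -> measurable A -> measurable (edge_event t A).
Proof.
move=> t0 mA.
have mX : measurable_fun [set: Omega] (X t).
  have -> : X t = fun w => c * \int[mu]_(s in `[0, t]) cos ((K (N s w) w)%:R * pi / 2).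
    by apply/funext => w; rewrite XE// ltW.
  apply: measurable_funM => //.
  exact: (@measurable_direction_integral (fun j => cos (j%:R * pi / 2)) t (ltW t0) (fun j => cos_bound _)).
have mY : measurable_fun [set: Omega] (Y t).
  have -> : Y t = fun w => c * \int[mu]_(s in `[0, t]) sin ((K (N s w) w)%:R * pi / 2).
    by apply/funext => w; rewrite YE// ltW.
  apply: measurable_funM => //.
  exact: (@measurable_direction_integral (fun j => sin (j%:R * pi / 2)) t (ltW t0) (fun j => sin_bound _)).
have mS : measurable_fun [set: Omega] (fun w => X t w + Y t w) by exact: measurable_funD.
have mD : measurable_fun [set: Omega] (fun w => X t w - Y t w) by exact: measurable_funB.
have -> : edge_event t A = ((fun w => X t w + Y t w) @^-1` [set c * t]) `&`
    ((fun w => X t w - Y t w) @^-1` A) by [].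
apply: measurableI.
- by rewrite -[X in measurable X]setTI; apply: mS => //; exact: measurable_set1.
- by rewrite -[X in measurable X]setTI; exact: mD.
Qed.

Lemma measurable_switch_event t A n e : 0 < t -> measurable A -> measurable (switch_event t A n e).
Proof.
move=> t0 mA; apply: measurableI; first exact: (poisson_set_measurable NP [set n.+1] (ltW t0)).
have mo := measurable_other_time NP (ltW t0).
have m : measurable_fun [set: Omega] (fun w => (if e then - c else c) * (t - 2 * other_time N t w)).
  by apply: measurable_funM => //; apply: measurable_funB => //; exact: measurable_funM.
by rewrite -[X in measurable X]setTI; exact: m.
Qed.

(** The particle is on the edge exactly when it has used no direction but d_0
    and d_1, and then it alternates between them. A path without a switch ends
    at an end of the edge, which A does not contain. *)
Lemma edge_event_split t A w : 0 < t -> A `<=` `](- (c * t)), (c * t)[ ->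
  (forall i, (i <= N t w)%N -> exists s, [/\ 0 <= s, s < t & N s w = i]) ->
  (forall i, K i.+1 w <> K i w) ->
  edge_event t A w <-> exists n e, (switch_event t A n e `&` path_event n e) w.
Proof.
move=> t0 Arange visits alt.
have key : X t w + Y t w = c * t <-> forall i, (i <= N t w)%N -> (K i w < 2)%N.
  rewrite sum_coordinates//; split=> [h i /visits[s [s0 st <-]]|h].
    have I0 : \int[mu]_(s in `[0, t]) (1 < K (N s w) w)%N%:R = 0 :> R.
      by have := mulfI (lt0r_neq0 c_gt0) h; lra.
    have := (path_integral_eq0 NP (fun n => (1 < K n w)%N) w t0).1 I0 s s0 st.
    by rewrite -leqNgt.
  rewrite (path_integral_eq0 NP (fun n => (1 < K n w)%N) w t0).2 ?mulr0 ?subr0// => s s0 st.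
  by rewrite -leqNgt; apply: h; exact: (poisson_le NP _ s0 (ltW st)).
split=> [[/key lt2 Aw]|[n [e [[Nt Aw] path]]]].
- have [e path] := edge_path_alternates alt lt2.
  have D := difference_coordinates t0 erefl path.
  case Nt : (N t w) => [|n].
    have o0 : other_time N t w = 0.
      rewrite /other_time Nt; apply: (path_integral_eq0 NP (fun n => odd n != odd 0) w t0).2 => s s0 st.
      by have := poisson_le NP w s0 (ltW st); rewrite Nt leqn0 => /eqP->.
    exfalso; move: (Arange _ Aw); rewrite D o0 mulr0 subr0 /= in_itv/=.
    by case: (e); rewrite ?mulNr ltxx ?andbF.
  exists n, e; split; last by rewrite Nt in path.
  by split => //=; rewrite -D.
- split; first by apply/key => i; rewrite Nt => /path ->; rewrite edge_pathE; case: (_ (+) _).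
  by rewrite (difference_coordinates t0 Nt path).
Qed.

Lemma switch_path_probability t A n e : 0 < t -> measurable A ->
  P (switch_event t A n e `&` path_event n e) =
  ((4^-1 * 3^-1 ^+ n.+1)%:E * P (switch_event t A n e))%E.
Proof.
move=> t0 mA; rewrite NK.
- by rewrite muleC; congr (_ * _)%E; exact: edge_path_probability.
- apply: (@generated_other_time N t n.+1 [set y | A ((if e then - c else c) * (t - 2 * y))] (ltW t0)).
    by move=> f w; exact: (poisson_right_constant NP f w).
  rewrite -[X in measurable X]setTI.
  have m : measurable_fun [set: R] (fun y : R => (if e then - c else c) * (t - 2 * y)).
    by apply: measurable_funM => //; apply: measurable_funB => //; exact: measurable_funM.
  exact: m.
- exact: (generated_prefix n.+1 (edge_path e n.+1)).
Qed.

(** For either final direction, a path with n.+1 switches has probability 4^-1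
    * 3^-1 ^+ n.+1, which is the weight in [two_sided_law]. *)
Lemma edge_law t A : 0 < t -> measurable A -> A `<=` `](- (c * t)), (c * t)[ ->
  P [set w | X t w + Y t w = c * t /\ A (X t w - Y t w)] =
  (\int[mu]_(eta in A) (edge k c eta t)%:E)%E.
Proof.
move=> t0 mA Arange.
pose F n := (switch_event t A n false `&` path_event n false) `|`
  (switch_event t A n true `&` path_event n true).
have mP n e : measurable (path_event n e) by exact: prefix_measurable.
have mF n e : measurable (switch_event t A n e `&` path_event n e).
  by apply: measurableI => //; exact: measurable_switch_event.
have mFn n : measurable (F n) by exact: measurableU.
have N3 s : 0 <= 3 * k s by rewrite mulr_ge0.
have N3i s : mu.-integrable `]0, s] (EFin \o (fun u => 3 * k u)) by exact: integrable_EFinZ.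
transitivity (P (\bigcup_n F n)).
  apply: (probability_off_negligible (measurable_edge_event t0 mA) (bigcupT_measurable F mFn)
    (negligibleU (skipped_value_negligible N3 N3i NP t0) repeated_direction_negligible)).
  move=> w /not_orP[/contrapT visits /forallNP alt].
  rewrite (edge_event_split t0 Arange visits alt); split.
    by move=> [n [e h]]; exists n => //; case: e h => h; [right|left].
  by move=> [n _ [h|h]]; exists n; [exists false|exists true].
have tF : trivIset setT F.
  apply/trivIsetP => i j _ _ ij; apply/seteqP; split => // w [].
  have Nt h : F h w -> N t w = h.+1 by move=> [[[]]|[[]]].
  move=> /Nt hi /Nt hj; move: ij; by rewrite -eqSS -hi -hj eqxx.
rewrite (measure_semi_bigcup P mFn tF (bigcupT_measurable F mFn)).
have PF n : P (F n) = ((4^-1)%:E * ((3^-1 ^+ n.+1)%:E *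
   (P (switch_event t A n false) + P (switch_event t A n true))))%E.
  rewrite measureU//; last first.
    apply/seteqP; split => // w [[_ p1] [_ p2]].
    have := congr1 val (etrans (esym (p1 _ (leqnn _))) (p2 _ (leqnn _))).
    by rewrite /= !edge_pathE; case: (odd _).
  have E e := switch_path_probability n e t0 mA.
  apply: (eq_trans (congr2 (fun x y : \bar R => x + y)%E (E false) (E true))).
  by rewrite [RHS]muleA -EFinM [RHS]ge0_muleDr.
transitivity (\sum_(n <oo) ((4^-1)%:E * ((3^-1 ^+ n.+1)%:E *
   (P (switch_event t A n false) + P (switch_event t A n true)))))%E.
  by apply: eq_eseriesr => n _; exact: PF.
rewrite nneseriesZl; last by move=> n _; rewrite mule_ge0 ?adde_ge0// lee_fin.
have law := two_sided_law mk k0 ki (ltr0Sn R 2) NP kc t0 c_gt0 mA.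
rewrite (setIidl Arange) in law; rewrite law -ge0_integralZl//.
- apply: eq_integral => eta _; rewrite -EFinM; congr EFin.
  rewrite /edge /forward /backward /damping /char_u /char_v.
  by field; rewrite gt_eqF.
- apply/measurable_EFinP; exact: measurable_symmetric_density.
- by move=> x _; rewrite lee_fin mulr_ge0 ?addr_ge0 ?density_ge0// divr_ge0 ?expR_ge0// mulr_ge0// ltW.
Qed.
End motion_law.

(** * The law of the telegraph process *)

Section telegraph_law.
Context d (Omega : measurableType d) (R : realType) (P : probability Omega R).
Local Notation mu := (@lebesgue_measure R).
Implicit Types (s t x : R) (w : Omega) (n i : nat) (e : bool).
Variables (k : R -> R) (v : R) (N : R -> Omega -> nat) (V : Omega -> R) (S : R -> Omega -> R).
Hypothesis mk : measurable_fun [set: R] k.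
Hypothesis k0 : forall s, 0 <= k s.
Hypothesis k1 : C1_pos k.
Hypothesis ki : forall t, mu.-integrable `]0, t] (EFin \o k).
Hypothesis v_gt0 : 0 < v.
Hypothesis NP : poisson_process P k N.
Hypothesis V2 : forall w, V w = v \/ V w = - v.
Hypothesis mV : forall x, measurable [set w | V w = x].
Hypothesis PV : P [set w | V w = v] = (2^-1)%:E /\ P [set w | V w = - v] = (2^-1)%:E.
Hypothesis NV : independent_families P
  (generated_sigma [set t : R | 0 <= t] N) (generated_sigma [set: unit] (fun=> V)).
Hypothesis SE : forall t w, 0 <= t -> S t w =
  \int[mu]_(s in `[0, t]) (V w * (-1) ^+ N s w).
Local Notation G := (density k).
Local Notation K := (cumulative_rate k).

Let kc := rate_continuous k1.

Let NP1 : poisson_process P (fun s => 1 * k s) N.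
Proof. by apply: (@poisson_process_rate _ _ _ _ k) => // s _; rewrite mul1r. Qed.

Let mass : forall t, 0 < t -> (\int[mu]_(y in `]0%R, t[) total_density k (t - y)%R y < +oo)%E.
Proof. by move=> t t0; exact: (total_mass_lty mk k0 ki ltr01 NP1). Qed.

Definition telegraph_density x t : R :=
  if `|x| < v * t then expR (- K t) / (4 * v) *
    (G ((t + x / v) / 2) ((t - x / v) / 2) + G ((t - x / v) / 2) ((t + x / v) / 2))
  else 0.

Lemma telegraph_positionE t w : 0 <= t ->
  S t w = V w * (-1) ^+ N t w * (t - 2 * other_time N t w).
Proof.
move=> t0; rewrite SE//.
have := @path_integral_linear _ _ _ _ _ _ NP (fun n => V w * (-1) ^+ n)
  (fun i => odd i != odd (N t w)) (V w * (-1) ^+ N t w) (- 2 * (V w * (-1) ^+ N t w)) t w t0.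
move=> -> => [|i _]; first by rewrite /other_time; ring.
rewrite -signr_odd -[in RHS]signr_odd.
by case: (odd i); case: (odd (N t w)) => /=; ring.
Qed.

Let velocity e : R := if e then - v else v.

Let switch_event t (A : set R) n e := [set w | N t w = n] `&`
  [set w | A (velocity e * (t - 2 * other_time N t w))].

Let start_event n e := [set w | V w = velocity (odd n (+) e)].

Lemma velocity_flip n e : velocity (odd n (+) e) * (-1) ^+ n = velocity e.
Proof. by rewrite -signr_odd /velocity; case: (odd n); case: e => /=; ring. Qed.

Lemma measurable_telegraph_switch t A n e : 0 <= t -> measurable A ->
  measurable (switch_event t A n e).
Proof.
move=> t0 mA; apply: measurableI; first exact: (poisson_set_measurable NP [set n] t0).
have mo := measurable_other_time NP t0.
have m : measurable_fun [set: Omega] (fun w => velocity e * (t - 2 * other_time N t w)).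
  by apply: measurable_funM => //; apply: measurable_funB => //; exact: measurable_funM.
by rewrite -[X in measurable X]setTI; exact: m.
Qed.

Lemma telegraph_event_probability t A n e : 0 <= t -> measurable A ->
  P (switch_event t A n e `&` start_event n e) = ((2^-1)%:E * P (switch_event t A n e))%E.
Proof.
move=> t0 mA; rewrite NV.
- rewrite muleC; congr (_ * _)%E; rewrite /start_event /velocity.
  by case: PV => h1 h2; case: (_ (+) _); [exact: h2|exact: h1].
- apply: (@generated_other_time _ _ _ N t n [set y | A (velocity e * (t - 2 * y))] t0).
    by move=> f w; exact: (poisson_right_constant NP f w).
  rewrite -[X in measurable X]setTI.
  have m : measurable_fun [set: R] (fun y : R => velocity e * (t - 2 * y)).
    by apply: measurable_funM => //; apply: measurable_funB => //; exact: measurable_funM.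
  exact: m.
- exact: (@generated_fibre _ _ _ [set: unit] (fun=> V) tt).
Qed.

Lemma telegraph_split t A : 0 <= t ->
  [set w | A (S t w)] = \bigcup_n ((switch_event t A n false `&` start_event n false) `|`
    (switch_event t A n true `&` start_event n true)).
Proof.
move=> t0; apply/seteqP; split=> w /=.
- rewrite telegraph_positionE// => Aw.
  have [e Ve] : exists e, V w = velocity (odd (N t w) (+) e).
    case: (V2 w) => ->; rewrite /velocity.
      by exists (odd (N t w)); rewrite addbb.
    by exists (~~ odd (N t w)); rewrite addbN addbb.
  have H : (switch_event t A (N t w) e `&` start_event (N t w) e) w.
    by split => //; split => //=; rewrite -(velocity_flip (N t w)) -Ve.
  by exists (N t w) => //; case: e {Ve} H => H; [right|left].
- have H n e : (switch_event t A n e `&` start_event n e) w -> A (S t w).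
    move=> [[/= Nt Aw] Ve]; rewrite telegraph_positionE// Nt Ve.
    by rewrite velocity_flip.
  by move=> [n _ [/H|/H]].
Qed.

Lemma telegraph_sum t A : 0 <= t -> measurable A ->
  P [set w | A (S t w)] = (\sum_(n <oo) ((2^-1)%:E *
    (P (switch_event t A n false) + P (switch_event t A n true))))%E.
Proof.
move=> t0 mA; rewrite telegraph_split//.
have mF n e : measurable (switch_event t A n e `&` start_event n e).
  by apply: measurableI; [exact: measurable_telegraph_switch|exact: mV].
pose F n := (switch_event t A n false `&` start_event n false) `|`
    (switch_event t A n true `&` start_event n true).
have mFn n : measurable (F n) by exact: measurableU.
have tF : trivIset setT F.
  apply/trivIsetP => i j _ _ ij; apply/seteqP; split => // w [].
  have Nt h : F h w -> N t w = h by move=> [[[]]|[[]]].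
  by move=> /Nt hi /Nt hj; move: ij; rewrite -hi -hj eqxx.
rewrite (measure_semi_bigcup P mFn tF (bigcupT_measurable F mFn)).
apply: eq_eseriesr => n _; rewrite measureU//; last first.
  apply/seteqP; split => // w [[_ p1] [_ p2]].
  exfalso; have := etrans (esym p1) p2; have := v_gt0; rewrite /velocity.
  by case: (odd n) => /= h1 h2; lra.
have E e := telegraph_event_probability n e t0 mA.
apply: (eq_trans (congr2 (fun x y : \bar R => x + y)%E (E false) (E true))).
by rewrite ge0_muleDr.
Qed.

Let atom_weight t : {nonneg R} := NngNum (divr_ge0 (expR_ge0 (- K t)) (ler0n R 2)).

(** The contribution of the paths without a switch, which end at the two ends
    of the range. *)
Definition telegraph_atoms t : {measure set (measurableTypeR R) -> \bar R} :=
  measure_add (mscale (atom_weight t) (@dirac _ (measurableTypeR R) (v * t) R))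
              (mscale (atom_weight t) (@dirac _ (measurableTypeR R) (- v * t) R)).

Lemma telegraph_atomsE t A : telegraph_atoms t A =
  ((expR (- K t) / 2)%:E * (\1_A (v * t))%:E + (expR (- K t) / 2)%:E * (\1_A (- v * t))%:E)%E.
Proof. exact: measure_addE. Qed.

(** The final velocity is symmetric and independent of the clock, so the paths
    with a switch follow [two_sided_law] with weight 1. *)
Lemma telegraph_law t A : 0 < t -> measurable A ->
  P [set w | A (S t w)] =
  (\int[mu]_(x in A) (telegraph_density x t)%:E + telegraph_atoms t A)%E.
Proof.
move=> t0 mA; rewrite telegraph_sum ?ltW//.
have c0 n : (0 <= (2^-1)%:E * (P (switch_event t A n false) + P (switch_event t A n true)))%E.
  by rewrite mule_ge0// adde_ge0.
rewrite nneseries_recl// addeC; congr (_ + _)%E; last first.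
- have law := two_sided_law mk k0 ki ltr01 NP1 kc t0 v_gt0 mA.
  rewrite -[in LHS]nneseries_addn; last by move=> n; exact: c0.
  transitivity ((2^-1)%:E * (\sum_(n <oo) (1^-1 ^+ n.+1)%:E *
    (P ([set w | N t w = n.+1] `&` [set w | A (v * (t - 2 * other_time N t w))%R]) +
     P ([set w | N t w = n.+1] `&` [set w | A (- v * (t - 2 * other_time N t w))%R]))))%E.
    rewrite -nneseriesZl; last by move=> n _; rewrite mule_ge0 ?adde_ge0// lee_fin invr1 expr1n.
    by apply: eq_eseriesr => n _; rewrite addn1 invr1 expr1n mul1e.
  have mAI : measurable (A `&` `](- (v * t)), (v * t)[) by apply: measurableI.
  rewrite law -ge0_integralZl//; last 2 first.
  + apply/measurable_EFinP; exact: measurable_symmetric_density.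
  + by move=> x _; rewrite lee_fin mulr_ge0 ?addr_ge0 ?density_ge0// divr_ge0 ?expR_ge0// mulr_ge0// ltW.
  rewrite integral_mkcond [RHS]integral_mkcond; apply: eq_integral => x _.
  rewrite !patchE in_setI /telegraph_density; case: (x \in A) => //=.
  have -> : (x \in (`](- (v * t)), (v * t)[%classic : set R)) = (`|x| < v * t).
    by rewrite ltr_norml; apply/idP/idP; rewrite inE/= in_itv.
  case: ifP => // _; rewrite -EFinM; congr EFin; rewrite mul1r; field.
  by rewrite gt_eqF.
- rewrite telegraph_atomsE.
  have H e : P (switch_event t A 0 e) = ((expR (- K t))%:E * (\1_A (velocity e * t))%:E)%E.
    have PN : P [set w | N t w = 0%N] = (expR (- K t))%:E.
      have := poisson_incr ki NP 0 (lexx 0) (ltW t0).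
      rewrite cumulative_rate0 subr0 expr0 fact0 divr1 mul1r => <-.
      by congr (P _); apply/seteqP; split=> w /=; rewrite (poisson0 NP) subn0.
    have o0 w : N t w = 0%N -> other_time N t w = 0.
      move=> Nt; rewrite /other_time Nt.
      apply: (path_integral_eq0 NP (fun n => odd n != odd 0) w t0).2 => s s0 st.
      by have := poisson_le NP w s0 (ltW st); rewrite Nt leqn0 => /eqP->.
    rewrite indicE; case: (boolP (_ \in A)) => h.
      rewrite mule1 -PN; congr (P _); apply/seteqP; split=> w /=; first by case.
      by move=> Nt; split => //=; rewrite o0// mulr0 subr0; rewrite inE in h.
    rewrite mule0 -[RHS](@measure0 _ _ _ P); congr (P _); apply/seteqP; split=> w //=.
    by move=> [/= Nt]; rewrite o0// mulr0 subr0 => Aw; move: h; rewrite notin_setE.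
  rewrite !H /velocity; move: (\1_A (v * t)) (\1_A (- v * t)) (expR _) => x y z.
  have E (a b e : R) : (2^-1%:E * (e%:E * a%:E + e%:E * b%:E) = (e / 2)%:E * a%:E + (e / 2)%:E * b%:E)%E.
    by rewrite -!EFinM -!EFinD; congr EFin; ring.
  exact: E.
Qed.
End telegraph_law.

(** * Uniqueness of continuous densities *)

Lemma near_eq_continuous (T U : topologicalType) (f g : T -> U) (x : T) :
  (\forall y \near x, f y = g y) -> {for x, continuous f} -> {for x, continuous g}.
Proof.
move=> fg cf; rewrite /prop_for /continuous_at -(nbhs_singleton fg).
by apply: cvg_trans cf; exact: near_eq_cvg.
Qed.

Section continuous_density.
Context {R : realType}.
Local Notation mu := (@lebesgue_measure R).
Implicit Types (f g : R -> R) (r x y : R).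

(** If f x > g x, the integrals of f and g over a short interval around x
    deprived of Z differ. *)
Lemma continuous_density_le (f g : R -> R) (r : R) (Z : set R) :
  measurable Z -> mu Z = 0%E ->
  (forall x, `|x| < r -> {for x, continuous f}) ->
  (forall x, `|x| < r -> {for x, continuous g}) ->
  (forall A : set R, measurable A -> A `<=` `](- r), r[ -> A `&` Z = set0 ->
    (\int[mu]_(x in A) (f x)%:E = \int[mu]_(x in A) (g x)%:E)%E) ->
  forall x, `|x| < r -> f x <= g x.
Proof.
move=> mZ Z0 cf cg fg x xr; rewrite leNgt; apply/negP => gf.
pose e := (f x - g x) / 3; have e0 : 0 < e by rewrite divr_gt0// subr_gt0.
have [d1 d10 h1] := (continuous_epsP _ _).1 (cf x xr) _ e0.
have [d2 d20 h2] := (continuous_epsP _ _).1 (cg x xr) _ e0.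
have [d [d0 dd1 dd2 dr]] : exists d, [/\ 0 < d, d <= d1, d <= d2 & d <= r - `|x|].
  exists (Num.min d1 (Num.min d2 (r - `|x|))).
  by rewrite !lt_min d10 d20 subr_gt0 xr !ge_min !lexx !orbT.
pose J : set R := `](x - d), (x + d)[%classic.
have JE y : J y -> `|y - x| < d.
  by rewrite /J/= in_itv/= ltr_norml => /andP[? ?]; apply/andP; split; lra.
have mJ : measurable J by exact: measurable_itv.
pose A := J `\` Z; have mA : measurable A by exact: measurableD.
have Ar : A `<=` `](- r), r[.
  move=> y [/JE yx _]; rewrite /= in_itv/= -ltr_norml.
  by have := ler_normD (y - x) x; rewrite subrK; lra.
have AZ : A `&` Z = set0 by apply/seteqP; split=> // y [[_ nZ] Zy].
have mfA : measurable_fun A f.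
  apply: (@measurable_funS _ _ _ _ `](- r), r[) => //.
  apply: open_continuous_measurable_fun; first exact: interval_open.
  by move=> y; rewrite inE/= in_itv/= -ltr_norml; exact: cf.
have mgA : measurable_fun A g.
  apply: (@measurable_funS _ _ _ _ `](- r), r[) => //.
  apply: open_continuous_measurable_fun; first exact: interval_open.
  by move=> y; rewrite inE/= in_itv/= -ltr_norml; exact: cg.
have muJ : mu J = (2 * d)%:E.
  rewrite /J; transitivity (mu `](x - d)%R, (x + d)%R[%classic) => //.
  rewrite lebesgue_measure_itv/= lte_fin ifT; last by lra.
  by rewrite -EFinB; congr EFin; ring.
have muA_le : (mu A <= (2 * d)%:E)%E.
  by rewrite -muJ; apply: le_measure; rewrite ?inE//; exact: subDsetl.
have muA_ge : ((2 * d)%:E <= mu A)%E.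
  rewrite -muJ; apply: (@le_trans _ _ (mu (A `|` Z))).
    apply: le_measure; rewrite ?inE//; first exact: measurableU.
    by move=> y Jy; have [Zy|nZ] := pselect (Z y); [right|left].
  have H : (mu (A `|` Z) <= mu A + mu Z)%E by exact: measureU2.
  by rewrite Z0 adde0 in H.
have muA : mu A = (2 * d)%:E by apply/eqP; rewrite eq_le muA_le.
have finA : (mu A < +oo)%E by rewrite muA ltry.
have fb y : A y -> f x - e <= f y <= f x + e.
  move=> [/JE yx _]; have := h1 y (lt_le_trans yx dd1).
  by rewrite ltr_norml => /andP[? ?]; apply/andP; split; lra.
have gb y : A y -> g x - e <= g y <= g x + e.
  move=> [/JE yx _]; have := h2 y (lt_le_trans yx dd2).
  by rewrite ltr_norml => /andP[? ?]; apply/andP; split; lra.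
have intf : mu.-integrable A (EFin \o f).
  apply: (@integrable_bounded _ _ _ mu _ _ (`|f x| + e)) => // y /fb.
  have := ler_norm (f x); have := ler_norm (- f x); rewrite normrN => ? ? /andP[? ?].
  by rewrite ler_norml; apply/andP; split; lra.
have intg : mu.-integrable A (EFin \o g).
  apply: (@integrable_bounded _ _ _ mu _ _ (`|g x| + e)) => // y /gb.
  have := ler_norm (g x); have := ler_norm (- g x); rewrite normrN => ? ? /andP[? ?].
  by rewrite ler_norml; apply/andP; split; lra.
have intc (a : R) : mu.-integrable A (EFin \o (fun=> a)).
  by apply: (@integrable_bounded _ _ _ mu _ _ `|a|).
have I1 : (\int[mu]_(y in A) (f x - e)%:E <= \int[mu]_(y in A) (f y)%:E)%E.
  apply: le_integral => //; first exact: intc.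
  by move=> y; rewrite inE => /fb /andP[]; rewrite lee_fin.
have I2 : (\int[mu]_(y in A) (g y)%:E <= \int[mu]_(y in A) (g x + e)%:E)%E.
  apply: le_integral => //; first exact: intc.
  by move=> y; rewrite inE => /gb /andP[]; rewrite lee_fin.
have := le_trans I1 (le_trans (eq_ind _ (fun z => (z <= \int[mu]_(y in A) (g y)%:E)%E) (lexx _) _ (esym (fg A mA Ar AZ))) I2).
rewrite !integral_cst// -[X in ((_ * X <= _ * X)%E)]/(mu A) muA -!EFinM lee_fin ler_pM2r; last by rewrite mulr_gt0.
by rewrite /e; lra.
Qed.

Lemma continuous_density_unique (f g : R -> R) (r : R) (Z : set R) :
  measurable Z -> mu Z = 0%E ->
  (forall x, `|x| < r -> {for x, continuous f}) ->
  (forall x, `|x| < r -> {for x, continuous g}) ->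
  (forall A : set R, measurable A -> A `<=` `](- r), r[ -> A `&` Z = set0 ->
    (\int[mu]_(x in A) (f x)%:E = \int[mu]_(x in A) (g x)%:E)%E) ->
  forall x, `|x| < r -> f x = g x.
Proof.
move=> mZ Z0 cf cg fg x xr; apply/eqP; rewrite eq_le.
rewrite (continuous_density_le mZ Z0 cf cg fg)//=.
by apply: (continuous_density_le mZ Z0 cg cf _ xr) => A mA Ar AZ; rewrite fg.
Qed.
End continuous_density.

Section density_versions.
Context d (Omega : measurableType d) (R : realType) (P : probability Omega R).
Local Notation mu := (@lebesgue_measure R).

Lemma edge_density_unique (c : R) (X Y : R -> Omega -> R) (f g : R -> R -> R) :
  0 < c -> edge_density P c X Y f -> edge_density P c X Y g -> cone_agree c f g.
Proof.
move=> c0 hf hg eta t h; have t0 := cone_time_gt0 c0 h.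
have [cf lf] := hf t t0; have [cg lg] := hg t t0.
apply: (continuous_density_unique (measurable0 : measurable (set0 : set R)) _ cf cg _ h).
  exact: measure0.
by move=> A mA Ar _; rewrite -lf// lg.
Qed.

Lemma agree_edge_density (c : R) (X Y : R -> Omega -> R) (f g : R -> R -> R) :
  cone_agree c f g -> edge_density P c X Y f -> edge_density P c X Y g.
Proof.
move=> fg hf t t0; have [cf lf] := hf t t0; split.
- by move=> eta h; exact: (near_eq_continuous (agree_near_eta fg h) (cf eta h)).
- move=> A mA Ar; rewrite lf//; apply: eq_integral => eta; rewrite inE => /Ar.
  by rewrite /= in_itv/= -ltr_norml => /fg ->.
Qed.

(** Off the two null sets that carry the singular parts, both densities
    integrate to the probabilities of the law. *)
Lemma ac_component_unique (v : R) (S : R -> Omega -> R) (p q : R -> R -> R) :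
  0 < v -> ac_component P v S p -> ac_component P v S q -> cone_agree v p q.
Proof.
move=> v0 hp hq x t h; have t0 := cone_time_gt0 v0 h.
have [cp mp [nu [[Z [mZ Z0 nuZ]] lp]]] := hp t t0.
have [cq mq [nu' [[Z' [mZ' Z'0 nuZ']] lq]]] := hq t t0.
apply: (@continuous_density_unique _ (p^~ t) (q^~ t) (v * t) (Z `|` Z')) => //.
- exact: measurableU.
- have H : (mu (Z `|` Z') <= mu Z + mu Z')%E by exact: measureU2.
  rewrite Z0 Z'0 adde0 in H; apply/eqP; rewrite eq_le H /=.
  exact: measure_ge0.
- move=> A mA _ AZ.
  have sub (m : {measure set (measurableTypeR R) -> \bar R}) (W : set R) : measurable W ->
      W `<=` Z `|` Z' -> m (~` W) = 0%E -> m A = 0%E.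
    move=> mW WZ m0; apply/eqP; rewrite -measure_le0 -m0; apply: le_measure; rewrite ?inE//.
      exact: measurableC.
    by move=> y Ay Wy; suff : (set0 : set R) y by []; rewrite -AZ; split => //; exact: WZ.
  have := lp A mA; rewrite lq// (sub nu Z mZ (@subsetUl _ _ _) nuZ).
  by rewrite (sub nu' Z' mZ' (@subsetUr _ _ _) nuZ') !adde0.
Qed.
End density_versions.

(** * The density solves the problem *)

Section transfer.
Context {R : realType}.
Local Notation mu := (@lebesgue_measure R).
Implicit Types (c : R) (l : R -> R) (f g : R -> R -> R).

Lemma cone_near c (p : R * R) : 0 < c -> cone c p -> \forall q \near p, cone c q.
Proof.
case: p => x s c0; rewrite /cone/= => h; have c1 : 0 < 1 + c by rewrite addr_gt0.
have [d d0 hd] : exists2 d : R, 0 < d & d + c * d = c * s - `|x|.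
  exists ((c * s - `|x|) / (1 + c)); first by rewrite divr_gt0// subr_gt0.
  by field; rewrite gt_eqF.
apply/nbhs_ballP; exists d => //; case=> y r [/=]; rewrite /ball/= => hx hs.
have h1 := ler_normD (y - x) x; rewrite subrK distrC in h1.
have h2 := ler_wpM2l (ltW c0) (ltW hs).
have h3 := ler_wpM2l (ltW c0) (ler_norm (s - r)).
by rewrite /cone/=; move: h3; rewrite mulrBr; lra.
Qed.

Lemma agree_solves_problem c l f g : 0 < c -> cone_agree c f g ->
  solves_problem c l f -> solves_problem c l g.
Proof.
move=> c0 fg [[cf Df] Cf f0 mf]; split.
- split=> [p hp|phi hphi].
    apply: near_eq_continuous (cf p hp).
    by apply: filterS (cone_near c0 hp) => -[x s] /= h; exact: fg.
  rewrite -[RHS](Df phi hphi); apply: eq_Rintegral => -[x s]; rewrite inE => h.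
  by rewrite /= (fg _ _ h).
- by move=> l2; exact: agree_pde_classical fg (Cf l2).
- by move=> eta t h; rewrite -fg// f0.
- move=> t t0; rewrite -mf//; apply: eq_integral => eta.
  by rewrite inE/= in_itv/= -ltr_norml => h; rewrite fg.
Qed.
End transfer.

Section edge_solution.
Context d (Omega : measurableType d) (R : realType) (P : probability Omega R).
Local Notation mu := (@lebesgue_measure R).
Variables (k l : R -> R) (c : R) (N : R -> Omega -> nat).
Hypothesis mk : measurable_fun [set: R] k.
Hypothesis k0 : forall s : R, 0 <= k s.
Hypothesis k1 : C1_pos k.
Hypothesis ki : forall t : R, mu.-integrable `]0, t] (EFin \o k).
Hypothesis l1 : C1_pos l.
Hypothesis lk : forall t : R, 0 < t -> l t = 3 * k t.
Hypothesis c_gt0 : 0 < c.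
Hypothesis NP : poisson_process P (fun s => 3 * k s) N.
Implicit Types (s t eta : R).

Let kc := rate_continuous k1.
Let three_gt0 : (0 : R) < 3. Proof. by rewrite ltr0n. Qed.
Let mass := total_mass_lty mk k0 ki three_gt0 NP.

Lemma cumulative_rate_triple t : cumulative_rate l t = 3 * cumulative_rate k t.
Proof.
rewrite -(cumulative_rateZ 3 ki); apply: eq_Rintegral => s.
by rewrite inE/= in_itv/= => /andP[s0 _]; exact: lk.
Qed.

Lemma edge_ge0 eta t : 0 <= edge k c eta t.
Proof.
by rewrite divr_ge0 ?addr_ge0 ?mulr_ge0 ?expR_ge0 ?density_ge0// ltW.
Qed.

(** The two-sided law on the whole line, evaluated by [poisson_mass]. *)
Lemma edge_mass t : 0 < t ->
  (\int[mu]_(eta in `](- (c * t))%R, (c * t)%R[) (edge k c eta t)%:E)%E =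
  (2^-1 * (expR (- (2 * cumulative_rate l t / 3)) - expR (- cumulative_rate l t)))%:E.
Proof.
move=> t0; rewrite cumulative_rate_triple; set K := cumulative_rate k t.
have law := two_sided_law mk k0 ki three_gt0 NP kc t0 c_gt0 (measurableT : measurable [set: R]).
rewrite setTI in law.
transitivity ((4^-1)%:E * (\int[mu]_(x in `](- (c * t))%R, (c * t)%R[)
     (expR (- (3 * K)) / (2 * c) *
      (density k ((t + x / c) / 2) ((t - x / c) / 2) +
       density k ((t - x / c) / 2) ((t + x / c) / 2)))%:E))%E.
  rewrite -ge0_integralZl//.
  - apply: eq_integral => eta _; rewrite -EFinM; congr EFin.
    rewrite /edge /forward /backward /damping /char_u /char_v -/K.
    by field; rewrite gt_eqF.
  - apply/measurable_EFinP; exact: measurable_symmetric_density.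
  - by move=> x _; rewrite lee_fin mulr_ge0 ?addr_ge0 ?density_ge0// divr_ge0 ?expR_ge0// mulr_ge0// ltW.
rewrite -law.
transitivity ((4^-1)%:E * ((2%:E * (expR (- (3 * K)) * (expR K - 1))%:E)))%E.
  congr (_ * _)%E; rewrite -(poisson_mass k0 ki three_gt0 NP t0) -nneseriesZl; last first.
    by move=> n _; rewrite mule_ge0// lee_fin exprn_ge0// invr_ge0.
  apply: eq_eseriesr => n _; rewrite !setIT muleCA; congr (_ * _)%E.
  by rewrite -mule2n muleC mule_natr.
rewrite -!EFinM; congr EFin.
have -> : - (2 * (3 * K) / 3) = - (3 * K) + K by field.
by rewrite expRD; field.
Qed.

Lemma edge_solves_problem : solves_problem c l (edge k c).
Proof.
have kl t : 0 < t -> k t = 3^-1 * l t by move=> /lk ->; rewrite mulrA mulVf// mul1r.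
have [_ lk'] := C1_pos_scale lk k1.
split.
- have l' t (t0 : 0 < t) := C1_pos_is_derive l1 t0.
  have H := edge_pde_distributional mk k0 k1 ki mass c_gt0 l' lk lk'.
  refine H.
- move=> [_ l2]; apply: (edge_pde mk k0 k1 ki mass c_gt0 lk lk').
  have kl' t : 0 < t -> k^`()%classic t = 3^-1 * l^`()%classic t.
    by move=> /lk' ->; rewrite mulrA mulVf// mul1r.
  by have [] := C1_pos_scale kl' l2.
- by move=> eta t _; exact: edge_ge0.
- exact: edge_mass.
Qed.

Lemma edge_eta_continuous eta t : `|eta| < c * t -> {for eta, continuous ((edge k c)^~ t)}.
Proof.
by move=> h; have [_ D] := edge_derive mk k0 k1 ki mass c_gt0 h; exact: is_derive_continuous D.
Qed.

Lemma motion_edge_density (K : nat -> Omega -> 'I_4) (X Y : R -> Omega -> R) :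
  direction_chain P K ->
  independent_families P (generated_sigma [set t : R | 0 <= t] N) (generated_sigma [set: nat] K) ->
  (forall t w, 0 <= t -> X t w = c * \int[mu]_(s in `[0, t]) cos ((K (N s w) w)%:R * pi / 2)) ->
  (forall t w, 0 <= t -> Y t w = c * \int[mu]_(s in `[0, t]) sin ((K (N s w) w)%:R * pi / 2)) ->
  edge_density P c X Y (edge k c).
Proof.
move=> KP NK XE YE t t0; split; first by move=> eta; exact: edge_eta_continuous.
by move=> A mA Ar; exact: (edge_law KP mk k0 kc ki c_gt0 NP NK XE YE t0 mA Ar).
Qed.

(** Both processes have the same switch densities. They differ by the rate of
    the clock, which gives the exponential factor, by the probability of the
    initial directions, and by the scale of length. *)
Lemma telegraph_density_edge eta t : `|eta| < c * t ->
  telegraph_density k (c / 2) (eta / 2) t = 4 * expR (2 * cumulative_rate k t) * edge k c eta t.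
Proof.
move=> h; rewrite /telegraph_density.
have -> : `|eta / 2| < c / 2 * t.
  by rewrite normrM (ger0_norm (_ : (0 : R) <= 2^-1))// mulrAC ltr_pM2r.
have E1 : eta / 2 / (c / 2) = eta / c by field; rewrite gt_eqF.
rewrite E1 /edge /forward /backward /damping /char_u /char_v; set K := cumulative_rate k t.
have -> : - K = 2 * K + - (3 * K) by ring.
by rewrite expRD; field; rewrite gt_eqF.
Qed.

Lemma telegraph_density_continuous (x t : R) : `|x| < c / 2 * t ->
  {for x, continuous (fun y : R => telegraph_density k (c / 2) y t)}.
Proof.
move=> h; have c2 : 0 < c / 2 by rewrite divr_gt0.
have h2 y : `|y| < c / 2 * t -> `|2 * y| < c * t.
  by rewrite normrM (ger0_norm (_ : (0 : R) <= 2))// => hy; rewrite mulrC -ltr_pdivlMr// mulrAC.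
apply: (@near_eq_continuous R R (fun y : R => 4 * expR (2 * cumulative_rate k t) * edge k c (2 * y) t : R)).
  apply: filterS (cone_near_eta h) => y hy.
  rewrite -(telegraph_density_edge (h2 y hy)).
  by rewrite (_ : 2 * y / 2 = y); last by field.
apply: cvgM; first exact: cvg_cst.
apply: (@cvg_comp _ _ _ (fun y : R => 2 * y) ((edge k c)^~ t) _ (nbhs (2 * x))).
  by apply: cvgM; [exact: cvg_cst|exact: cvg_id].
exact: edge_eta_continuous (h2 x h).
Qed.

Lemma measurable_telegraph_density v t : measurable_fun [set: R] ((telegraph_density k v)^~ t).
Proof.
apply: measurable_fun_ifT => //.
- apply: measurable_fun_ltr => //; exact: measurableT_comp.
- exact: measurable_symmetric_density.
Qed.

Lemma telegraph_ac_component d' (Omega' : measurableType d') (P' : probability Omega' R)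
    (S : R -> Omega' -> R) : telegraph_process P' (c / 2) k S ->
  ac_component P' (c / 2) S (telegraph_density k (c / 2)).
Proof.
move=> [N' [V [NP' V2 [mV PV] NV SE]]] t t0.
have c2 : 0 < c / 2 by rewrite divr_gt0.
split.
- by move=> x; exact: telegraph_density_continuous.
- exact: measurable_telegraph_density.
- exists (telegraph_atoms k (c / 2) t); split.
    exists ([set c / 2 * t] `|` [set - (c / 2) * t]); split.
    + by apply: measurableU; exact: measurable_set1.
    + apply: measure_negligible; first by apply: measurableU; exact: measurable_set1.
      by apply: negligibleU; apply/negligibleP => //; exact: lebesgue_measure_set1.
    + rewrite telegraph_atomsE !indicE !memNset ?mule0 ?adde0//.
      * by apply; right.
      * by apply; left.
  move=> A mA; exact: (telegraph_law mk k0 k1 ki c2 NP' V2 mV PV NV SE t0 mA).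
Qed.

Lemma telegraph_solution d' (Omega' : measurableType d') (P' : probability Omega' R)
    (S : R -> Omega' -> R) (p : R -> R -> R) : telegraph_process P' (c / 2) k S ->
  ac_component P' (c / 2) S p ->
  cone_agree c (edge k c)
    (fun eta t => expR (- (2 * cumulative_rate l t / 3)) / 4 * p (eta / 2) t).
Proof.
move=> TP hp eta t h; have c2 : 0 < c / 2 by rewrite divr_gt0.
have h2 : `|eta / 2| < c / 2 * t.
  by rewrite normrM (ger0_norm (_ : (0 : R) <= 2^-1))// mulrAC ltr_pM2r.
rewrite (ac_component_unique c2 hp (telegraph_ac_component TP) h2) telegraph_density_edge//.
rewrite cumulative_rate_triple; set K := cumulative_rate k t.
have -> : - (2 * (3 * K) / 3) = - (2 * K) by field.
have e0 := expR_gt0 (2 * K); rewrite expRN.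
by move: (expR _) (edge _ _ _ _) e0 => x y x0; field; rewrite gt_eqF.
Qed.
End edge_solution.

Theorem proposition3p1 (R : realType) (d : measure_display)
    (Omega : measurableType d) (P : probability Omega R)
    (c : R) (l : R -> R) (X Y : R -> Omega -> R)
    (c_gt0 : 0 < c)
    (l_ge0 : forall t : R, 0 < t -> 0 <= l t)
    (l_C1 : C1_pos l)
    (l_int : forall t : R, 0 < t ->
       (\int[lebesgue_measure]_(s in `]0%R, t]) (l s)%:E < +oo)%E)
    (XY_motion : reflecting_motion P c l X Y) :
  (exists f, edge_density P c X Y f) /\
  (forall f, edge_density P c X Y f -> solves_problem c l f) /\
  (forall (d' : measure_display) (Omega' : measurableType d')
      (P' : probability Omega' R) (S : R -> Omega' -> R),
    telegraph_process P' (c / 2) (fun t => l t / 3) S ->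
    (exists p, ac_component P' (c / 2) S p) /\
    (forall p, ac_component P' (c / 2) S p ->
       let f := fun eta t =>
         expR (- (2 * cumulative_rate l t / 3)) / 4 * p (eta / 2) t in
       solves_problem c l f /\ edge_density P c X Y f)).
Proof.
case: XY_motion => N [K [NP KP NK XE YE]].
(* Nothing is known of l on the negative half-line. *)
pose k s : R := if 0 < s then 3^-1 * l s else 0.
have kl s : 0 < s -> k s = 3^-1 * l s by rewrite /k => ->.
have lk s : 0 < s -> l s = 3 * k s by move=> /kl ->; rewrite mulrA divff// mul1r.
have k0 s : 0 <= k s by rewrite /k; case: ifPn => // s0; rewrite mulr_ge0// l_ge0.
have [k1 _] := C1_pos_scale kl l_C1.
have mk : measurable_fun [set: R] k.
  apply: pos_continuous_measurable => [s s0|s s0]; first exact: rate_continuous.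
  by rewrite /k ltNge s0.
have ki t : (@lebesgue_measure R).-integrable `]0, t] (EFin \o k).
  have [t0|t0] := leP t 0.
    by rewrite set_itv_ge ?bnd_simp -?leNgt//; exact: integrable_set0.
  apply/integrableP; split; first by apply/measurable_EFinP; exact: measurable_funTS.
  apply: le_lt_trans (l_int t t0).
  apply: ge0_le_integral => //.
  - by apply/measurable_EFinP; apply: measurable_funTS; exact: measurableT_comp.
  - apply: (@eq_measurable_fun _ _ _ _ _ (EFin \o (fun s => 3 * k s))).
      by move=> s; rewrite inE/= in_itv/= => /andP[s0 _]; rewrite lk.
    by apply/measurable_EFinP; apply: measurable_funTS; exact: measurable_funM.
  - move=> s; rewrite /= in_itv/= => /andP[s0 _].
    rewrite lee_fin ger0_norm// lk//; have := k0 s; lra.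
have NP3 : poisson_process P (fun s => 3 * k s) N by exact: poisson_process_rate NP.
have D := motion_edge_density mk k0 k1 ki c_gt0 NP3 KP NK XE YE.
have solves := edge_solves_problem mk k0 k1 ki l_C1 lk c_gt0 NP3.
split; first by exists (edge k c).
split=> [f hf|d' Omega' P' S [N' [V [NP' V2 V3 NV SE]]]].
  exact: agree_solves_problem c_gt0 (edge_density_unique c_gt0 D hf) solves.
have TP : telegraph_process P' (c / 2) k S.
  exists N', V; split => //; apply: poisson_process_rate NP' => s s0.
  by rewrite kl// mulrC.
have ac := telegraph_ac_component mk k0 k1 ki c_gt0 NP3 TP.
split; first by exists (telegraph_density k (c / 2)); refine ac.
move=> p hp f; have ag := telegraph_solution mk k0 k1 ki lk c_gt0 NP3 TP hp.
split; first exact: agree_solves_problem c_gt0 ag solves.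
exact: agree_edge_density ag D.
Qed.
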